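(* Let $m\in\mathbb Z^+$, $\gamma\in\Delta_m$, $W_0\in\mathcal B^{\gamma,*}$. Let $H$ be a finite $d$-regular graph and let $\tau=t(H,\cdot)$. If $t(H,W_0)<t^\tau_{\max}(\tilde{\mathcal W}_\Omega)$, then there exists $\delta>0$ such that every $t\in[t(H,W_0),(1+\delta)t(H,W_0))$ is in the symmetric regime for $W_0$ and $t(H,\cdot)$. Moreover, for such $t$, every minimizer $\tilde h$ of $\min\{J_{W_0}(\tilde f):\tilde f\in\tilde{\mathcal W},\ t(H,\tilde f)\ge t\}$ has a representative $h\in\mathcal B^\gamma$ with $$J_{W_0}(\tilde h)=I_{W_0}(h)=\min\{I_{W_0}(g):g\in\mathcal B^\gamma,\ t(H,g)\ge t\}.$$
   Context: A graphon is a measurable symmetric function $f:[0,1]^2\to[0,1]$; $\mathcal W$ is the set of graphons. $d_\square(f,g)=\sup_{S,T\subseteq[0,1]}\left|\int_{S\times T}(f-g)\right|$ over measurable $S,T$; $\delta_\square(f,g)=\inf_{\phi}d_\square(f,g^\phi)$ over bijective Lebesgue-measure-preserving $\phi:[0,1]\to[0,1]$, where $g^\phi(x,y)=g(\phi(x),\phi(y))$. $\tilde f$ is the class of $f$ under $f\sim g\iff\delta_\square(f,g)=0$, and $\tilde{\mathcal W}=\mathcal W/\!\sim$ with metric $\delta_\square$ (a compact metric space). For a finite simple graph $H$ on $v$ vertices, $t(H,f)=\int_{[0,1]^v}\prod_{(i,j)\in E(H)}f(x_i,x_j)\,dx_1\cdots dx_v$; it is well defined and continuous on $\tilde{\mathcal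 W}$. $\Delta_m=\{\gamma\in[0,1]^m\cap\mathbb Q^m:\sum_i\gamma_i=1\}$. For $\gamma\in\Delta_m$ let $I_1=[0,\gamma_1]$, $I_j=(\sum_{k<j}\gamma_k,\sum_{k\le j}\gamma_k]$ for $j\ge 2$. $\mathcal B^\gamma$ is the set of graphons that are constant, equal to some $p_{ij}=p_{ji}\in[0,1]$, on each $I_i\times I_j$. $\mathcal B^{\gamma,*}$ is the set of $f\in\mathcal B^\gamma$ with $f\notin\mathcal B^\eta$ for all $\eta\in\Delta_{m-1}$. $\tilde{\mathcal B}^\gamma$ is the set of $\tilde f\in\tilde{\mathcal W}$ with $\delta_\square(\tilde f,g)=0$ for some $g\in\mathcal B^\gamma$. $h_p(u)=u\log\frac up+(1-u)\log\frac{1-u}{1-p}$ (with $0\log0=0$, $0\log(0/0)=0$, value $+\infty$ if $p\in\{0,1\}$, $u\ne p$); $I_{W_0}(f)=\frac12\int_{[0,1]^2}h_{W_0(x,y)}(f(x,y))\,dx\,dy$; $\Omega=\{W_0\in(0,1)\}$; $\mathcal W_\Omega$ is the set of graphons equal to $W_0$ a.e. on $\Omega^c$; $\tilde{\mathcal W}_\Omega$ is the set of classes $\tilde f$ with $\delta_\square(\tilde f,g)=0$ for some $g\in\mathcal W_\Omega$. $J_{W_0}(\tilde f)=\sup_{\eta>0}\inf\{I_{W_0}(h):h\in\mathcal W,\delta_\square(\tilde f,h)\le\eta\}$ if $\tilde f\in\tilde{\mathcal W}_\Omega$ and $\infty$ otherwise. $t^\tau_{\max}(\tilde{\mathcal W}_\Omega)=\max_{\tilde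 f\in\tilde{\mathcal W}_\Omega}\tau(\tilde f)$. Symmetric regime: for $W_0\in\mathcal B^{\gamma,*}$ and a continuous graph parameter $\tau$, a value $t\le t^\tau_{\max}(\tilde{\mathcal W}_\Omega)$ is in the symmetric regime for $W_0$ and $\tau$ if all minimizers $\tilde g$ of $\min\{J_{W_0}(\tilde f):\tilde f\in\tilde{\mathcal W},\tau(\tilde f)\ge t\}$ satisfy $\tilde g\in\tilde{\mathcal B}^\gamma$. *)

(* Defs.v *)
From HB Require Import structures.
From mathcomp Require Import all_boot all_order all_algebra.
From mathcomp Require Import all_classical all_reals all_analysis.

Set Implicit Arguments.
Unset Strict Implicit.
Unset Printing Implicit Defensive.

Import Order.TTheory GRing.Theory Num.Theory.

Local Open Scope classical_set_scope.
Local Open Scope ring_scope.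

(* "Measurable" means Borel measurable throughout (Borel sets of R, and the
   product sigma-algebra on R * R). *)
Section Graphons.
Context {R : realType}.

Local Notation mu := (@lebesgue_measure R).
Local Notation mu2 := (mu \x mu)%E.

Definition unitI : set R := [set x | 0 <= x <= 1].
Definition unitI2 : set (R * R) := unitI `*` unitI.

(* Kernels are total functions on R * R; only their values on the unit square
   are constrained by, or enter into, the definitions below. *)
Definition graphon : set (R * R -> R) :=
  [set f : R * R -> R | [/\ measurable_fun unitI2 f,
     (forall x y, unitI x -> unitI y -> f (x, y) = f (y, x)) &
     (forall z, unitI2 z -> 0 <= f z <= 1)]].

Definition cut_metric (f g : R * R -> R) : R :=
  sup [set r | exists S T : set R,
    [/\ measurable S, measurable T, S `<=` unitI, T `<=` unitI &
        r = `| \int[mu2]_(z in S `*` T) (f z - g z) | ]].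

Definition mpbij : set (R -> R) :=
  [set phi : R -> R | [/\ set_bij unitI unitI phi, measurable_fun unitI phi &
     forall A : set R, measurable A -> A `<=` unitI ->
       mu (unitI `&` phi @^-1` A) = mu A]].

Definition relabel (g : R * R -> R) (phi : R -> R) : R * R -> R :=
  fun z => g (phi z.1, phi z.2).

Definition cut_dist (f g : R * R -> R) : R :=
  inf [set cut_metric f (relabel g phi) | phi in mpbij].

(* The quotient of the space of graphons, as a set of equivalence classes. *)
Definition class_of (f : R * R -> R) : set (R * R -> R) :=
  [set g : R * R -> R | graphon g /\ cut_dist f g = 0].

Definition qgraphon : set (set (R * R -> R)) := class_of @` graphon.

(* Functions on the quotient are evaluated at a chosen representative; those
   used here do not depend on the choice. *)
Definition lift {T : Type} (F : (R * R -> R) -> T) (c : set (R * R -> R)) : T :=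
  F (xget (fun=> 0) c).

Definition qcut_dist (c : set (R * R -> R)) (g : R * R -> R) : R :=
  lift (cut_dist^~ g) c.

(* The n-fold iterated integral over the unit cube. *)
Fixpoint cube_integral (n : nat) : (n.-tuple R -> R) -> R :=
  match n with
  | 0 => fun F => F [tuple]
  | n'.+1 => fun F =>
      \int[mu]_(x in unitI) cube_integral (fun s => F (cons_tuple x s))
  end.

Definition simple_graph v (e : rel 'I_v) : Prop := symmetric e /\ irreflexive e.

Definition regular_graph v (d : nat) (e : rel 'I_v) : Prop :=
  forall i, #|[set j | e i j]%SET| = d.

Definition hom_density v (e : rel 'I_v) (f : R * R -> R) : R :=
  cube_integral (fun x : v.-tuple R =>
    \prod_(ij : 'I_v * 'I_v | (ij.1 < ij.2)%N && e ij.1 ij.2)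
      f (tnth x ij.1, tnth x ij.2)).

Definition rat_simplex m (gam : 'I_m -> rat) : Prop :=
  (forall i, 0 <= gam i <= 1) /\ \sum_(i < m) gam i = 1.

Definition partial_sum m (gam : 'I_m -> rat) (k : nat) : R :=
  ratr (\sum_(i < m | (i < k)%N) gam i).

Definition block m (gam : 'I_m -> rat) (j : 'I_m) : set R :=
  [set x | (if j == 0%N :> nat then 0 <= x else partial_sum gam j < x)
           && (x <= partial_sum gam j.+1)].

Definition block_graphon m (gam : 'I_m -> rat) : set (R * R -> R) :=
  [set f : R * R -> R | graphon f /\ exists p : 'I_m -> 'I_m -> R,
     [/\ forall i j, p i j = p j i,
         forall i j, 0 <= p i j <= 1 &
         forall i j x y, block gam i x -> block gam j y -> f (x, y) = p i j]].

Definition block_graphon_star m (gam : 'I_m -> rat) : set (R * R -> R) :=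
  [set f : R * R -> R | block_graphon gam f /\
     forall eta : 'I_m.-1 -> rat, rat_simplex eta -> ~ block_graphon eta f].

Definition qblock_graphon m (gam : 'I_m -> rat) : set (set (R * R -> R)) :=
  [set c | qgraphon c /\ exists2 g, block_graphon gam g & qcut_dist c g = 0].

(* For 0 < p < 1 the convention 0 log 0 = 0 is built in, since ln 0 = 0. *)
Definition rel_entropy (p u : R) : \bar R :=
  (if (0 < p < 1)%R
   then (u * ln (u / p) + (1 - u) * ln ((1 - u) / (1 - p)))%R%:E
   else if u == p then 0 else +oo)%E.

Definition rate (W0 f : R * R -> R) : \bar R :=
  ((2^-1)%:E * \int[mu2]_(z in unitI2) rel_entropy (W0 z) (f z))%E.

Definition Omega (W0 : R * R -> R) : set (R * R) :=
  [set z | unitI2 z /\ 0 < W0 z < 1].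

Definition graphon_Omega (W0 : R * R -> R) : set (R * R -> R) :=
  [set f : R * R -> R | graphon f /\
     {ae mu2, forall z, (unitI2 `\` Omega W0) z -> f z = W0 z}].

Definition qgraphon_Omega (W0 : R * R -> R) : set (set (R * R -> R)) :=
  [set c | qgraphon c /\ exists2 g, graphon_Omega W0 g & qcut_dist c g = 0].

Definition qrate (W0 : R * R -> R) (c : set (R * R -> R)) : \bar R :=
  if `[< qgraphon_Omega W0 c >] then
    ereal_sup [set ereal_inf [set rate W0 h |
                 h in [set h | graphon h /\ qcut_dist c h <= eta]]
              | eta in [set eta : R | 0 < eta]]
  else +oo%E.

(* The maximum of tau over the quotient of W_Omega; it is attained when tau is
   continuous, by compactness. *)
Definition tmax (W0 : R * R -> R) (tau : (R * R -> R) -> R) : R :=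
  sup [set lift tau c | c in qgraphon_Omega W0].

Definition minimizer (W0 : R * R -> R) (tau : (R * R -> R) -> R) (t : R) :
    set (set (R * R -> R)) :=
  [set c | [/\ qgraphon c, t <= lift tau c &
     forall c', qgraphon c' -> t <= lift tau c' ->
       (qrate W0 c <= qrate W0 c')%E]].

Definition symmetric_regime m (gam : 'I_m -> rat) (W0 : R * R -> R)
    (tau : (R * R -> R) -> R) (t : R) : Prop :=
  t <= tmax W0 tau /\ minimizer W0 tau t `<=` qblock_graphon gam.

Definition is_min (A : set (\bar R)) (v : \bar R) : Prop := A v /\ lbound A v.

End Graphons.

(* Main.v *)
Require Import Defs.
From HB Require Import structures.
From mathcomp Require Import all_boot all_order all_algebra.
From mathcomp Require Import all_classical all_reals all_analysis.
From mathcomp Require Import measurable_realfun lra ring.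

Import Order.TTheory GRing.Theory Num.Theory numFieldNormedType.Exports.

(** Let [p] be the matrix of block values of [W0]. For a graphon [h], let [q] be
    the matrix of its block norms: the [d]-th power of its entry at [(i, j)] is
    the average of [h ^+ d] over the block with indices [i] and [j]. The proof
    compares [h] with the step graphon of values [q].

    - Passing to [q] does not decrease the density. As every vertex of [H] lies
      on exactly [d] edges, Hoelder's inequality with exponent [d], applied to
      one variable after the other, bounds the density of [h] by that of the
      step graphon ([hom_density_le_block_norm]).
    - Passing to [q] does not increase the rate when [q] is close to [p]. Read
      as a function of [u ^+ d], the relative entropy lies above its tangent at
      every point near [p], with a quadratic term to spare
      ([entropy_support]). Integrating the tangents over the blocks bounds the
      rate of [h] from below by the rate of a step graphon plus a multiple of
      the squared L2 distance to it ([rate_tangent]). If the rate of [h] is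
      small, then [q] is close to [p] ([rate_small_near]).

    A minimizer has small rate when [t] is just above the density of [W0],
    since there are competitors: raising [W0] towards 1 on [Omega] by the
    fraction [s] costs a rate of order [s ^+ 2] and gains density
    ([ex_cheap_block]). The gain is positive because the graphon with [s = 1]
    has the largest density among those that agree with [W0] off [Omega]
    ([hom_density_Omega_le]), and by assumption [W0] does not attain it.

    The rate of the class of a minimizer is a limit of the rates of graphons
    [h n] approaching the class in cut distance. Let [r] be a cluster point of
    their block norms. By the first comparison and the continuity of the
    density ([counting_lemma]), the step graphon of values [r] satisfies the
    constraint, so its rate is at least the minimum. By the second comparison
    it is at most the minimum, and then the quadratic term forces [h n] to
    converge to it in L2 along a subsequence. So the step graphon represents
    the minimizer ([minimizer_block]).

    Two degenerate situations need care. Where [W0] is 0 or 1 the entropy is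
    infinite off that value, so a finite rate pins the graphon there
    ([rect_dist_null]). And the rate of a class is defined through a chosen
    representative, so the rate of a block graphon bounds that of its class
    only because [cut_dist] is symmetric; this rests on the Borel
    measurability of the inverse of a Borel bijection, the Lusin--Souslin
    theorem ([measurable_image_bij]). *)

Set Implicit Arguments.
Unset Strict Implicit.
Unset Printing Implicit Defensive.

Local Open Scope classical_set_scope.
Local Open Scope ring_scope.

(** * Integrals of bounded measurable functions over the unit interval *)

Section BoundedMeasurable.
Context {R : realType}.

Definition bmeas {d} {T : measurableType d} (f : T -> R) : Prop :=
  measurable_fun setT f /\ exists M : R, forall x, `|f x| <= M.

Section ops.
Context {d} {T : measurableType d}.
Implicit Types f g : T -> R.

Lemma bmeas_cst (c : R) : bmeas (fun _ : T => c).
Proof. by split=> //; exists `|c|. Qed.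

Lemma bmeasD f g : bmeas f -> bmeas g -> bmeas (fun x => f x + g x).
Proof.
move=> [mf [M fM]] [mg [N gN]]; split; first exact: measurable_funD.
by exists (M + N) => x; rewrite (le_trans (ler_normD _ _)) // lerD.
Qed.

Lemma bmeasN f : bmeas f -> bmeas (fun x => - f x).
Proof.
move=> [mf [M fM]]; split; first exact: measurableT_comp.
by exists M => x; rewrite normrN.
Qed.

Lemma bmeasB f g : bmeas f -> bmeas g -> bmeas (fun x => f x - g x).
Proof. by move=> bf bg; apply: bmeasD => //; exact: bmeasN. Qed.

Lemma bmeasM f g : bmeas f -> bmeas g -> bmeas (fun x => f x * g x).
Proof.
move=> [mf [M fM]] [mg [N gN]]; split; first exact: measurable_funM.
by exists (M * N) => x; rewrite normrM ler_pM.
Qed.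

Lemma bmeas_norm f : bmeas f -> bmeas (fun x => `|f x|).
Proof.
move=> [mf [M fM]]; split; first exact: measurableT_comp.
by exists M => x; rewrite normr_id.
Qed.

Lemma bmeasX f n : bmeas f -> bmeas (fun x => f x ^+ n).
Proof.
move=> bf; elim: n => [|n IHn].
  by under eq_fun do rewrite expr0; exact: bmeas_cst.
by under eq_fun do rewrite exprS; exact: bmeasM.
Qed.

Lemma bmeas_sum (I : Type) (s : seq I) (P : pred I) (F : I -> T -> R) :
  (forall i, P i -> bmeas (F i)) -> bmeas (fun x => \sum_(i <- s | P i) F i x).
Proof.
move=> bF; elim: s => [|i s IHs].
  by under eq_fun do rewrite big_nil; exact: bmeas_cst.
under eq_fun do rewrite big_cons.
by case Pi: (P i) => //; apply: bmeasD => //; exact: bF.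
Qed.

Lemma bmeas_prod (I : Type) (s : seq I) (P : pred I) (F : I -> T -> R) :
  (forall i, P i -> bmeas (F i)) -> bmeas (fun x => \prod_(i <- s | P i) F i x).
Proof.
move=> bF; elim: s => [|i s IHs].
  by under eq_fun do rewrite big_nil; exact: bmeas_cst.
under eq_fun do rewrite big_cons.
by case Pi: (P i) => //; apply: bmeasM => //; exact: bF.
Qed.

Lemma bmeas_indic (A : set T) : measurable A -> bmeas (\1_A : T -> R).
Proof.
move=> mA; split; first exact: measurable_indic.
by exists 1 => x; rewrite indicE; case: (_ \in _) => /=; rewrite ?normr1 ?normr0.
Qed.

Lemma bmeas_comp {d'} {T' : measurableType d'} (f : T' -> R) (g : T -> T') :
  bmeas f -> measurable_fun setT g -> bmeas (fun x => f (g x)).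
Proof.
move=> [mf [M fM]] mg; split; first exact: measurableT_comp.
by exists M => x; exact: fM.
Qed.

End ops.

Local Notation mu := (@lebesgue_measure R).
Local Notation mu2 := (mu \x mu)%E.

Definition Ex (f : R -> R) : R := \int[mu]_(x in unitI) f x.

Lemma unitIE : @unitI R = `[0, 1]%classic.
Proof. by apply/seteqP; split=> x /=; rewrite in_itv. Qed.

Lemma measurable_unitI : measurable (@unitI R).
Proof. by rewrite unitIE. Qed.
Hint Resolve measurable_unitI : core.

Lemma mu_unitI : mu (@unitI R) = 1%E.
Proof. by rewrite unitIE lebesgue_measure_itv /= lte01 oppr0 adde0. Qed.

Lemma measurable_unitI2 : measurable (@unitI2 R).
Proof. exact: measurableX. Qed.
Hint Resolve measurable_unitI2 : core.

Lemma mu2_unitI2 : mu2 (@unitI2 R) = 1%E.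
Proof. by rewrite product_measure1E // [X in (X * X)%E]mu_unitI mule1. Qed.

Lemma integrable_bmeas {d} {T : measurableType d}
    (m : {measure set T -> \bar R}) (D : set T) (f : T -> R) :
  measurable D -> (m D < +oo)%E -> bmeas f -> m.-integrable D (EFin \o f).
Proof.
move=> mD Doo [mf [M fM]]; apply: measurable_bounded_integrable => //.
  exact: measurable_funTS.
exists M; split; first exact: num_real.
by move=> y My x _ /=; apply: le_trans (fM x) (ltW My).
Qed.

Lemma integrable_bmeas_patch {d} {T : measurableType d}
    (m : {measure set T -> \bar R}) (D : set T) (f : T -> R) :
  measurable D -> (m D < +oo)%E -> bmeas f ->
  m.-integrable setT (EFin \o (f \_ D)).
Proof.
move=> mD Doo bf; rewrite -restrict_EFin -integrable_mkcond //.
exact: integrable_bmeas.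
Qed.

Lemma integrable_Ex (f : R -> R) :
  bmeas f -> mu.-integrable (@unitI R) (EFin \o f).
Proof. by move=> bf; apply: integrable_bmeas => //; rewrite [X in (X < _)%E]mu_unitI ltry. Qed.

Lemma eq_Ex (f g : R -> R) : {in unitI, f =1 g} -> Ex f = Ex g.
Proof. by move=> fg; rewrite /Ex; exact: eq_Rintegral. Qed.

Lemma ExD f g : bmeas f -> bmeas g -> Ex (fun x => f x + g x) = Ex f + Ex g.
Proof. by move=> bf bg; rewrite /Ex RintegralD //; exact: integrable_Ex. Qed.

Lemma ExZ c f : bmeas f -> Ex (fun x => c * f x) = c * Ex f.
Proof. by move=> bf; rewrite /Ex RintegralZl //; exact: integrable_Ex. Qed.

Lemma Ex_cst c : Ex (fun=> c) = c.
Proof. by rewrite /Ex Rintegral_cst // [X in fine X]mu_unitI /= mulr1. Qed.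

Lemma ExN f : bmeas f -> Ex (fun x => - f x) = - Ex f.
Proof.
move=> bf; rewrite -mulN1r -ExZ //; congr Ex.
by apply/funext => x; rewrite mulN1r.
Qed.

Lemma le_Ex f g : bmeas f -> bmeas g -> (forall x, unitI x -> f x <= g x) ->
  Ex f <= Ex g.
Proof. by move=> bf bg fg; apply: le_Rintegral => //; exact: integrable_Ex. Qed.

Lemma Ex_ge0 f : (forall x, unitI x -> 0 <= f x) -> 0 <= Ex f.
Proof. by move=> f0; rewrite /Ex; exact: Rintegral_ge0. Qed.

Lemma ler_norm_Ex f : bmeas f -> `|Ex f| <= Ex (fun x => `|f x|).
Proof. by move=> bf; apply: le_normr_Rintegral => //; exact: integrable_Ex. Qed.

Lemma Ex_norm_le f M : bmeas f -> (forall x, unitI x -> `|f x| <= M) ->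
  `|Ex f| <= M.
Proof.
move=> bf fM; apply: le_trans (ler_norm_Ex bf) _; rewrite -[leRHS](Ex_cst M).
by apply: le_Ex => //; [exact: bmeas_norm|exact: bmeas_cst].
Qed.

Lemma Ex_sum (I : Type) (s : seq I) (P : pred I) (F : I -> R -> R) :
  (forall i, P i -> bmeas (F i)) ->
  Ex (fun x => \sum_(i <- s | P i) F i x) = \sum_(i <- s | P i) Ex (F i).
Proof.
move=> bF; elim: s => [|i s IHs].
  rewrite big_nil -[RHS](Ex_cst 0); congr Ex.
  by apply/funext => x; rewrite big_nil.
rewrite big_cons; under [X in Ex X]eq_fun do rewrite big_cons.
by case Pi: (P i) => //; rewrite ExD ?IHs//; [exact: bF|exact: bmeas_sum].
Qed.

Lemma Ex_bmeas {d} {T : measurableType d} (F : T * R -> R) :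
  bmeas F -> bmeas (fun t => Ex (fun y => F (t, y))).
Proof.
move=> bF; have [mF [M FM]] := bF.
have bFt t : bmeas (fun y => F (t, y)).
  by apply: bmeas_comp => //; exact: measurableT_comp.
split; last by exists M => t; apply: Ex_norm_le.
pose G (z : T * R) : \bar R := ((F z + M) * \1_(@unitI R) z.2)%:E.
have mG : measurable_fun setT G.
  apply/measurable_EFinP; apply: measurable_funM.
    exact: measurable_funD.
  by apply: measurableT_comp => //; exact: measurable_indic.
have G0 z : (0 <= G z)%E.
  rewrite lee_fin mulr_ge0 ?indicE ?ler0n //.
  by move: (FM z); rewrite ler_norml => /andP[+ _]; lra.
have := measurable_fun_fubini_tonelli_F (m2 := mu) G mG G0.
move=> mFG.
have -> : (fun t => Ex (fun y => F (t, y))) =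
    (fun t => fine (fubini_F mu G t) - M).
  apply/funext => t.
  have -> : fine (fubini_F mu G t) = Ex (fun y => F (t, y) + M).
    rewrite /Ex Rintegral_mkcond /Rintegral /fubini_F; congr fine.
    apply: eq_integral => y _; rewrite /G patchE indicE /=.
    by case: ifP => _; rewrite ?mulr1 ?mulr0.
  by rewrite ExD ?Ex_cst ?addrK//; exact: bmeas_cst.
apply: measurable_funB => //.
exact: measurableT_comp.
Qed.

Lemma mu2_rect_lty (S T : set R) :
  measurable S -> measurable T -> S `<=` unitI -> T `<=` unitI ->
  (mu2 (S `*` T) < +oo)%E.
Proof.
move=> mS mT SU TU.
apply: (@le_lt_trans _ _ (mu2 (@unitI2 R))); last first.
  by rewrite [X in (X < _)%E]mu2_unitI2 ltry.
apply: le_measure; rewrite ?inE//; first exact: measurableX.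
by move=> [x y] [/= /SU ? /TU].
Qed.

Lemma integral_rectE (S T : set R) (F : R * R -> R) :
  measurable S -> measurable T -> S `<=` unitI -> T `<=` unitI -> bmeas F ->
  \int[mu2]_(z in S `*` T) F z =
  Ex (fun x => \1_S x * Ex (fun y => \1_T y * F (x, y))).
Proof.
move=> mS mT SU TU bF.
pose G (z : R * R) := \1_S z.1 * (\1_T z.2 * F z) : R.
have GE : G = (F \_ (S `*` T)).
  apply/funext => -[x y]; rewrite /G patchE !indicE /= in_setX /=.
  by case: (x \in S) => /=; case: (y \in T); rewrite ?mul1r ?mul0r.
have iG : mu2.-integrable setT (EFin \o G).
  rewrite GE; apply: integrable_bmeas_patch => //; first exact: measurableX.
  exact: mu2_rect_lty.
rewrite Rintegral_mkcond -GE /Rintegral -integral12_prod_meas1 //.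
rewrite /Ex Rintegral_mkcond /Rintegral; congr fine.
apply: eq_integral => x _; rewrite /fubini_F.
pose K (y : R) : R := \1_T y * F (x, y).
have bT : bmeas K.
  apply: bmeasM; first exact: bmeas_indic.
  by apply: bmeas_comp => //; exact: measurableT_comp.
rewrite patchE; case: ifPn => xU; last first.
  rewrite integral0_eq // => y _ /=; rewrite /G indicE /=.
  by rewrite memNset ?mul0r // => /SU; move: xU; rewrite notin_setE.
have -> : (fun y => (G (x, y))%:E) =
    (fun y => (\1_S x)%:E * (EFin \o (K \_ unitI)) y)%E.
  apply/funext => y /=; rewrite /G /= -EFinM; congr (_ * _)%:E.
  rewrite patchE; case: ifPn => // yU; rewrite indicE memNset ?mul0r //.
  by move=> /TU; move: yU; rewrite notin_setE.
rewrite integralZl //; last first.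
  by apply: integrable_bmeas_patch => //; rewrite [X in (X < _)%E]mu_unitI ltry.
rewrite EFinM; congr (_ * _)%E.
rewrite -restrict_EFin -integral_mkcond fineK //.
by apply: integrable_fin_num => //; exact: integrable_Ex.
Qed.

Lemma Ex_bmeas1 {d} {T : measurableType d} (F : T * R -> R) t :
  bmeas F -> bmeas (fun y => F (t, y)).
Proof. by move=> bF; apply: bmeas_comp => //; exact: measurableT_comp. Qed.

Lemma integral_unitI2E (F : R * R -> R) : bmeas F ->
  \int[mu2]_(z in unitI2) F z = Ex (fun x => Ex (fun y => F (x, y))).
Proof.
move=> bF; rewrite /unitI2 integral_rectE //; apply: eq_Ex => x xU.
rewrite indicE xU mul1r; apply: eq_Ex => y yU.
by rewrite indicE yU mul1r.
Qed.

Lemma Ex_swap (F : R * R -> R) : bmeas F ->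
  Ex (fun x => Ex (fun y => F (x, y))) = Ex (fun y => Ex (fun x => F (x, y))).
Proof.
move=> bF.
pose G (z : R * R) := F z * (\1_unitI z.1 * \1_unitI z.2).
have GE : G = (F \_ (unitI `*` unitI)).
  apply/funext => -[x y]; rewrite /G patchE !indicE /= in_setX /=.
  by case: (x \in _) => /=; case: (y \in _); rewrite ?mulr1 ?mulr0 ?mul0r ?mulr0.
have iG : mu2.-integrable setT (EFin \o G).
  rewrite GE; apply: integrable_bmeas_patch => //.
  exact: mu2_rect_lty.
have := Fubini (m1 := mu) (m2 := mu) iG.
have aux (H : R -> R -> R) (K : R -> R -> R) :
  (forall x, bmeas (K x)) ->
  (forall x y, H x y = if (x \in unitI) && (y \in unitI) then K x y else 0) ->
  (\int[mu]_x \int[mu]_y (H x y)%:E = \int[mu]_(x in unitI) (Ex (K x))%:E)%E.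
  move=> bK HK; rewrite [RHS]integral_mkcond; apply: eq_integral => x _.
  rewrite patchE; case: ifPn => xU; last first.
    by rewrite integral0_eq // => y _; rewrite HK (negbTE xU).
  rewrite /Ex /Rintegral fineK; last first.
    by apply: integrable_fin_num => //; exact: integrable_Ex.
  rewrite [RHS]integral_mkcond; apply: eq_integral => y _.
  by rewrite patchE HK xU /=; case: ifP.
have bF' : forall y, bmeas (fun x => F (x, y)).
  by move=> y; apply: bmeas_comp => //; exact: measurableT_comp.
rewrite (aux (fun x y => G (x, y)) (fun x y => F (x, y))); last 2 first.
- by move=> x; exact: Ex_bmeas1.
- by move=> x y; rewrite GE patchE in_setX.
rewrite (aux (fun y x => G (x, y)) (fun y x => F (x, y)) bF'); last first.
  by move=> x y; rewrite GE patchE in_setX andbC.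
by move=> eqF; rewrite /Ex /Rintegral in eqF *; rewrite eqF.
Qed.

End BoundedMeasurable.
#[global] Hint Resolve measurable_unitI measurable_unitI2 : core.

(** * Iterated integrals over the unit square *)

Section DoubleIntegral.
Context {R : realType}.
Implicit Types F G : R * R -> R.

Definition Ex2 F : R := Ex (fun x => Ex (fun y => F (x, y))).

Lemma Ex2D F G : bmeas F -> bmeas G -> Ex2 (fun z => F z + G z) = Ex2 F + Ex2 G.
Proof.
move=> bF bG; rewrite /Ex2 -ExD; [|exact: (Ex_bmeas bF)|exact: (Ex_bmeas bG)].
by congr Ex; apply/funext => x; rewrite -ExD; [|exact: (Ex_bmeas1 x bF)|exact: (Ex_bmeas1 x bG)].
Qed.

Lemma Ex2Z c F : bmeas F -> Ex2 (fun z => c * F z) = c * Ex2 F.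
Proof.
move=> bF; rewrite /Ex2 -ExZ; last exact: (Ex_bmeas bF).
by congr Ex; apply/funext => x; rewrite -ExZ //; exact: (Ex_bmeas1 x bF).
Qed.

Lemma Ex2_cst c : Ex2 (fun=> c) = c.
Proof. by rewrite /Ex2 !Ex_cst. Qed.

Lemma Ex2_sum (I : Type) (s : seq I) (H : I -> R * R -> R) : (forall i, bmeas (H i)) ->
  Ex2 (fun z => \sum_(i <- s) H i z) = \sum_(i <- s) Ex2 (H i).
Proof.
move=> bH; elim: s => [|i s IHs].
  by rewrite big_nil -[RHS](Ex2_cst 0); congr Ex2; apply/funext => z; rewrite big_nil.
rewrite big_cons -IHs -Ex2D; [|exact: bH|exact: bmeas_sum].
by congr Ex2; apply/funext => z; rewrite big_cons.
Qed.

Lemma le_Ex2 F G : bmeas F -> bmeas G -> (forall z, unitI2 z -> F z <= G z) ->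
  Ex2 F <= Ex2 G.
Proof.
move=> bF bG FG; apply: le_Ex; [exact: (Ex_bmeas bF)|exact: (Ex_bmeas bG)|move=> x Ux].
apply: le_Ex; [exact: (Ex_bmeas1 x bF)|exact: (Ex_bmeas1 x bG)|move=> y Uy].
exact: FG.
Qed.

Lemma eq_Ex2 F G : (forall z, unitI2 z -> F z = G z) -> Ex2 F = Ex2 G.
Proof.
by move=> FG; apply: eq_Ex => x /set_mem Ux; apply: eq_Ex => y /set_mem Uy; exact: FG.
Qed.

Lemma Ex2_ge0 F : (forall z, unitI2 z -> 0 <= F z) -> 0 <= Ex2 F.
Proof. by move=> F0; apply: Ex_ge0 => x Ux; apply: Ex_ge0 => y Uy; exact: F0. Qed.

Lemma ler_norm_Ex2 F : bmeas F -> `|Ex2 F| <= Ex2 (fun z => `|F z|).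
Proof.
move=> bF; have bN : bmeas (fun z => `|F z|) by exact: bmeas_norm.
apply: le_trans (ler_norm_Ex _) _; first exact: (Ex_bmeas bF).
apply: le_Ex; [by apply: bmeas_norm; exact: (Ex_bmeas bF)|exact: (Ex_bmeas bN)|].
by move=> x _; apply: ler_norm_Ex; exact: (Ex_bmeas1 x bF).
Qed.

End DoubleIntegral.

(** * Images of Borel sets under Borel bijections *)

Section LusinSouslin.
Context {R : realType}.
Implicit Types (z : R * R) (a : nat -> nat) (C : set ((R * R) * (nat -> nat))).

Definition mesh (n : nat) : R := n.+1%:R^-1.

Lemma mesh_gt0 n : 0 < mesh n.
Proof. by rewrite invr_gt0 ltr0n. Qed.

Lemma lt_add_mesh (x y : R) : x < y -> exists n, x + mesh n < y.
Proof. exact: ltr_add_invr. Qed.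

(** The basic neighborhoods of the product of the plane and the Baire space. *)
Definition close_at (n : nat) (p q : (R * R) * (nat -> nat)) : Prop :=
  [/\ `|p.1.1 - q.1.1| < mesh n, `|p.1.2 - q.1.2| < mesh n &
      forall k, (k < n)%N -> p.2 k = q.2 k].

Definition closed_relation C : Prop :=
  forall p, (forall n, exists2 q, C q & close_at n p q) -> C p.

(** Analytic sets, as projections of closed sets along the Baire space. *)
Definition analytic (E : set (R * R)) : Prop :=
  exists2 C, closed_relation C & E = [set z | exists a, C (z, a)].

Lemma close_atW m n p q : (m <= n)%N -> close_at n p q -> close_at m p q.
Proof.
move=> mn [h1 h2 h3].
have le : mesh n <= mesh m by rewrite lef_pV2 ?posrE ?ltr0n // ler_nat.
split; [exact: lt_le_trans h1 _|exact: lt_le_trans h2 _|].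
by move=> k km; apply: h3; exact: leq_trans mn.
Qed.

(** The first term of the sequence chooses the set of the union. *)
Lemma analytic_bigcup (E : nat -> set (R * R)) :
  (forall i, analytic (E i)) -> analytic (\bigcup_i E i).
Proof.
move=> /(_ _)/cid2-/all_sig2[C cC CE].
exists [set p | C (p.2 0%N) (p.1, fun k => p.2 k.+1)].
  move=> p pC /=; apply: cC => n.
  have [q Cq pq] := pC n.+1.
  exists (q.1, fun k => q.2 k.+1); first by have [_ _ ->] := pq.
  have [h1 h2 _] := close_atW (leqnSn n) pq.
  by split => // k kn /=; have [_ _ ->] := pq.
apply/seteqP; split=> [z [i _]|z [a /= Ca]].
  rewrite CE => -[a Ca] /=.
  by exists (fun k => if k is k'.+1 then a k' else i).
by exists (a 0%N) => //; rewrite CE /=; exists (fun k => a k.+1).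
Qed.

(** Countably many sequences are read off one sequence through a pairing of
    the indices. *)
Lemma analytic_bigcap (E : nat -> set (R * R)) :
  (forall i, analytic (E i)) -> analytic (\bigcap_i E i).
Proof.
move=> /(_ _)/cid2-/all_sig2[C cC CE].
pose code (i j : nat) : nat := pickle (i, j).
exists [set p | forall i, C i (p.1, fun j => p.2 (code i j))].
  move=> p pC i /=; apply: cC => n.
  pose N := (n + \sum_(j < n) (code i j).+1)%N.
  have [q Cq pq] := pC N.
  exists (q.1, fun j => q.2 (code i j)); first exact: Cq.
  have [h1 h2 _] := close_atW (leq_addr _ _ : (n <= N)%N) pq.
  split => // k kn /=; have [_ _ ->] // := pq.
  rewrite /N (bigD1 (Ordinal kn)) //= addnCA ltnS.
  by rewrite leq_addr.
apply/seteqP; split=> [z zE|z [a /= Ca] i _]; last first.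
  by rewrite CE /=; exists (fun j => a (code i j)).
have /choice[A AE] i : exists a, C i (z, a).
  by have := zE i I; rewrite CE.
exists (fun k => if unpickle k is Some (i, j) then A i j else 0%N) => /= i.
by under eq_fun do rewrite /code pickleK; exact: AE.
Qed.

Definition bianalytic (E : set (R * R)) := analytic E /\ analytic (~` E).

Lemma bianalyticC E : bianalytic E -> bianalytic (~` E).
Proof. by case=> ? ?; split => //; rewrite setCK. Qed.

Lemma bianalytic_bigcup (E : nat -> set (R * R)) :
  (forall i, bianalytic (E i)) -> bianalytic (\bigcup_i E i).
Proof.
move=> bE; split; first by apply: analytic_bigcup => i; have [] := bE i.
by rewrite setC_bigcup; apply: analytic_bigcap => i; have [] := bE i.
Qed.

Lemma analytic_closed (E : set (R * R)) :
  (forall z, (forall n, exists2 w, E w & close_at n (z, fun=> 0%N) (w, fun=> 0%N))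
     -> E z) -> analytic E.
Proof.
move=> cE; exists [set p | E p.1].
  move=> p pC; apply: cE => n; have [q Eq [h1 h2 _]] := pC n.
  by exists q.1.
by apply/seteqP; split=> [z Ez|z [_]] //=; exists (fun=> 0%N).
Qed.

Lemma bianalytic_halfplane (f : R * R -> R) (x : R) :
  (f = fst \/ f = snd) -> bianalytic (f @^-1` `[x, +oo[%classic).
Proof.
move=> ffs.
have fclose n z w : close_at n (z, fun=> 0%N) (w, fun=> 0%N) ->
    `|f z - f w| < mesh n.
  by case=> h1 h2 _; case: ffs => ->.
move=> {ffs}; split.
  apply: analytic_closed => z zE /=; rewrite in_itv /= andbT leNgt.
  apply/negP => /lt_add_mesh[k kx].
  have [w] := zE k; rewrite /= in_itv /= andbT => xw /fclose.
  by rewrite ltr_norml => /andP[h _]; lra.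
rewrite (_ : ~` _ = \bigcup_k (f @^-1` `]-oo, x - mesh k]%classic)).
  apply: analytic_bigcup => i; apply: analytic_closed => z zE /=.
  rewrite in_itv /= leNgt; apply/negP => /lt_add_mesh[k kx].
  have [w] := zE k; rewrite /= in_itv /= => xw /fclose.
  by rewrite ltr_norml => /andP[_ h]; lra.
apply/seteqP; split=> [z /=|z [k _] /=]; rewrite !in_itv /= andbT.
  move/negP; rewrite -ltNge => /lt_add_mesh[k kx]; exists k => //=.
  by rewrite in_itv /=; lra.
move=> h; apply/negP; rewrite -ltNge; apply: le_lt_trans h _.
by rewrite ltrBlDr ltrDl mesh_gt0.
Qed.

(** The sets that are analytic together with their complement form a
    sigma-algebra, which contains the closed half-planes. *)
Lemma measurable_bianalytic (E : set (R * R)) : measurable E -> bianalytic E.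
Proof.
have b0 : bianalytic set0.
  split; first by apply: analytic_closed => z zE; have [] := zE 0%N.
  by rewrite setC0; exact: analytic_closed.
have half (f : R * R -> R) (A : set R) : (f = fst \/ f = snd) -> measurable A ->
    bianalytic (f @^-1` A).
  move=> ffs mA.
  have {}mA : (@RGenCInfty.G R).-sigma.-measurable A.
    by rewrite -RGenCInfty.measurableE.
  apply: (mA [set A | bianalytic (f @^-1` A)]); split; last first.
    by move=> _ [x ->]; exact: bianalytic_halfplane.
  split; first by rewrite /= preimage_set0.
    by move=> B bB /=; rewrite setTD preimage_setC; exact: bianalyticC.
  by move=> B bB; rewrite /= preimage_bigcup; exact: bianalytic_bigcup.
move=> mE; apply: (mE bianalytic); split.
  split=> //; first by move=> A bA; rewrite setTD; exact: bianalyticC.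
  by move=> A bA; exact: bianalytic_bigcup.
move=> A [] /= [B mB <-]; rewrite setTI; apply: half => //; [by left|by right].
Qed.

Definition separated (A B : set ((R * R) * (nat -> nat))) : Prop :=
  exists S : set R, [/\ measurable S, forall p, A p -> S p.1.2 &
    forall p, B p -> ~ S p.1.2].

(** A separator of two countable unions is assembled from separators of the
    pieces, so inseparability is inherited by some pair of pieces. *)
Lemma separated_pieces (c : (R * R) * (nat -> nat) -> nat) A B :
  ~ separated A B -> exists ij : nat * nat,
    ~ separated (A `&` [set p | c p = ij.1]) (B `&` [set p | c p = ij.2]).
Proof.
move=> nAB; apply: contrapT => /forallNP h; apply: nAB.
have /choice[S SP] (ij : nat * nat) : exists S : set R, [/\ measurable S,
    forall p, (A `&` [set p | c p = ij.1]) p -> S p.1.2 &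
    forall p, (B `&` [set p | c p = ij.2]) p -> ~ S p.1.2].
  by have /contrapT := h ij.
exists (\bigcup_i \bigcap_j S (i, j)); split.
- apply: bigcupT_measurable => i; apply: bigcapT_measurable => j.
  by have [] := SP (i, j).
- move=> p Ap; exists (c p) => // j _.
  by have [_ + _] := SP (c p, j); apply.
- move=> p Bp [i _ /(_ (c p) I)].
  by have [_ _ /(_ p)] := SP (i, c p); apply.
Qed.

(** At stage [n] a point is located within [mesh n] in both coordinates, and
    one more term of the sequence is revealed. *)
Definition stage_code n (p : (R * R) * (nat -> nat)) : nat :=
  pickle (p.2 n, Num.floor (n.+1%:R * p.1.1), Num.floor (n.+1%:R * p.1.2)).

Lemma nested_intervals (lo hi : nat -> R) :
  (forall m n, lo m <= hi n) -> exists x, forall n, lo n <= x <= hi n.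
Proof.
move=> h; exists (sup (range lo)) => n; apply/andP; split.
  apply: ub_le_sup; last by exists n.
  by exists (hi 0%N) => _ [m _ <-].
by apply: ge_sup; [exists (lo 0%N), 0%N|move=> _ [m _ <-]].
Qed.

(** Points lying in cells of every finite depth of one branch converge, and
    the limit stays in the closed relation. *)
Lemma branch_limit C (s : nat -> nat) : closed_relation C ->
  (forall n, exists2 p, C p & forall k, (k < n)%N -> stage_code k p = s k) ->
  exists2 p, C p & forall n q,
    (forall k, (k <= n)%N -> stage_code k q = s k) ->
    `|p.1.2 - q.1.2| <= mesh n.
Proof.
move=> cC ne.
pose dec n := odflt (0%N, 0, 0) (unpickle (s n)) : nat * int * int.
have decE n p : stage_code n p = s n ->
    dec n = (p.2 n, Num.floor (n.+1%:R * p.1.1), Num.floor (n.+1%:R * p.1.2)).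
  by rewrite /dec => <-; rewrite /stage_code pickleK.
have cell (u : R) n : mesh n * (Num.floor (n.+1%:R * u))%:~R <= u <=
    mesh n * ((Num.floor (n.+1%:R * u))%:~R + 1).
  have n0 : 0 < n.+1%:R :> R by rewrite ltr0n.
  rewrite ler_pdivrMl // ler_pdivlMl // floor_le_tmp /=.
  by rewrite ltW // -intrD1 floorD1_gt.
have lim (pr : nat * int * int -> int) (pt : R * R -> R) :
    (forall n p, stage_code n p = s n ->
      pr (dec n) = Num.floor (n.+1%:R * pt p.1)) ->
    exists x : R, forall n q, stage_code n q = s n ->
      `|x - pt q.1| <= mesh n.
  move=> prE.
  have [|x xP] := @nested_intervals (fun n => mesh n * (pr (dec n))%:~R)
      (fun n => mesh n * ((pr (dec n))%:~R + 1)).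
    move=> m n; have [p Cp ps] := ne (maxn m n).+1.
    have := cell (pt p.1) m; have := cell (pt p.1) n.
    rewrite -!prE ?ps ?ltnS ?leq_maxl ?leq_maxr //.
    by move=> /andP[_ h1] /andP[h2 _]; exact: le_trans h2 h1.
  exists x => n q qs; have := cell (pt q.1) n; have := xP n.
  rewrite -prE // mulrDr mulr1 ler_norml => /andP[h1 h2] /andP[h3 h4].
  by apply/andP; split; lra.
have [|x xP] := lim (fun t => t.1.2) fst; first by move=> n p /decE ->.
have [|y yP] := lim (fun t => t.2) snd; first by move=> n p /decE ->.
exists ((x, y), fun n => (dec n).1.1); last by move=> n q qs; exact/yP/qs.
apply: cC => n; have [p Cp ps] := ne n.+2; exists p => //.
have lt : mesh n.+1 < mesh n.
  by rewrite ltf_pV2 ?posrE ?ltr0n // ltr_nat.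
split => /=.
- by apply: le_lt_trans lt; apply: xP; exact: ps.
- by apply: le_lt_trans lt; apply: yP; exact: ps.
- by move=> k kn; rewrite (decE k p) // ps // ltnW // ltnW.
Qed.

(** Lusin's separation theorem. If no Borel set separated the two projections,
    then inseparable pairs of ever smaller cells would shrink to a pair of
    points with distinct second coordinates, which small balls separate. *)
Lemma analytic_separation E F : analytic E -> analytic F ->
  (forall z w, E z -> F w -> z.2 <> w.2) ->
  exists S : set R, [/\ measurable S, forall z, E z -> S z.2 &
    forall z, F z -> ~ S z.2].
Proof.
move=> [C cC ->] [D cD ->] EF.
suff [S [mS CS DS]] : separated C D.
  exists S; split => //; first by move=> z [a /CS].
  by move=> z [a /DS].
apply: contrapT => nCD.
have /choice[next nextP] (q : nat * (set ((R * R) * (nat -> nat)) *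
    set ((R * R) * (nat -> nat)))) : exists ij : nat * nat,
    ~ separated q.2.1 q.2.2 ->
    ~ separated (q.2.1 `&` [set p | stage_code q.1 p = ij.1])
                (q.2.2 `&` [set p | stage_code q.1 p = ij.2]).
  have [h|h] := pselect (separated q.2.1 q.2.2); first by exists (0, 0)%N.
  by have [ij] := separated_pieces (stage_code q.1) h; exists ij.
pose fix st n := if n is n'.+1 then
    let ij := next (n', st n') in
    ((st n').1 `&` [set p | stage_code n' p = ij.1],
     (st n').2 `&` [set p | stage_code n' p = ij.2])
  else (C, D).
have stP n : ~ separated (st n).1 (st n).2.
  by elim: n => [//|n IHn] /=; exact: (nextP (n, st n)).
pose s n := (next (n, st n)).1; pose t n := (next (n, st n)).2.
have stE n : st n = (C `&` [set p | forall k, (k < n)%N -> stage_code k p = s k],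
    D `&` [set p | forall k, (k < n)%N -> stage_code k p = t k]).
  have split_lt (A : set ((R * R) * (nat -> nat))) (u : nat -> nat) m :
      (A `&` [set p | forall k, (k < m)%N -> stage_code k p = u k]) `&`
      [set p | stage_code m p = u m] =
      A `&` [set p | forall k, (k < m.+1)%N -> stage_code k p = u k].
    apply/seteqP; split=> [p [[Ap h] hm]|p [Ap h]].
      split => // k; rewrite ltnS leq_eqVlt => /predU1P[->//|]; exact: h.
    by split; [split => // k km; apply: h; exact: ltnW|exact: h].
  elim: n => [|n IHn] /=.
    by congr pair; apply/seteqP; split=> // p [].
  by rewrite -/(s n) -/(t n) IHn /= !split_lt.
have [|p Cp pP] := @branch_limit C s cC.
  move=> n; apply: contrapT => h; apply: (stP n); rewrite stE /=.
  exists set0; split => //; last by move=> p _ [].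
  by move=> p [Cp ps]; case: h; exists p.
have [|q Dq qP] := @branch_limit D t cD.
  move=> n; apply: contrapT => h; apply: (stP n); rewrite stE /=.
  exists setT; by split => // q [Dq qt] _; apply: h; exists q.
have pq : 0 < `|p.1.2 - q.1.2|.
  rewrite normr_gt0 subr_eq0; apply/eqP.
  by apply: (EF p.1 q.1); [exists p.2; case: (p) Cp|exists q.2; case: (q) Dq].
have [n nP] := lt_add_mesh (divr_gt0 pq (ltr0n _ 3) : 0 < `|p.1.2 - q.1.2| / 3%:R).
apply: (stP n.+1); rewrite stE /=.
exists `[p.1.2 - mesh n, p.1.2 + mesh n]%classic; split => //.
- move=> w [_ ws]; have := pP n w ws.
  by rewrite /= in_itv /= ler_norml => /andP[h1 h2]; apply/andP; split; lra.
- move=> w [_ ws] /=; have := qP n w ws.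
  rewrite in_itv /= ler_norml => /andP[h1 h2] /andP[h3 h4].
  have : `|p.1.2 - q.1.2| <= 2 * mesh n.
    by rewrite ler_norml; apply/andP; split; lra.
  by lra.
Qed.

(** The Lusin--Souslin theorem for Borel bijections of the line: the images of
    a Borel set and of its complement are disjoint projections of analytic
    sets, and a Borel set separating them can only be the image itself. *)
Theorem measurable_image_bij (phi : R -> R) (A : set R) :
  measurable_fun setT phi -> bijective phi -> measurable A ->
  measurable (phi @` A).
Proof.
move=> mphi [psi phiK psiK] mA.
pose E (B : set R) : set (R * R) := [set z | B z.1 /\ z.2 = phi z.1].
have mE B : measurable B -> measurable (E B).
  move=> mB; rewrite (_ : E B = fst @^-1` B `&`
      [set z | z.2 == phi z.1]); last first.
    by apply/seteqP; split=> z /= [? /eqP].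
  apply: measurableI.
    by rewrite -[X in measurable X]setTI; exact: measurable_fst.
  rewrite -[X in measurable X]setTI.
  have := @measurable_fun_eqr _ _ R setT (snd : R * R -> R)
    (phi \o fst : R * R -> R).
  move=> /(_ measurable_snd (measurableT_comp mphi measurable_fst)).
  by move=> /(_ measurableT [set true]); apply.
have [EA _] := measurable_bianalytic (mE _ mA).
have [EC _] := measurable_bianalytic (mE _ (measurableC mA)).
have [|S [mS AS CS]] := analytic_separation EA EC.
  move=> [x y] [x' y'] [/= Ax ->] [/= Ax' ->] xx'; apply: Ax'.
  by rewrite -(phiK x') -xx' phiK.
rewrite (_ : phi @` A = S) //; apply/seteqP; split=> [_ [x Ax <-]|y Sy].
  exact: (AS (x, phi x)).
exists (psi y) => //; apply: contrapT => nA.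
by apply: (CS (psi y, y)) => //; split=> //=; rewrite psiK.
Qed.

End LusinSouslin.

(** * The cut metric and the cut distance *)

Section CutMetric.
Context {R : realType}.
Local Notation mu := (@lebesgue_measure R).
Local Notation mu2 := (mu \x mu)%E.
Implicit Types (f g h : R * R -> R) (phi psi : R -> R).

(** Extension by zero, so that measurability and bounds hold on whole sections. *)
Definition kernel_ext f : R * R -> R := f \_ unitI2.

Lemma kernel_extE f x y : unitI x -> unitI y -> kernel_ext f (x, y) = f (x, y).
Proof. by move=> Ux Uy; rewrite /kernel_ext patchE mem_set. Qed.

Lemma kernel_ext_ge0 f z : graphon f -> 0 <= kernel_ext f z.
Proof.
move=> [_ _ f01]; rewrite /kernel_ext patchE; case: ifPn => // /set_mem /f01.
by case/andP.
Qed.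

Lemma kernel_ext_le1 f z : graphon f -> kernel_ext f z <= 1.
Proof.
move=> [_ _ f01]; rewrite /kernel_ext patchE; case: ifPn => [/set_mem /f01|_].
  by case/andP.
exact: ler01.
Qed.

Lemma kernel_ext_sym f x y : graphon f -> kernel_ext f (x, y) = kernel_ext f (y, x).
Proof.
move=> [_ fC _]; rewrite /kernel_ext !patchE !in_setX /= andbC.
by case: ifPn => // /andP[/set_mem Uy /set_mem Ux]; exact: fC.
Qed.

Lemma bmeas_kernel_ext f : graphon f -> bmeas (kernel_ext f).
Proof.
move=> gf; split.
  by apply/(measurable_restrictT f measurable_unitI2); have [] := gf.
by exists 1 => z; rewrite ger0_norm ?kernel_ext_ge0 ?kernel_ext_le1.
Qed.

(** A measure-preserving self-map of the unit interval, tested on functions. *)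
Definition preserves_Ex phi : Prop :=
  measurable_fun setT phi /\
  forall F : R -> R, bmeas F -> Ex (fun x => F (phi x)) = Ex F.

(** Extension by the identity, which keeps a bijection of the unit interval a
    bijection, now of the line. *)
Definition map_ext phi x : R := if x \in unitI then phi x else x.

Lemma map_extE phi x : unitI x -> map_ext phi x = phi x.
Proof. by move=> Ux; rewrite /map_ext mem_set. Qed.

Lemma unitI_map_ext phi x : mpbij phi -> unitI (map_ext phi x) <-> unitI x.
Proof.
move=> [[phiU _ _] _ _]; rewrite /map_ext; case: ifPn => [/set_mem Ux|//].
by split=> // _; apply: phiU.
Qed.

Lemma unitI_mpbij phi x : mpbij phi -> unitI x -> unitI (phi x).
Proof. by move=> [[phiU _ _] _ _] Ux; apply: phiU. Qed.

Lemma measurable_map_ext phi : mpbij phi -> measurable_fun setT (map_ext phi).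
Proof.
move=> [_ mphi _].
rewrite (_ : map_ext phi = (phi \_ unitI) \+ (id \* \1_(~` unitI))).
  apply: measurable_funD; first exact/(measurable_restrictT _ measurable_unitI).
  apply: measurable_funM => //; apply: measurable_indic.
  by apply: measurableC; exact: measurable_unitI.
apply/funext => x; rewrite /map_ext /= patchE indicE in_setC.
by case: ifP => _ /=; rewrite ?mulr0 ?addr0 ?mulr1 ?add0r.
Qed.

Lemma bijective_map_ext phi : mpbij phi -> bijective (map_ext phi).
Proof.
move=> pphi; have [[phiU phiinj phisurj] _ _] := pphi.
rewrite -setTT_bijective; split => //.
  move=> x y _ _ exy; have := congr1 (fun z => z \in unitI) exy.
  have mem z : (map_ext phi z \in unitI) = (z \in unitI).
    by apply/idP/idP; rewrite !inE => /(unitI_map_ext z pphi).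
  rewrite !mem; move: exy; rewrite /map_ext; case: ifPn => Ux.
    by move=> + Uy; rewrite -Uy; apply: phiinj => //; rewrite -Uy.
  by move=> + Uy; rewrite -Uy.
move=> y _; have [Uy|Uy] := boolP (y \in unitI).
  have [x Ux <-] := phisurj y (set_mem Uy); exists x => //.
  by rewrite map_extE.
by exists y => //; rewrite /map_ext (negbTE Uy).
Qed.

Lemma map_ext_preserves phi : mpbij phi -> preserves_Ex (map_ext phi).
Proof.
move=> pphi; have mext := measurable_map_ext pphi.
split=> // F bF; have [_ _ phimu] := pphi.
have preU : map_ext phi @^-1` unitI = unitI.
  by apply/seteqP; split=> x /= /(unitI_map_ext x pphi).
have iF : mu.-integrable (map_ext phi @^-1` unitI) (EFin \o F \o map_ext phi).
  by rewrite preU; apply: integrable_Ex; exact: bmeas_comp.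
have mF : @measurable_fun _ _ (measurableTypeR R) _ setT (EFin \o F).
  by apply/measurable_EFinP; have [] := bF.
have mext' : @measurable_fun _ _ (measurableTypeR R) (measurableTypeR R) setT
  (map_ext phi) by exact: mext.
have := integral_pushforward mext' mF iF measurable_unitI.
rewrite /Ex /Rintegral => h; congr fine.
rewrite preU in h; rewrite -[LHS]h.
apply: eq_measure_integral => A mA AU.
rewrite -[RHS]phimu // /pushforward; congr (mu _).
apply/seteqP; split=> x /=.
  move=> Ax; have Ux : unitI x by apply/(unitI_map_ext x pphi)/AU.
  by split=> //; rewrite -map_extE.
by move=> [Ux Ax]; rewrite map_extE.
Qed.

Lemma bmeas_comp2 (F : R * R -> R) phi psi : bmeas F ->
  measurable_fun setT phi -> measurable_fun setT psi ->
  bmeas (fun z => F (phi z.1, psi z.2)).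
Proof.
move=> bF mphi mpsi; apply: (bmeas_comp (g := fun z => (phi z.1, psi z.2))) => //.
by apply: measurable_fun_pair; exact: measurableT_comp.
Qed.

Lemma bmeas_swap (F : R * R -> R) : bmeas F -> bmeas (fun z => F (z.2, z.1)).
Proof.
move=> bF; apply: (bmeas_comp (g := fun z => (z.2, z.1))) => //.
exact: measurable_fun_pair.
Qed.

Lemma bmeas_fst (f : R -> R) : bmeas f -> bmeas (fun z : R * R => f z.1).
Proof. by move=> bf; apply: bmeas_comp. Qed.

Lemma bmeas_snd (f : R -> R) : bmeas f -> bmeas (fun z : R * R => f z.2).
Proof. by move=> bf; apply: bmeas_comp. Qed.

(** A bound on the cut norm, with the integral over the rectangle in iterated
    form. *)
Definition rect_le (F : R * R -> R) (c : R) : Prop :=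
  forall S T : set R, measurable S -> measurable T -> S `<=` unitI -> T `<=` unitI ->
  `| Ex (fun x => \1_S x * Ex (fun y => \1_T y * F (x, y))) | <= c.

(** Pointwise no weight does better than the indicator of the set where the
    integrand is positive. This indicator depends on the image point only, so
    the map disappears under the integral. *)
Lemma Ex_weight_le (K a : R -> R) phi : bmeas K -> bmeas a -> preserves_Ex phi ->
  (forall x, unitI x -> 0 <= a x <= 1) ->
  Ex (fun x => a x * K (phi x)) <= Ex (fun x => \1_(unitI `&` [set x | 0 < K x]) x * K x).
Proof.
move=> bK ba [mphi phiE] a01.
have mS : measurable [set x | 0 < K x].
  have -> : [set x | 0 < K x] = K @^-1` `]0, +oo[%classic.
    by apply/seteqP; split=> x /=; rewrite in_itv /= andbT.
  by rewrite -[X in measurable X]setTI; have [mK _] := bK; exact: mK.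
have bS : bmeas (fun x => \1_[set x | 0 < K x] x * K x : R).
  by apply: bmeasM => //; exact: bmeas_indic.
rewrite [leRHS](_ : _ = Ex (fun x => \1_[set x | 0 < K x] x * K x)); last first.
  by apply: eq_Ex => x xU; rewrite !indicE in_setI xU.
rewrite -(phiE _ bS); apply: le_Ex.
- by apply: bmeasM => //; exact: bmeas_comp.
- exact: (bmeas_comp bS mphi).
move=> x /a01 /andP[a0 a1]; rewrite indicE.
have [K0|K0] := ltP 0 (K (phi x)).
  by rewrite mem_set // mul1r ler_piMl // ltW.
rewrite memNset ?mul0r /= => [|]; first exact: mulr_ge0_le0.
by rewrite ltNge K0.
Qed.

Lemma rect_le_weight_upper (F : R * R -> R) c (a b : R -> R) phi : bmeas F ->
  rect_le F c -> bmeas a -> bmeas b -> preserves_Ex phi ->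
  (forall x, unitI x -> 0 <= a x <= 1) -> (forall x, unitI x -> 0 <= b x <= 1) ->
  Ex (fun x => a x * Ex (fun y => b y * F (phi x, phi y))) <= c.
Proof.
move=> bF Fc ba bb pphi a01 b01; have [mphi _] := pphi.
pose K u := Ex (fun y => b y * F (u, phi y)).
have bKF : bmeas (fun z : R * R => b z.2 * F (z.1, phi z.2)).
  by apply: bmeasM; [exact: bmeas_snd|apply: (bmeas_comp2 (phi := id) bF) => //].
have bK : bmeas K by exact: (Ex_bmeas bKF).
apply: le_trans (Ex_weight_le bK ba pphi a01) _.
set S := _ `&` _.
have mS : measurable S.
  apply: measurableI; first exact: measurable_unitI.
  have -> : [set x | 0 < K x] = K @^-1` `]0, +oo[%classic.
    by apply/seteqP; split=> x /=; rewrite in_itv /= andbT.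
  by rewrite -[X in measurable X]setTI; have [mK _] := bK; exact: mK.
have bS : bmeas (\1_S : R -> R) by exact: bmeas_indic.
pose L w := Ex (fun u => \1_S u * F (u, w)).
have bLF : bmeas (fun z : R * R => \1_S z.2 * F (z.2, z.1)).
  by apply: bmeasM; [exact: bmeas_snd|exact: bmeas_swap].
have bL : bmeas L by exact: (Ex_bmeas bLF).
have bFx x : bmeas (fun y => F (x, y)) by exact: Ex_bmeas1.
have bFy y : bmeas (fun x => F (x, y)) by exact: (Ex_bmeas1 y (bmeas_swap bF)).
have -> : Ex (fun x => \1_S x * K x) = Ex (fun y => b y * L (phi y)).
  transitivity (Ex (fun x => Ex (fun y => \1_S x * (b y * F (x, phi y))))).
    congr Ex; apply/funext => x; rewrite ExZ //; exact: (Ex_bmeas1 x bKF).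
  rewrite (Ex_swap (F := fun z => \1_S z.1 * (b z.2 * F (z.1, phi z.2)))); last first.
    by apply: bmeasM => //; exact: bmeas_fst.
  congr Ex; apply/funext => y /=; rewrite -ExZ.
    by congr Ex; apply/funext => x; rewrite mulrCA.
  by apply: bmeasM.
apply: le_trans (Ex_weight_le bL bb pphi b01) _.
set T := _ `&` _.
have mT : measurable T.
  apply: measurableI; first exact: measurable_unitI.
  have -> : [set x | 0 < L x] = L @^-1` `]0, +oo[%classic.
    by apply/seteqP; split=> x /=; rewrite in_itv /= andbT.
  by rewrite -[X in measurable X]setTI; have [mL _] := bL; exact: mL.
apply: le_trans (le_trans (ler_norm _) (Fc S T mS mT _ _)); last 2 first.
- by move=> x [].
- by move=> x [].
have bT : bmeas (\1_T : R -> R) by exact: bmeas_indic.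
rewrite le_eqVlt; apply/orP; left; apply/eqP.
transitivity (Ex (fun y => Ex (fun x => \1_T y * (\1_S x * F (x, y))))).
  congr Ex; apply/funext => y; rewrite ExZ //; exact: (Ex_bmeas1 y bLF).
rewrite (Ex_swap (F := fun z => \1_T z.1 * (\1_S z.2 * F (z.2, z.1)))); last first.
  by apply: bmeasM => //; exact: bmeas_fst.
congr Ex; apply/funext => x /=; rewrite -ExZ.
  by congr Ex; apply/funext => y; rewrite mulrCA.
exact: bmeasM.
Qed.

Lemma rect_leN F c : bmeas F -> rect_le F c -> rect_le (fun z => - F z) c.
Proof.
move=> bF Fc S T mS mT SU TU; rewrite -normrN -ExN.
  rewrite (_ : Ex _ = Ex (fun x => \1_S x * Ex (fun y => \1_T y * F (x, y)))).
    exact: Fc.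
  congr Ex; apply/funext => x; rewrite -mulrN -ExN.
    by congr (_ * Ex _); apply/funext => y; rewrite -mulrN opprK.
  by apply: bmeasM; [exact: bmeas_indic|apply: bmeasN; exact: Ex_bmeas1].
apply: bmeasM; first exact: bmeas_indic.
apply: (@Ex_bmeas _ _ _ (fun z => \1_T z.2 * - F z)).
by apply: bmeasM; [apply: bmeas_snd; exact: bmeas_indic|exact: bmeasN].
Qed.

(** The integral is linear in each weight, so weights can be replaced by
    indicators one variable at a time. *)
Lemma rect_le_weight (F : R * R -> R) c (a b : R -> R) phi : bmeas F ->
  rect_le F c -> bmeas a -> bmeas b -> preserves_Ex phi ->
  (forall x, unitI x -> 0 <= a x <= 1) -> (forall x, unitI x -> 0 <= b x <= 1) ->
  `| Ex (fun x => a x * Ex (fun y => b y * F (phi x, phi y))) | <= c.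
Proof.
move=> bF Fc ba bb pphi a01 b01; have [mphi _] := pphi.
rewrite ler_norml; apply/andP; split; last exact: rect_le_weight_upper.
have := rect_le_weight_upper (bmeasN bF) (rect_leN bF Fc) ba bb pphi a01 b01.
rewrite lerNl; apply: le_trans.
have bFx x : bmeas (fun y => b y * F (phi x, phi y)).
  by apply: bmeasM => //; apply: (Ex_bmeas1 x (bmeas_comp2 bF mphi mphi)).
have bFF : bmeas (fun z => b z.2 * F (phi z.1, phi z.2)).
  by apply: bmeasM; [exact: bmeas_snd|exact: (bmeas_comp2 bF mphi mphi)].
rewrite -ExN; last by apply: bmeasM => //; exact: (Ex_bmeas bFF).
rewrite le_eqVlt; apply/orP; left; apply/eqP; congr Ex; apply/funext => x.
rewrite -mulrN -ExN //; congr (_ * Ex _); apply/funext => y.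
by rewrite mulrN.
Qed.

Lemma cut_integralE f g : graphon f -> graphon g ->
  forall S T : set R, measurable S -> measurable T -> S `<=` unitI -> T `<=` unitI ->
  \int[mu2]_(z in S `*` T) (f z - g z) =
  Ex (fun x => \1_S x *
     Ex (fun y => \1_T y * (kernel_ext f (x, y) - kernel_ext g (x, y)))).
Proof.
move=> gf gg S T mS mT SU TU.
rewrite -(integral_rectE (F := fun z => kernel_ext f z - kernel_ext g z)) //.
  apply: eq_Rintegral => -[x y] /set_mem[/= /SU Sx /TU Ty].
  by rewrite !kernel_extE.
by apply: bmeasB; exact: bmeas_kernel_ext.
Qed.

Definition kernel_diff f g z : R := kernel_ext f z - kernel_ext g z.

Lemma bmeas_kernel_diff f g : graphon f -> graphon g -> bmeas (kernel_diff f g).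
Proof. by move=> gf gg; apply: bmeasB; exact: bmeas_kernel_ext. Qed.

Lemma rect_le_L1 F : bmeas F ->
  rect_le F (Ex2 (fun z => `|F z|)).
Proof.
move=> bF S T mS mT SU TU.
have bS : bmeas (\1_S : R -> R) by exact: bmeas_indic.
have bT : bmeas (\1_T : R -> R) by exact: bmeas_indic.
have ind (A : set R) x : `|\1_A x : R| <= 1.
  by rewrite indicE ger0_norm ?lern1 ?leq_b1 ?ler0n.
have bTF x : bmeas (fun y => \1_T y * F (x, y)).
  by apply: bmeasM => //; exact: Ex_bmeas1.
have bTFE : bmeas (fun x => Ex (fun y => \1_T y * F (x, y))).
  apply: (@Ex_bmeas _ _ _ (fun z => \1_T z.2 * F z)).
  by apply: bmeasM => //; exact: bmeas_snd.
have bN : bmeas (fun z => `|F z|) by exact: bmeas_norm.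
apply: le_trans (ler_norm_Ex _) _; first exact: bmeasM.
apply: le_Ex; first by apply: bmeas_norm; exact: bmeasM.
  exact: (Ex_bmeas bN).
move=> x _; rewrite normrM -[leRHS]mul1r ler_pM //.
apply: le_trans (ler_norm_Ex _) _ => //.
apply: le_Ex; [exact: bmeas_norm|exact: (Ex_bmeas1 x bN)|].
by move=> y _; rewrite normrM -[leRHS]mul1r ler_pM.
Qed.

Lemma cut_metric_has_sup f g : graphon f -> graphon g ->
  has_sup [set r | exists S T : set R,
    [/\ measurable S, measurable T, S `<=` unitI, T `<=` unitI &
        r = `| \int[mu2]_(z in S `*` T) (f z - g z) | ]].
Proof.
move=> gf gg; split.
  exists `|\int[mu2]_(z in set0 `*` set0) (f z - g z)|; exists set0, set0.
  by split => //; exact: sub0set.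
exists (Ex2 (fun z => `|kernel_diff f g z|)) => _ [S [T [mS mT SU TU ->]]].
rewrite cut_integralE //.
exact: (rect_le_L1 (bmeas_kernel_diff gf gg)).
Qed.

Lemma cut_metricP f g c : graphon f -> graphon g ->
  cut_metric f g <= c <-> rect_le (kernel_diff f g) c.
Proof.
move=> gf gg; have hs := cut_metric_has_sup gf gg; split=> [fgc S T mS mT SU TU|Fc].
  apply: le_trans fgc; rewrite -cut_integralE //.
  by apply: sup_ubound; [have [] := hs|exists S, T].
apply: ge_sup; first by have [] := hs.
move=> _ [S [T [mS mT SU TU ->]]]; rewrite cut_integralE //; exact: Fc.
Qed.

Lemma cut_metric_rect f g : graphon f -> graphon g ->
  rect_le (kernel_diff f g) (cut_metric f g).
Proof. by move=> gf gg; exact/cut_metricP. Qed.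

Lemma rect_leD (F G : R * R -> R) c c' : bmeas F -> bmeas G -> rect_le F c -> rect_le G c' ->
  rect_le (fun z => F z + G z) (c + c').
Proof.
move=> bF bG Fc Gc S T mS mT SU TU.
have bS : bmeas (\1_S : R -> R) by exact: bmeas_indic.
have bT : bmeas (\1_T : R -> R) by exact: bmeas_indic.
have bTF (F' : R * R -> R) x : bmeas F' -> bmeas (fun y => \1_T y * F' (x, y) : R).
  by move=> bF'; apply: bmeasM => //; exact: Ex_bmeas1.
have bTFE (F' : R * R -> R) : bmeas F' -> bmeas (fun x => Ex (fun y => \1_T y * F' (x, y))).
  move=> bF'; apply: (@Ex_bmeas _ _ _ (fun z => \1_T z.2 * F' z)).
  by apply: bmeasM => //; exact: bmeas_snd.
rewrite (_ : Ex _ = Ex (fun x => \1_S x * Ex (fun y => \1_T y * F (x, y))) +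
  Ex (fun x => \1_S x * Ex (fun y => \1_T y * G (x, y)))).
  apply: le_trans (ler_normD _ _) _; apply: lerD; [exact: Fc|exact: Gc].
rewrite -ExD; [|by apply: bmeasM => //; exact: bTFE..].
congr Ex; apply/funext => x; rewrite -mulrDr -ExD; [|exact: bTF..].
by congr (_ * Ex _); apply/funext => y; rewrite mulrDr.
Qed.

Lemma cut_metric_ge0 f g : graphon f -> graphon g -> 0 <= cut_metric f g.
Proof.
move=> gf gg; apply: le_trans (cut_metric_rect gf gg
  measurable0 measurable0 (@sub0set _ _) (@sub0set _ _)).
exact: normr_ge0.
Qed.

Lemma cut_metric_triangle f g h : graphon f -> graphon g -> graphon h ->
  cut_metric f h <= cut_metric f g + cut_metric g h.
Proof.
move=> gf gg gh; apply/cut_metricP => //.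
rewrite (_ : kernel_diff f h = fun z => kernel_diff f g z + kernel_diff g h z).
  by apply: rect_leD; first [exact: bmeas_kernel_diff|exact: cut_metric_rect].
by apply/funext => z; rewrite /kernel_diff; lra.
Qed.

Lemma cut_metricC f g : graphon f -> graphon g -> cut_metric f g = cut_metric g f.
Proof.
have h f' g' : graphon f' -> graphon g' -> cut_metric f' g' <= cut_metric g' f'.
  move=> gf gg; apply/cut_metricP => //.
  rewrite (_ : kernel_diff f' g' = fun z => - kernel_diff g' f' z).
    by apply: rect_leN; [exact: bmeas_kernel_diff|exact: cut_metric_rect].
  by apply/funext => z; rewrite /kernel_diff opprB.
by move=> gf gg; apply/eqP; rewrite eq_le !h.
Qed.

Lemma cut_metric_L1 f g : graphon f -> graphon g ->
  cut_metric f g <= Ex2 (fun z => `|kernel_diff f g z|).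
Proof.
by move=> gf gg; apply/cut_metricP => //; apply: rect_le_L1; exact: bmeas_kernel_diff.
Qed.

Lemma kernel_ext_relabel g phi z : mpbij phi ->
  kernel_ext (relabel g phi) z = kernel_ext g (map_ext phi z.1, map_ext phi z.2).
Proof.
move=> pphi; rewrite /kernel_ext !patchE !in_setX /=.
have mem x : (map_ext phi x \in unitI) = (x \in unitI).
  by apply/idP/idP; rewrite !inE => /(unitI_map_ext x pphi).
by rewrite !mem; case: ifPn => // /andP[/set_mem ? /set_mem ?]; rewrite /relabel !map_extE.
Qed.

Lemma graphon_relabel g phi : graphon g -> mpbij phi -> graphon (relabel g phi).
Proof.
move=> gg pphi; have [mg gC g01] := gg; split.
- have mext := measurable_map_ext pphi;
  have [mF _] := bmeas_comp2 (bmeas_kernel_ext gg) mext mext.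
  apply: eq_measurable_fun (measurable_funTS mF) => -[x y] /set_mem[/= Ux Uy].
  rewrite !map_extE // kernel_extE //; exact: unitI_mpbij.
- by move=> x y Ux Uy; apply: gC; exact: unitI_mpbij.
- by move=> [x y] [/= Ux Uy]; apply: g01; split; exact: unitI_mpbij.
Qed.

Lemma cut_metric_relabel f g phi : graphon f -> graphon g -> mpbij phi ->
  cut_metric (relabel f phi) (relabel g phi) <= cut_metric f g.
Proof.
move=> gf gg pphi; apply/cut_metricP; [exact: graphon_relabel..|].
move=> S T mS mT SU TU.
have -> : kernel_diff (relabel f phi) (relabel g phi) =
    fun z => kernel_diff f g (map_ext phi z.1, map_ext phi z.2).
  by apply/funext => z; rewrite /kernel_diff !kernel_ext_relabel.
have ind (A : set R) x : unitI x -> 0 <= (\1_A x : R) <= 1.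
  by rewrite indicE; case: (_ \in _); rewrite /= ?lexx ?ler01.
apply: (rect_le_weight (a := \1_S) (b := \1_T)).
- exact: bmeas_kernel_diff.
- exact: cut_metric_rect.
- exact: bmeas_indic.
- exact: bmeas_indic.
- exact: map_ext_preserves.
- exact: ind.
- exact: ind.
Qed.

Lemma mpbij_id : mpbij (@id R).
Proof.
split; first by split=> // x Ux; exists x.
  exact: measurable_id.
by move=> A mA AU; rewrite preimage_id setIidr.
Qed.

Lemma mpbij_comp phi psi : mpbij phi -> mpbij psi -> mpbij (phi \o psi).
Proof.
move=> pphi ppsi.
have [[phiU phiI phiS] mphi phimu] := pphi; have [[psiU psiI psiS] mpsi psimu] := ppsi.
split.
- split=> [x Ux|x y Ux Uy|y Uy] /=; first exact/phiU/psiU.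
    move=> exy; have Ux' := set_mem Ux; have Uy' := set_mem Uy.
    by apply: psiI => //; apply: phiI => //; apply/mem_set; apply: psiU.
  have [x Ux <-] := phiS y Uy; have [w Uw <-] := psiS x Ux; by exists w.
- apply: (measurable_comp measurable_unitI _ mphi) => //.
  by move=> _ [x Ux <-]; apply: psiU.
- move=> A mA AU; rewrite -[RHS]phimu // -[RHS]psimu.
  + congr (mu _); apply/seteqP; split=> x /= [Ux Ax]; split => //.
      by split => //; apply: psiU.
    by case: Ax.
  + by apply: mphi => //; exact: measurable_unitI.
  + by move=> x [].
Qed.

(** Borel measurability of the inverse is the Lusin--Souslin theorem. The
    symmetry of [cut_dist] comes down to this. *)
Lemma mpbij_inverse phi : mpbij phi ->
  exists2 psi, mpbij psi & forall x, unitI x -> psi (phi x) = x /\ phi (psi x) = x.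
Proof.
move=> pphi; have mext := measurable_map_ext pphi.
have bij := bijective_map_ext pphi.
have [psi phiK psiK] := bij.
have Upsi x : unitI (psi x) <-> unitI x.
  by rewrite -[in X in _ <-> X](psiK x); split=> /(unitI_map_ext (psi x) pphi).
have mim A : measurable A -> measurable (map_ext phi @` A).
  exact: measurable_image_bij.
have preim A : psi @^-1` A = map_ext phi @` A.
  apply/seteqP; split=> [x /= Ax|_ [x Ax <-] /=]; last by rewrite phiK.
  by exists (psi x).
have mpsi : measurable_fun setT psi.
  by move=> _ A mA; rewrite setTI preim; exact: mim.
have [_ _ phimu] := pphi.
exists psi; last first.
  move=> x Ux; have Upx := (Upsi x).2 Ux.
  by rewrite -{1}(map_extE phi Ux) phiK -(map_extE phi Upx) psiK.
split.
- split=> [x Ux|x y _ _ /(congr1 (map_ext phi))|y Uy]; first exact/Upsi.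
    by rewrite !psiK.
  exists (map_ext phi y); last exact: phiK.
  exact/(unitI_map_ext y pphi).
- exact: measurable_funTS.
- move=> A mA AU; rewrite (_ : unitI `&` _ = map_ext phi @` A).
    have imU : map_ext phi @` A `<=` unitI.
      by move=> _ [x /AU Ux <-]; apply/(unitI_map_ext x pphi).
    rewrite -[LHS]phimu //; last exact: mim.
    congr (mu _); apply/seteqP; split=> [x /= [Ux [y Ay]]|x Ax /=].
      by rewrite -(map_extE phi Ux) => /(can_inj phiK) <-.
    by split; [exact: AU|exists x => //; rewrite map_extE //; exact: AU].
  rewrite preim; apply/seteqP; split=> [x []//|x Ax]; split => //.
  by case: Ax => y /AU Uy <-; apply/(unitI_map_ext y pphi).
Qed.

Lemma cut_dist_le f g phi : graphon f -> graphon g -> mpbij phi ->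
  cut_dist f g <= cut_metric f (relabel g phi).
Proof.
move=> gf gg pphi; apply: ge_inf; last by exists phi.
exists 0 => _ [psi ppsi <-]; apply: cut_metric_ge0 => //; exact: graphon_relabel.
Qed.

Lemma cut_dist_lt f g e : cut_dist f g < e ->
  exists2 phi, mpbij phi & cut_metric f (relabel g phi) < e.
Proof.
move=> fge; have [|_ [phi pphi <-] lt] := inf_lt _ fge; last by exists phi.
by exists (cut_metric f (relabel g id)), id => //; exact: mpbij_id.
Qed.

Lemma cut_dist_ge0 f g : graphon f -> graphon g -> 0 <= cut_dist f g.
Proof.
move=> gf gg; apply: lb_le_inf.
  by exists (cut_metric f (relabel g id)), id => //; exact: mpbij_id.
by move=> _ [phi pphi <-]; apply: cut_metric_ge0 => //; exact: graphon_relabel.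
Qed.

Lemma relabel_id g : relabel g id = g.
Proof. by apply/funext => -[]. Qed.

Lemma cut_dist_le_metric f g : graphon f -> graphon g -> cut_dist f g <= cut_metric f g.
Proof.
move=> gf gg; rewrite -[in leRHS](relabel_id g).
by apply: cut_dist_le => //; exact: mpbij_id.
Qed.

Lemma cut_dist_triangle f g h : graphon f -> graphon g -> graphon h ->
  cut_dist f h <= cut_dist f g + cut_dist g h.
Proof.
move=> gf gg gh; apply/ler_addgt0Pr => e e0.
have e2 : 0 < e / 2 by rewrite divr_gt0.
have [phi pphi fg] : exists2 phi, mpbij phi &
    cut_metric f (relabel g phi) < cut_dist f g + e / 2.
  by apply: cut_dist_lt; rewrite ltrDl.
have [psi ppsi ghl] : exists2 phi, mpbij phi &
    cut_metric g (relabel h phi) < cut_dist g h + e / 2.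
  by apply: cut_dist_lt; rewrite ltrDl.
have ggp := graphon_relabel gg pphi; have ghp := graphon_relabel gh ppsi.
have := cut_dist_le gf gh (mpbij_comp ppsi pphi).
have := cut_metric_triangle gf ggp (graphon_relabel ghp pphi).
have := cut_metric_relabel gg ghp pphi.
rewrite (_ : relabel (relabel h psi) phi = relabel h (psi \o phi)) //.
move: (cut_metric _ _) (cut_metric _ _) (cut_metric _ _) (cut_metric _ _) fg ghl.
move: (cut_dist _ _) (cut_dist _ _) (cut_dist _ _) => *; lra.
Qed.

Lemma cut_distC f g : graphon f -> graphon g -> cut_dist f g = cut_dist g f.
Proof.
have le f' g' : graphon f' -> graphon g' -> cut_dist f' g' <= cut_dist g' f'.
  move=> gf gg; apply/ler_addgt0Pr => e e0.
  have [phi pphi gfl] : exists2 phi, mpbij phi &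
      cut_metric g' (relabel f' phi) < cut_dist g' f' + e.
    by apply: cut_dist_lt; rewrite ltrDl.
  have [psi ppsi inv] := mpbij_inverse pphi.
  apply: le_trans (cut_dist_le gf gg ppsi) _.
  apply: le_trans (ltW gfl).
  have gfp := graphon_relabel gf pphi.
  have := cut_metric_relabel gg gfp ppsi.
  rewrite cut_metricC //; [|exact: graphon_relabel..].
  apply: le_trans; apply/cut_metricP => //; first exact: graphon_relabel.
  rewrite (_ : kernel_diff f' _ =
    kernel_diff (relabel (relabel f' phi) psi) (relabel g' psi)).
    by apply: cut_metric_rect; [exact: graphon_relabel..].
  apply/funext => -[x y]; rewrite /kernel_diff; congr (_ - _).
  rewrite /kernel_ext !patchE; case: ifPn => // /set_mem[/= Ux Uy].
  by rewrite /relabel /= (inv x Ux).2 (inv y Uy).2.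
by move=> gf gg; apply/eqP; rewrite eq_le; apply/andP; split; exact: le.
Qed.

Lemma cut_dist_refl f : graphon f -> cut_dist f f = 0.
Proof.
move=> gf; apply/eqP; rewrite eq_le cut_dist_ge0 // andbT.
apply: le_trans (cut_dist_le_metric gf gf) _.
apply: le_trans (cut_metric_L1 gf gf) _.
rewrite (_ : (fun z => _) = fun=> 0) ?Ex2_cst //.
by apply/funext => z; rewrite /kernel_diff subrr normr0.
Qed.

Lemma cut_dist_L1 f g h : graphon f -> graphon g -> graphon h ->
  cut_dist f h <= cut_dist f g + Ex2 (fun z => `|kernel_diff g h z|).
Proof.
move=> gf gg gh; apply: le_trans (cut_dist_triangle gf gg gh) _; rewrite lerD2l.
exact: le_trans (cut_dist_le_metric gg gh) (cut_metric_L1 gg gh).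
Qed.

End CutMetric.

(** * Iterated integrals over the unit cube *)

Section CubeIntegral.
Context {R : realType}.

Definition in_cube n (s : n.-tuple R) : Prop := forall i, unitI (tnth s i).

Lemma in_cube_cons n x (s : n.-tuple R) :
  unitI x -> in_cube s -> in_cube (cons_tuple x s).
Proof.
move=> Ux Us i; have [->|[j ->]] : i = ord0 \/ exists j, i = lift ord0 j.
  by case: (unliftP ord0 i) => [j ->|->]; [right; exists j|left].
- by rewrite tnth0.
- by rewrite tnthS.
Qed.

Lemma measurable_cons_tuple {d} {T : measurableType d} n :
  measurable_fun setT
    (fun z : T * R * n.-tuple R => (z.1.1, cons_tuple z.1.2 z.2)).
Proof.
apply: measurable_fun_pair; first exact: measurableT_comp.
by apply: measurable_cons => //; exact: measurableT_comp.
Qed.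

Lemma bmeas_cons2 {d} {T : measurableType d} n (F : T * n.+1.-tuple R -> R) :
  bmeas F -> bmeas (fun z : T * R * n.-tuple R => F (z.1.1, cons_tuple z.1.2 z.2)).
Proof.
move=> bF; apply: (bmeas_comp
  (g := fun z : T * R * n.-tuple R => (z.1.1, cons_tuple z.1.2 z.2)) bF).
exact: measurable_cons_tuple.
Qed.

Lemma cube_bmeas n : forall {d} {T : measurableType d} (F : T * n.-tuple R -> R),
  bmeas F -> bmeas (fun t => cube_integral (fun s => F (t, s))).
Proof.
elim: n => [|n IHn] d T F bF /=.
  by apply: (bmeas_comp (g := fun t => (t, [tuple]))) => //; exact: measurable_fun_pair.
apply: (@Ex_bmeas _ _ _ (fun z => cube_integral (fun s => F (z.1, cons_tuple z.2 s)))).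
apply: (IHn _ _ (fun z => F (z.1.1, cons_tuple z.1.2 z.2))).
exact: bmeas_cons2.
Qed.

Lemma bmeas_cons_tuple n (F : n.+1.-tuple R -> R) x :
  bmeas F -> bmeas (fun s : n.-tuple R => F (cons_tuple x s)).
Proof. by move=> bF; apply: bmeas_comp => //; exact: measurable_cons. Qed.

Lemma bmeas_cube_cons n (F : n.+1.-tuple R -> R) :
  bmeas F -> bmeas (fun x => cube_integral (fun s => F (cons_tuple x s))).
Proof.
move=> bF; apply: (cube_bmeas (F := fun z => F (cons_tuple z.1 z.2))).
apply: (bmeas_comp (g := fun z : R * n.-tuple R => cons_tuple z.1 z.2)) => //.
exact: measurable_cons.
Qed.

Lemma cube_cst n (c : R) : cube_integral (fun _ : n.-tuple R => c) = c.
Proof. by elim: n => [//|n IHn] /=; under eq_Rintegral do rewrite IHn; exact: Ex_cst. Qed.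

Lemma eq_cube n (F G : n.-tuple R -> R) :
  (forall s, in_cube s -> F s = G s) -> cube_integral F = cube_integral G.
Proof.
elim: n F G => [|n IHn] F G FG /=; first by apply: FG => -[].
apply: eq_Rintegral => x /set_mem Ux; apply: IHn => s Us; apply: FG.
exact: in_cube_cons.
Qed.

Lemma cubeD n (F G : n.-tuple R -> R) : bmeas F -> bmeas G ->
  cube_integral (fun s => F s + G s) = cube_integral F + cube_integral G.
Proof.
elim: n F G => [//|n IHn] F G bF bG /=.
rewrite -[RHS]ExD; [|exact: bmeas_cube_cons..].
by apply: eq_Rintegral => x _; apply: IHn; exact: bmeas_cons_tuple.
Qed.

Lemma cubeZ n (c : R) (F : n.-tuple R -> R) : bmeas F ->
  cube_integral (fun s => c * F s) = c * cube_integral F.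
Proof.
elim: n F => [//|n IHn] F bF /=.
rewrite -[RHS]ExZ; last exact: bmeas_cube_cons.
by apply: eq_Rintegral => x _; apply: IHn; exact: bmeas_cons_tuple.
Qed.

Lemma cubeB n (F G : n.-tuple R -> R) : bmeas F -> bmeas G ->
  cube_integral (fun s => F s - G s) = cube_integral F - cube_integral G.
Proof.
move=> bF bG; rewrite -[- cube_integral G]mulN1r -cubeZ // -cubeD //.
  by apply: eq_cube => s _; rewrite mulN1r.
by apply: bmeasM => //; exact: bmeas_cst.
Qed.

Lemma le_cube n (F G : n.-tuple R -> R) : bmeas F -> bmeas G ->
  (forall s, in_cube s -> F s <= G s) -> cube_integral F <= cube_integral G.
Proof.
elim: n F G => [|n IHn] F G bF bG FG /=; first by apply: FG => -[].
apply: (le_Ex (bmeas_cube_cons bF) (bmeas_cube_cons bG)) => x Ux.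
apply: IHn; [exact: bmeas_cons_tuple..|].
by move=> s Us; apply: FG; exact: in_cube_cons.
Qed.

Lemma cube_norm_le n (F : n.-tuple R -> R) c : bmeas F ->
  (forall s, in_cube s -> `|F s| <= c) -> `|cube_integral F| <= c.
Proof.
move=> bF Fc; rewrite ler_norml; apply/andP; split.
  rewrite -[leLHS](cube_cst n); apply: le_cube => //; first exact: bmeas_cst.
  by move=> s /Fc; rewrite ler_norml => /andP[].
rewrite -[leRHS](cube_cst n); apply: le_cube => //; first exact: bmeas_cst.
by move=> s /Fc; rewrite ler_norml => /andP[].
Qed.

Lemma bmeas_Ex_snd n (F : R * n.-tuple R -> R) : bmeas F ->
  bmeas (fun s => Ex (fun x => F (x, s))).
Proof.
move=> bF; apply: (@Ex_bmeas _ _ _ (fun z => F (z.2, z.1))).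
by apply: (bmeas_comp (g := fun z => (z.2, z.1))) => //; exact: measurable_fun_pair.
Qed.

Lemma cube_Ex n (F : R * n.-tuple R -> R) : bmeas F ->
  Ex (fun x => cube_integral (fun s => F (x, s))) =
  cube_integral (fun s => Ex (fun x => F (x, s))).
Proof.
elim: n F => [//|n IHn] F bF /=.
pose F' (z : R * R * n.-tuple R) := F (z.1.1, cons_tuple z.1.2 z.2).
have bF' : bmeas F' by exact: bmeas_cons2.
have := Ex_swap (cube_bmeas bF').
rewrite /Ex => ->; apply: eq_Rintegral => y _.
apply: (IHn (fun z => F (z.1, cons_tuple y z.2))).
apply: (bmeas_comp (g := fun z => (z.1, cons_tuple y z.2))) => //.
by apply: measurable_fun_pair => //; exact: measurable_cons.
Qed.

Definition tuple_upd {T : Type} n (s : n.-tuple T) (i : 'I_n) (y : T) : n.-tuple T :=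
  [tuple if j == i then y else tnth s j | j < n].

Lemma tnth_upd (T : Type) n (s : n.-tuple T) i y j :
  tnth (tuple_upd s i y) j = if j == i then y else tnth s j.
Proof. by rewrite tnth_mktuple. Qed.

Lemma tuple_upd0 (T : Type) n x (s : n.-tuple T) y :
  tuple_upd (cons_tuple x s) ord0 y = cons_tuple y s.
Proof.
apply: eq_from_tnth => i; rewrite tnth_upd.
case: (unliftP ord0 i) => [j ->|->]; last by rewrite eqxx tnth0.
by rewrite eq_sym (negbTE (neq_lift _ _)) !tnthS.
Qed.

Lemma tuple_updS (T : Type) n x (s : n.-tuple T) j y :
  tuple_upd (cons_tuple x s) (lift ord0 j) y = cons_tuple x (tuple_upd s j y).
Proof.
apply: eq_from_tnth => i; rewrite tnth_upd.
case: (unliftP ord0 i) => [k ->|->]; last by rewrite (negbTE (neq_lift _ _)) !tnth0.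
by rewrite !tnthS tnth_upd (inj_eq lift_inj).
Qed.

Lemma measurable_tuple_upd n (i : 'I_n) :
  measurable_fun setT (fun z : R * n.-tuple R => tuple_upd z.2 i z.1).
Proof.
apply/measurable_fun_tnthP => j.
rewrite (_ : _ \o _ = fun z => if j == i then z.1 else tnth z.2 j); last first.
  by apply/funext => z /=; rewrite tnth_upd.
case: (j == i); first exact: measurable_fst.
apply: (measurableT_comp (f := fun s : n.-tuple R => tnth s j)) => //.
exact: measurable_tnth.
Qed.

Lemma bmeas_upd n (F : n.-tuple R -> R) i : bmeas F ->
  bmeas (fun z : R * n.-tuple R => F (tuple_upd z.2 i z.1)).
Proof. by move=> bF; apply: (bmeas_comp bF (measurable_tuple_upd i)). Qed.

Lemma bmeas_upd1 n (F : n.-tuple R -> R) i s : bmeas F ->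
  bmeas (fun x => F (tuple_upd s i x)).
Proof.
move=> bF; apply: (bmeas_comp (g := fun x => (x, s)) (bmeas_upd i bF)).
exact: measurable_fun_pair.
Qed.

(** Averaging over one coordinate first leaves the iterated integral unchanged:
    Fubini's theorem moves that coordinate to the outside. *)
Lemma cube_avg n (F : n.-tuple R -> R) i : bmeas F ->
  cube_integral F = cube_integral (fun s => Ex (fun y => F (tuple_upd s i y))).
Proof.
elim: n F i => [F []//|n IHn] F i bF.
case: (unliftP ord0 i) => [j ->|->] /=.
  apply: eq_Rintegral => x _; rewrite (IHn _ j); last exact: bmeas_cons_tuple.
  apply: eq_cube => s _; congr Ex; apply/funext => y.
  by rewrite tuple_updS.
transitivity (cube_integral (fun s : n.-tuple R => Ex (fun y => F (cons_tuple y s)))).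
  apply: (cube_Ex (F := fun z => F (cons_tuple z.1 z.2))).
  apply: (bmeas_comp (g := fun z : R * n.-tuple R => cons_tuple z.1 z.2)) => //.
  exact: measurable_cons.
rewrite -[LHS]Ex_cst; apply: eq_Rintegral => x _; apply: eq_cube => s _.
by congr Ex; apply/funext => y; rewrite tuple_upd0.
Qed.

Lemma cube_preserves n (F : n.-tuple R -> R) phi : bmeas F -> preserves_Ex phi ->
  cube_integral (fun s => F (map_tuple phi s)) = cube_integral F.
Proof.
move=> + [mphi phiE]; elim: n F => [|n IHn] F bF /=.
  by congr F; apply: val_inj.
transitivity (Ex (fun x => cube_integral (fun s => F (cons_tuple (phi x) s)))).
  apply: eq_Rintegral => x _.
  rewrite -[RHS]IHn; last exact: bmeas_cons_tuple.
  by apply: eq_cube => s _; congr F; apply: val_inj.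
exact: (phiE _ (bmeas_cube_cons bF)).
Qed.

End CubeIntegral.

(** * The counting lemma *)

Section Counting.
Context {R : realType}.
Implicit Types (f g : R * R -> R).

Section weights.
Variable v : nat.
Implicit Types (K : 'I_v * 'I_v -> R * R -> R) (L : seq ('I_v * 'I_v)).

Definition edge_prod K L (s : v.-tuple R) : R :=
  \prod_(e <- L) K e (tnth s e.1, tnth s e.2).

Lemma measurable_pair_tnth (i j : 'I_v) :
  measurable_fun setT (fun s : v.-tuple R => (tnth s i, tnth s j)).
Proof. by apply: measurable_fun_pair; exact: measurable_tnth. Qed.

Lemma bmeas_edge (F : R * R -> R) (i j : 'I_v) :
  bmeas F -> bmeas (fun s : v.-tuple R => F (tnth s i, tnth s j)).
Proof. by move=> bF; apply: (bmeas_comp bF (measurable_pair_tnth i j)). Qed.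

Lemma bmeas_edge_prod K L : (forall e, bmeas (K e)) -> bmeas (edge_prod K L).
Proof. by move=> bK; apply: bmeas_prod => e _; exact: bmeas_edge. Qed.

Lemma edge_prod01 K L s : (forall e z, 0 <= K e z <= 1) -> 0 <= edge_prod K L s <= 1.
Proof.
move=> K01; rewrite /edge_prod; apply: (big_ind (fun x => 0 <= x <= 1)).
- by rewrite ler01 lexx.
- by move=> x y /andP[x0 x1] /andP[y0 y1]; rewrite mulr_ge0 ?mulr_ile1.
- by move=> e _; exact: K01.
Qed.

Lemma eq_edge_prod K L s s' :
  (forall e, e \in L -> tnth s e.1 = tnth s' e.1 /\ tnth s e.2 = tnth s' e.2) ->
  edge_prod K L s = edge_prod K L s'.
Proof.
by move=> h; apply: eq_big_seq => e /h[-> ->].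
Qed.

(** With all variables but [x_i] and [x_j] fixed, the factors that avoid [j]
    form a weight in [x_i], the others one in [x_j]. *)
Lemma single_edge_bound K L (D : R * R -> R) c (i j : 'I_v) :
  (forall e, bmeas (K e)) -> (forall e z, 0 <= K e z <= 1) ->
  bmeas D -> rect_le D c -> i != j ->
  (i, j) \notin L -> (j, i) \notin L ->
  `| cube_integral (fun s : v.-tuple R => D (tnth s i, tnth s j) * edge_prod K L s) | <= c.
Proof.
move=> bK K01 bD Dc ij ijL jiL.
pose G s := D (tnth s i, tnth s j) * edge_prod K L s.
have bG : bmeas G by apply: bmeasM; [exact: bmeas_edge|exact: bmeas_edge_prod].
pose G' s := Ex (fun y => G (tuple_upd s j y)).
have bG' : bmeas G' by exact: (bmeas_Ex_snd (bmeas_upd j bG)).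
rewrite -/G (cube_avg j bG) (cube_avg i bG').
apply: cube_norm_le.
  exact: (bmeas_Ex_snd (bmeas_upd i bG')).
move=> s _.
pose touches (e : 'I_v * 'I_v) := (e.1 == j) || (e.2 == j).
pose L1 := [seq e <- L | ~~ touches e]; pose L2 := [seq e <- L | touches e].
pose a x := edge_prod K L1 (tuple_upd s i x).
pose b y := edge_prod K L2 (tuple_upd s j y).
rewrite (_ : Ex _ = Ex (fun x => a x * Ex (fun y => b y * D (id x, id y)))).
  apply: rect_le_weight => //.
  - by apply: bmeas_upd1; exact: bmeas_edge_prod.
  - by apply: bmeas_upd1; exact: bmeas_edge_prod.
  - by move=> x _; exact: edge_prod01.
  - by move=> x _; exact: edge_prod01.
congr Ex; apply/funext => x; rewrite -ExZ; last first.
  apply: bmeasM; last exact: (Ex_bmeas1 x bD).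
  by apply: bmeas_upd1; exact: bmeas_edge_prod.
congr Ex; apply/funext => y; rewrite /G !tnth_upd eqxx (negbTE ij) eqxx.
rewrite mulrA [RHS]mulrC; congr (_ * _).
rewrite /edge_prod (bigID touches) /= mulrC -!(big_filter L); congr (_ * _).
  rewrite -/L1; apply: eq_edge_prod => e; rewrite mem_filter negb_or.
  by move=> /andP[/andP[/negbTE h1 /negbTE h2] _]; rewrite !tnth_upd h1 h2.
rewrite -/L2; apply: eq_edge_prod => e; rewrite mem_filter => /andP[te eL].
have ei1 : e.1 == i -> e.2 == j -> False.
  by move=> /eqP e1 /eqP e2; move: ijL; rewrite -e1 -e2 -surjective_pairing eL.
have ei2 : e.2 == i -> e.1 == j -> False.
  by move=> /eqP e1 /eqP e2; move: jiL; rewrite -e1 -e2 -surjective_pairing eL.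
rewrite !tnth_upd; move: te ei1 ei2; rewrite /touches.
case: (e.1 =P j) => [->|_]; case: (e.2 =P j) => [->|_] //=.
- by move=> _ _; case: (e.2 =P i) => // _ /(_ isT isT).
- by move=> _; case: (e.1 =P i) => // _ /(_ isT isT).
Qed.

End weights.

Definition edges v (H : rel 'I_v) : seq ('I_v * 'I_v) :=
  [seq ij : 'I_v * 'I_v <- index_enum _ | (ij.1 < ij.2)%N && H ij.1 ij.2].

Lemma hom_densityE v (H : rel 'I_v) f :
  hom_density H f =
  cube_integral (fun s => edge_prod (fun=> kernel_ext f) (edges H) s).
Proof.
apply: eq_cube => s Us; rewrite /edge_prod big_filter; apply: eq_bigr => e _.
by rewrite kernel_extE.
Qed.

(** The edges are switched from [f] to [g] one at a time, and each switch
    costs at most the cut metric by [single_edge_bound]. *)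
Lemma counting_lemma v (H : rel 'I_v) f g : graphon f -> graphon g ->
  `| hom_density H f - hom_density H g | <= (size (edges H))%:R * cut_metric f g.
Proof.
move=> gf gg; rewrite !hom_densityE.
have bf := bmeas_kernel_ext gf; have bg := bmeas_kernel_ext gg.
have uE : uniq (edges H) by apply: filter_uniq; exact: index_enum_uniq.
have ltE e : e \in edges H -> (e.1 < e.2)%N.
  by rewrite mem_filter => /andP[/andP[]].
pose c := cut_metric f g.
suff key (es fs : seq ('I_v * 'I_v)) : uniq (fs ++ es) ->
    (forall e, e \in fs ++ es -> (e.1 < e.2)%N) ->
    `| cube_integral (fun s => edge_prod (fun=> kernel_ext g) fs s *
                               edge_prod (fun=> kernel_ext f) es s) -
       cube_integral (fun s => edge_prod (fun=> kernel_ext g) (fs ++ es) s)|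
    <= (size es)%:R * c.
  have := key (edges H) [::] uE ltE; rewrite /=.
  rewrite (_ : cube_integral (fun s => edge_prod _ [::] s * _) =
    cube_integral (fun s => edge_prod (fun=> kernel_ext f) (edges H) s)) //.
  by apply: eq_cube => s _; rewrite {1}/edge_prod big_nil mul1r.
elim: es fs => [|e es IHes] fs ufe lfe.
  rewrite (_ : cube_integral (fun s => edge_prod _ fs s * _) =
    cube_integral (fun s => edge_prod (fun=> kernel_ext g) (fs ++ [::]) s)).
    by rewrite subrr normr0 mul0r.
  by apply: eq_cube => s _; rewrite cats0 [X in _ * X]/edge_prod big_nil mulr1.
have ufe' : uniq (rcons fs e ++ es) by rewrite cat_rcons.
have lfe' x : x \in rcons fs e ++ es -> (x.1 < x.2)%N by rewrite cat_rcons; exact: lfe.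
have := IHes _ ufe' lfe'; rewrite cat_rcons.
have bprod h L : graphon h -> bmeas (edge_prod (fun=> kernel_ext h) L : v.-tuple R -> R).
  by move=> gh; apply: bmeas_edge_prod => _; exact: bmeas_kernel_ext.
set X := cube_integral _; set Y := cube_integral _; move=> XY.
set Z := cube_integral _.
rewrite -(subrKA X) (le_trans (ler_normD _ _)) //= -natr1 mulrDl mul1r addrC.
apply: lerD => //.
rewrite /Z /X -cubeB; [|by apply: bmeasM; exact: bprod..].
pose K x := if x \in fs then kernel_ext g else kernel_ext f.
have eE : e \notin fs /\ e \notin es.
  by move: ufe; rewrite cat_uniq /= negb_or => /and3P[_ /andP[-> _] /andP[-> _]].
have disj x : x \in es -> x \notin fs.
  move=> xes; move: ufe; rewrite cat_uniq => /and3P[_ /hasPn h _].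
  by apply: h; rewrite inE xes orbT.
have lt12 : (e.1 < e.2)%N by apply: lfe; rewrite mem_cat inE eqxx orbT.
rewrite (_ : cube_integral _ = cube_integral (fun s : v.-tuple R =>
    kernel_diff f g (tnth s e.1, tnth s e.2) * edge_prod K (fs ++ es) s)).
  apply: single_edge_bound.
  - by move=> x; rewrite /K; case: ifP.
  - by move=> x z; rewrite /K; case: ifP => _; rewrite kernel_ext_ge0 ?kernel_ext_le1.
  - exact: bmeas_kernel_diff.
  - exact: cut_metric_rect.
  - by rewrite neq_ltn lt12.
  - by rewrite -surjective_pairing mem_cat negb_or; have [-> ->] := eE.
  - apply/negP; rewrite mem_cat => h; have : (e.2 < e.1)%N.
      by apply: (lfe (e.2, e.1)); rewrite mem_cat inE; case/orP: h => ->; rewrite ?orbT.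
    by rewrite ltnNge ltnW.
apply: eq_cube => s _.
rewrite /edge_prod big_cons -cats1 !big_cat /= big_cons big_nil mulr1.
rewrite (_ : \prod_(e0 <- fs) K e0 _ = \prod_(e0 <- fs) kernel_ext g (tnth s e0.1, tnth s e0.2)).
  rewrite (_ : \prod_(e0 <- es) K e0 _ = \prod_(e0 <- es) kernel_ext f (tnth s e0.1, tnth s e0.2)).
    rewrite /kernel_diff mulrBl; congr (_ - _); first by rewrite mulrCA.
    by rewrite [RHS]mulrA; congr (_ * _); rewrite mulrC.
  by apply: eq_big_seq => x /disj xfs; rewrite /K (negbTE xfs).
by apply: eq_big_seq => x xfs; rewrite /K xfs.
Qed.

Lemma hom_density_relabel v (H : rel 'I_v) f phi : graphon f -> mpbij phi ->
  hom_density H (relabel f phi) = hom_density H f.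
Proof.
move=> gf pphi; rewrite !hom_densityE.
have bF : bmeas (edge_prod (fun=> kernel_ext f) (edges H) : v.-tuple R -> R).
  by apply: bmeas_edge_prod => _; exact: bmeas_kernel_ext.
rewrite -[RHS](cube_preserves bF (map_ext_preserves pphi)); apply: eq_cube => s _.
apply: eq_bigr => e _; rewrite kernel_ext_relabel //=.
by rewrite !tnth_map.
Qed.

Lemma hom_density_cut_dist v (H : rel 'I_v) f g : graphon f -> graphon g ->
  `| hom_density H f - hom_density H g | <= (size (edges H))%:R * cut_dist f g.
Proof.
move=> gf gg; apply/ler_addgt0Pr => e e0.
set E : R := (size (edges H))%:R.
have E0 : 0 <= E by rewrite ler0n.
have [phi pphi fg] : exists2 phi, mpbij phi &
    cut_metric f (relabel g phi) < cut_dist f g + e / (E + 1).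
  by apply: cut_dist_lt; rewrite ltrDl divr_gt0 // ltr_wpDl.
rewrite -(hom_density_relabel H gg pphi).
apply: le_trans (counting_lemma H gf (graphon_relabel gg pphi)) _.
apply: le_trans (ler_wpM2l E0 (ltW fg)) _; rewrite mulrDr lerD2l.
rewrite mulrCA; apply: ler_piMr; first exact: ltW.
by rewrite ler_pdivrMr ?mul1r ?lerDl // ltr_wpDl.
Qed.

End Counting.

(** * Blocks and step kernels *)

Section Blocks.
Context {R : realType}.
Variables (m : nat) (gam : 'I_m -> rat).
Hypothesis gamP : rat_simplex gam.
Local Notation mu := (@lebesgue_measure R).

Definition block_len (i : 'I_m) : R := ratr (gam i).

Local Notation ps := (@partial_sum R m gam).

Lemma block_len_ge0 i : 0 <= block_len i.
Proof. by rewrite ler0q; have [/(_ i)/andP[]] := gamP. Qed.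

Lemma sum_block_len : \sum_i block_len i = 1.
Proof. by rewrite -rmorph_sum /=; have [_ ->] := gamP; rewrite rmorph1. Qed.

Lemma partial_sum0 : ps 0 = 0.
Proof. by rewrite /partial_sum big_pred0 ?rmorph0. Qed.

Lemma partial_sum_all : ps m = 1.
Proof.
rewrite /partial_sum (eq_bigl xpredT) => [|i]; last by rewrite ltn_ord.
by have [_ ->] := gamP; rewrite rmorph1.
Qed.

Lemma partial_sumS (j : 'I_m) : ps j.+1 = ps j + block_len j.
Proof.
rewrite /partial_sum (bigD1 j) //= rmorphD /= addrC; congr (ratr _ + _).
by apply: eq_bigl => i; rewrite ltnS ltn_neqAle andbC.
Qed.

Lemma partial_sum_le k l : (k <= l)%N -> ps k <= ps l.
Proof.
move=> kl; rewrite /partial_sum ler_rat big_mkcond [leRHS]big_mkcond /=.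
apply: ler_sum => i _; have [/(_ i)/andP[g0 _] _] := gamP.
by case: ifPn => [ik|_]; [rewrite (leq_trans ik kl)|case: ifP].
Qed.

Lemma block_itv (j : 'I_m) :
  block gam j = [set` Interval (BSide (j == 0%N :> nat) (ps j)) (BRight (ps j.+1))].
Proof.
apply/seteqP; split=> x; rewrite /block /= in_itv /=; case: (altP (j =P 0%N :> nat)).
- by move=> ->; rewrite partial_sum0.
- by [].
- by move=> ->; rewrite partial_sum0.
- by [].
Qed.

Lemma measurable_block j : measurable (@block R m gam j).
Proof. by rewrite block_itv; exact: measurable_itv. Qed.

Lemma block_unitI j : @block R m gam j `<=` unitI.
Proof.
move=> x /=; rewrite /block /= => /andP[x0 x1].
rewrite /unitI /= (le_trans x1) ?andbT; last first.
  by rewrite -partial_sum_all; apply: partial_sum_le.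
by move: x0; case: ifP => // _ /ltW; apply: le_trans; rewrite -partial_sum0 partial_sum_le.
Qed.

Lemma mu_block j : mu (@block R m gam j) = (block_len j)%:E.
Proof.
rewrite block_itv lebesgue_measure_itv /= partial_sumS lte_fin ltrDl.
case: ifPn => [_|]; first by rewrite -EFinB addrAC subrr add0r.
by rewrite -leNgt => h; congr EFin; apply/eqP; rewrite eq_le h block_len_ge0.
Qed.

Lemma block_inj i j (x : R) : block gam i x -> block gam j x -> i = j.
Proof.
have lt (k l : 'I_m) : (k < l)%N -> block gam k x -> block gam l x -> False.
  move=> kl; rewrite /block /= => /andP[_ h1] /andP[+ _].
  rewrite (gtn_eqF (leq_ltn_trans _ kl)) // ltNge.
  by rewrite (le_trans h1) // partial_sum_le.
move=> bi bj; case: (ltngtP i j) => [ij|ij|/val_inj//].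
  by case: (lt _ _ ij bi bj).
by case: (lt _ _ ij bj bi).
Qed.

Lemma ex_block (x : R) : unitI x -> exists j, block gam j x.
Proof.
move=> /andP[x0 x1].
have m0 : (0 < m)%N.
  rewrite lt0n; apply/eqP => m0; move: gamP => -[_].
  move: gam; rewrite m0 => g; rewrite big_ord0 => /eqP.
  by rewrite eq_sym oner_eq0.
have ex : exists k, (k < m)%N && (x <= ps k.+1).
  by exists m.-1; rewrite prednK // leqnn /= partial_sum_all.
case: (ex_minnP ex) => k /andP[km xk] kmin.
exists (Ordinal km); rewrite /block /= xk andbT.
case: k km xk kmin => [//|k] km xk kmin /=; rewrite ltNge; apply/negP => xk'.
by have := kmin k; rewrite xk' (ltn_trans (ltnSn k) km) ltnn => /(_ isT).
Qed.

Definition block_ind (j : 'I_m) (x : R) : R := \1_(@block R m gam j) x.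

Lemma bmeas_block_ind j : bmeas (block_ind j).
Proof. by apply: bmeas_indic; exact: measurable_block. Qed.

Lemma block_ind_in i j x : block gam j x -> block_ind i x = (i == j)%:R.
Proof.
move=> bj; rewrite /block_ind indicE; congr (_%:R); congr nat_of_bool.
apply/idP/eqP => [/set_mem bi|->]; last exact: mem_set.
exact: block_inj bi bj.
Qed.

Lemma sum_block_ind (c : 'I_m -> R) j x : block gam j x ->
  \sum_i block_ind i x * c i = c j.
Proof.
move=> bj; rewrite (bigD1 j) //= big1 => [|i ij]; rewrite (block_ind_in _ bj).
  by rewrite eqxx mul1r addr0.
by rewrite (negbTE ij) mul0r.
Qed.

Lemma block_ind01 j x : 0 <= block_ind j x <= 1.
Proof. by rewrite /block_ind indicE; case: (_ \in _); rewrite /= ?lexx ?ler01. Qed.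

Lemma Ex_block_ind j : Ex (block_ind j) = block_len j.
Proof.
rewrite /Ex /Rintegral /block_ind integral_indic.
- by rewrite setIidl; [rewrite [X in fine X]mu_block|exact: block_unitI].
- exact: measurable_unitI.
- exact: measurable_block.
Qed.

Lemma Ex_blocks (u : R -> R) : bmeas u ->
  Ex u = \sum_i Ex (fun x => block_ind i x * u x).
Proof.
move=> bu; rewrite -Ex_sum; last by move=> i _; apply: bmeasM => //; exact: bmeas_block_ind.
apply: eq_Ex => x /set_mem/ex_block[j bj].
by rewrite (sum_block_ind (fun=> u x) bj).
Qed.

Lemma Ex_null_block j (u : R -> R) : bmeas u -> block_len j = 0 ->
  Ex (fun x => block_ind j x * u x) = 0.
Proof.
move=> bu j0; have [_ [M uM]] := bu.
have M0 : 0 <= M by rewrite (le_trans _ (uM 0)).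
have bj := bmeas_block_ind j; have bju := bmeasM bj bu.
apply/eqP; rewrite -normr_le0; apply: le_trans (ler_norm_Ex bju) _.
apply: (@le_trans _ _ (Ex (fun x => M * block_ind j x))); last first.
  by rewrite ExZ // Ex_block_ind j0 mulr0.
apply: le_Ex; [exact: bmeas_norm|by apply: bmeasM => //; exact: bmeas_cst|].
move=> x _; have /andP[b0 _] := block_ind01 j x.
by rewrite normrM ger0_norm // mulrC ler_wpM2r.
Qed.

Definition step_kernel (p : 'I_m -> 'I_m -> R) (z : R * R) : R :=
  \sum_i block_ind i z.1 * (\sum_j block_ind j z.2 * p i j).

Lemma step_kernelE p i j x y : block gam i x -> block gam j y ->
  step_kernel p (x, y) = p i j.
Proof. by move=> bi bj; rewrite /step_kernel /= (sum_block_ind _ bi) (sum_block_ind _ bj). Qed.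

Lemma bmeas_step_kernel p : bmeas (step_kernel p).
Proof.
apply: bmeas_sum => i _; apply: bmeasM; first by apply: bmeas_fst; exact: bmeas_block_ind.
apply: bmeas_sum => j _; apply: bmeasM; last exact: bmeas_cst.
by apply: bmeas_snd; exact: bmeas_block_ind.
Qed.

Lemma graphon_step_kernel p : (forall i j, p i j = p j i) ->
  (forall i j, 0 <= p i j <= 1) -> block_graphon gam (step_kernel p).
Proof.
move=> pC p01; split; last first.
  by exists p; split=> // i j x y bi bj; exact: step_kernelE.
split.
- by have [mp _] := bmeas_step_kernel p; exact: measurable_funTS.
- move=> x y /ex_block[i bi] /ex_block[j bj].
  by rewrite (step_kernelE _ bi bj) (step_kernelE _ bj bi).
- by move=> [x y] [/= /ex_block[i bi] /ex_block[j bj]]; rewrite (step_kernelE _ bi bj).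
Qed.

(** The value of [cube_integral] on functions that only see in which block
    each variable lies. *)
Fixpoint block_sum n : (n.-tuple 'I_m -> R) -> R :=
  match n with
  | 0 => fun P => P [tuple]
  | n'.+1 => fun P => \sum_a block_len a * block_sum (fun s => P (cons_tuple a s))
  end.

Lemma eq_block_sum n (P Q : n.-tuple 'I_m -> R) : P =1 Q -> block_sum P = block_sum Q.
Proof.
elim: n P Q => [|n IHn] P Q PQ /=; first exact: PQ.
by apply: eq_bigr => a _; congr (_ * _); apply: IHn => s; exact: PQ.
Qed.

Lemma le_block_sum n (P Q : n.-tuple 'I_m -> R) : (forall s, P s <= Q s) ->
  block_sum P <= block_sum Q.
Proof.
elim: n P Q => [|n IHn] P Q PQ /=; first exact: PQ.
apply: ler_sum => a _; apply: ler_wpM2l; first exact: block_len_ge0.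
by apply: IHn => s; exact: PQ.
Qed.

Lemma block_sum_lincomb n (P : 'I_m -> n.-tuple 'I_m -> R) (c : 'I_m -> R) :
  block_sum (fun s => \sum_a c a * P a s) = \sum_a c a * block_sum (P a).
Proof.
elim: n P => [//|n IHn] P /=.
transitivity (\sum_b block_len b *
    \sum_a c a * block_sum (fun s => P a (cons_tuple b s))).
  by apply: eq_bigr => b _; rewrite -IHn.
under eq_bigr do rewrite big_distrr.
rewrite exchange_big; apply: eq_bigr => a _ /=.
by rewrite big_distrr; apply: eq_bigr => b _ /=; rewrite mulrCA.
Qed.

Lemma bmeas_block_sum {d} {T : measurableType d} n (K : T -> n.-tuple 'I_m -> R) :
  (forall s, bmeas (fun t => K t s)) -> bmeas (fun t => block_sum (K t)).
Proof.
elim: n K => [|n IHn] K bK /=; first exact: bK.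
apply: bmeas_sum => a _; apply: bmeasM; first exact: bmeas_cst.
by apply: IHn => s; exact: bK.
Qed.

Lemma Ex_block_sum n (K : R -> n.-tuple 'I_m -> R) :
  (forall s, bmeas (fun x => K x s)) ->
  Ex (fun x => block_sum (K x)) = block_sum (fun s => Ex (fun x => K x s)).
Proof.
elim: n K => [//|n IHn] K bK /=.
have bn a : bmeas (fun x => block_sum (fun s => K x (cons_tuple a s))).
  by apply: bmeas_block_sum.
rewrite Ex_sum => [|a _]; last by apply: bmeasM => //; exact: bmeas_cst.
by apply: eq_bigr => a _; rewrite ExZ // IHn.
Qed.

Section block_index.
Variable i0 : 'I_m.

Definition block_index (x : R) : 'I_m := odflt i0 [pick j | x \in block gam j].

Lemma block_indexP x : unitI x -> block gam (block_index x) x.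
Proof.
move=> /ex_block[j bj]; rewrite /block_index; case: pickP => [k /set_mem //|/(_ j)].
by rewrite mem_set.
Qed.

Lemma cube_block_index n (P : n.-tuple 'I_m -> R) :
  cube_integral (fun s => P (map_tuple block_index s)) = block_sum P.
Proof.
elim: n P => [|n IHn] P /=; first by congr P; apply: val_inj.
transitivity (Ex (fun x => \sum_a block_ind a x *
    block_sum (fun s => P (cons_tuple a s)))).
  apply: eq_Ex => x /set_mem Ux; rewrite (sum_block_ind _ (block_indexP Ux)).
  by rewrite -IHn; apply: eq_cube => s _; congr P; apply: val_inj.
have bji (i : 'I_m) := bmeas_block_ind i.
rewrite Ex_sum => [|a _]; last by apply: bmeasM => //; exact: bmeas_cst.
apply: eq_bigr => a _; under [X in Ex X]eq_fun do rewrite mulrC.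
by rewrite ExZ // Ex_block_ind mulrC.
Qed.

End block_index.

Lemma hom_density_step v (H : rel 'I_v) (f : R * R -> R) (p : 'I_m -> 'I_m -> R) :
  (forall i j x y, block gam i x -> block gam j y -> f (x, y) = p i j) ->
  hom_density H f =
  block_sum (fun s : v.-tuple 'I_m => \prod_(e <- edges H) p (tnth s e.1) (tnth s e.2)).
Proof.
have U0 : unitI (0 : R) by rewrite /unitI /= lexx ler01.
have [i0 _] := ex_block U0.
move=> fp; rewrite -(cube_block_index i0); apply: eq_cube => s Us.
rewrite big_filter; apply: eq_bigr => e _; rewrite !tnth_map.
by apply: fp; apply: block_indexP; exact: Us.
Qed.

End Blocks.

(** * Hoelder's inequality on blocks *)

Section BlockHoelder.
Context {R : realType}.
Variables (m : nat) (gam : 'I_m -> rat).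
Hypothesis gamP : rat_simplex gam.
Variable d : nat.
Hypothesis d0 : (0 < d)%N.

Local Notation len := (@block_len R m gam).
Local Notation ind := (@block_ind R m gam).

Definition root_d (a : R) : R := a `^ d%:R^-1.

Lemma root_d_ge0 a : 0 <= root_d a.
Proof. exact: powR_ge0. Qed.

Lemma root_dK a : 0 <= a -> root_d a ^+ d = a.
Proof.
move=> a0; rewrite -powR_mulrn ?root_d_ge0 // /root_d -powRrM mulVf ?powRr1 //.
by rewrite pnatr_eq0 -lt0n.
Qed.

Lemma root_d_le1 a : 0 <= a <= 1 -> root_d a <= 1.
Proof.
move=> /andP[a0 a1]; rewrite -(ler_pXn2r d0) ?nnegrE ?root_d_ge0 //.
by rewrite root_dK // expr1n.
Qed.

Lemma bmeas_root_d {e} {T : measurableType e} (u : T -> R) :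
  bmeas u -> (forall t, 0 <= u t <= 1) -> bmeas (fun t => root_d (u t)).
Proof.
move=> [mu _] u01; split.
  apply: (measurableT_comp (f := fun a : R => a `^ d%:R^-1)) => //.
by exists 1 => t; rewrite ger0_norm ?root_d_ge0 // root_d_le1.
Qed.

Lemma prod_addr_le (I : Type) (r : seq I) (N : I -> R) : (forall i, 0 <= N i) ->
  exists C, 0 <= C /\ forall e, 0 <= e <= 1 ->
    \prod_(i <- r) (N i + e) <= \prod_(i <- r) N i + C * e.
Proof.
move=> N0; elim: r => [|i r [C [C0 IHr]]].
  by exists 0; split=> // e _; rewrite !big_nil mul0r addr0.
have P0 : 0 <= \prod_(j <- r) N j by apply: prodr_ge0.
exists (N i * C + \prod_(j <- r) N j + C); split.
  by rewrite !addr_ge0 // mulr_ge0.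
move=> e /andP[e0 e1]; rewrite !big_cons.
have Ne : 0 <= N i + e by rewrite addr_ge0.
apply: le_trans (ler_wpM2l Ne (IHr e _)) _; first by rewrite e0.
have := N0 i; move: (N i) (\prod_(j <- r) N j) P0 {IHr Ne} => n p p0 n0.
have : C * e * e <= C * e by rewrite ler_piMr // mulr_ge0.
nra.
Qed.

(** Hoelder's inequality for [d] functions, each measured in the [d]-norm. For
    strictly positive norms it integrates the inequality of arithmetic and
    geometric means of the normalized functions; adding [e] to every norm and
    letting [e] tend to zero covers vanishing norms. *)
Lemma block_hoelder (I : finType) (A : {pred I}) (u : I -> R -> R) (N : I -> R) a :
  #|A| = d -> (forall k, bmeas (u k)) -> (forall k x, 0 <= u k x) ->
  (forall k, 0 <= N k) ->
  (forall k, k \in A -> Ex (fun x => ind a x * u k x ^+ d) = len a * N k ^+ d) ->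
  Ex (fun x => ind a x * \prod_(k in A) u k x) <= len a * \prod_(k in A) N k.
Proof.
move=> cardA bu u0 N0 uN.
have la := block_len_ge0 (R := R) gamP a.
have bi := bmeas_block_ind (R := R) gam a.
have bprod : bmeas (fun x => \prod_(k in A) u k x) by apply: bmeas_prod => k _.
have step e : 0 < e -> Ex (fun x => ind a x * \prod_(k in A) u k x) <=
    len a * \prod_(k in A) (N k + e).
  move=> e0; pose M k := N k + e.
  have M0 k : 0 < M k by rewrite ltr_wpDl.
  have PM : 0 <= \prod_(k in A) M k by apply: prodr_ge0 => k _; exact: ltW.
  have bsum : bmeas (fun x => \sum_(k in A) (M k ^+ d)^-1 * (ind a x * u k x ^+ d)).
    apply: bmeas_sum => k _; apply: bmeasM; first exact: bmeas_cst.
    by apply: bmeasM => //; exact: bmeasX.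
  apply: (@le_trans _ _ (Ex (fun x => (\prod_(k in A) M k / d%:R) *
      \sum_(k in A) (M k ^+ d)^-1 * (ind a x * u k x ^+ d)))).
    apply: le_Ex; first exact: bmeasM.
      by apply: bmeasM => //; exact: bmeas_cst.
    move=> x _; have /andP[i0 _] := block_ind01 (R := R) gam a x.
    rewrite [X in _ <= _ * X](eq_bigr (fun k => ind a x * (u k x / M k) ^+ d)); last first.
      by move=> k _; rewrite expr_div_n mulrCA; congr (_ * _); rewrite mulrC.
    rewrite -big_distrr /= mulrCA; apply: ler_wpM2l => //.
    rewrite -mulrA [leLHS](_ : _ = \prod_(k in A) M k * \prod_(k in A) (u k x / M k)); last first.
      rewrite -big_split /=; apply: eq_bigr => k _.
      by rewrite mulrC divfK // gt_eqF.
    apply: ler_wpM2l => //.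
    have w0 k : 0 <= u k x / M k by rewrite divr_ge0 // ltW.
    rewrite -(ler_pXn2r d0) ?nnegrE; last 2 first.
    - by apply: prodr_ge0.
    - by rewrite mulr_ge0 ?invr_ge0 ?ler0n // sumr_ge0 // => k _; exact: exprn_ge0.
    have [+ _] := leif_AGM (A := A) (E := fun k => (u k x / M k) ^+ d)
      (fun k _ => exprn_ge0 d (w0 k)).
    by rewrite cardA prodrXl mulrC.
  rewrite ExZ // Ex_sum; last first.
    move=> k _; apply: bmeasM; first exact: bmeas_cst.
    by apply: bmeasM => //; exact: bmeasX.
  have sum_le : \sum_(k in A) Ex (fun x => (M k ^+ d)^-1 * (ind a x * u k x ^+ d)) <=
      d%:R * len a.
    rewrite -[in leRHS]cardA mulr_natl -sumr_const; apply: ler_sum => k kA.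
    rewrite ExZ; last by apply: bmeasM => //; exact: bmeasX.
    rewrite uN // mulrCA ler_piMr // mulrC ler_pdivrMr ?mul1r ?exprn_gt0 //.
    by rewrite lerXn2r ?nnegrE ?lerDl // ltW.
  have dR : 0 < d%:R :> R by rewrite ltr0n.
  apply: le_trans (ler_wpM2l _ sum_le) _; first by rewrite divr_ge0 // ltW.
  by rewrite mulrA divfK ?gt_eqF // [leLHS]mulrC.
have [C [C0 prodC]] := prod_addr_le (enum A) N0.
apply/ler_addgt0Pr => e e0.
pose e' := Num.min 1 (e / (C + 1)).
have C1 : 0 < C + 1 by rewrite ltr_wpDl.
have e'0 : 0 < e' by rewrite lt_min ltr01 divr_gt0.
have e'1 : 0 <= e' <= 1 by rewrite ltW // ge_min lexx.
apply: le_trans (step e' e'0) _; rewrite -[X in len a * X](big_enum _ _ A).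
apply: le_trans (ler_wpM2l la (prodC e' e'1)) _.
rewrite big_enum mulrDr lerD2l.
have la1 : len a <= 1.
  rewrite -(sum_block_len gamP) (bigD1 a) //= lerDl sumr_ge0 // => i _.
  exact: block_len_ge0.
have Ce0 : 0 <= C * e' by case/andP: e'1 => ? _; exact: mulr_ge0.
apply: (@le_trans _ _ (C * e')); first by rewrite ler_piMl.
apply: (@le_trans _ _ (C * (e / (C + 1)))).
  by apply: ler_wpM2l => //; rewrite ge_min lexx orbT.
rewrite mulrCA; apply: ler_piMr; first exact: ltW.
by rewrite ler_pdivrMr ?mul1r ?lerDl.
Qed.

Variable F : R * R -> R.
Hypothesis bF : bmeas F.
Hypothesis F01 : forall z, 0 <= F z <= 1.
Hypothesis FC : forall x y, F (x, y) = F (y, x).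

Definition block_avg (a : 'I_m) (u : R -> R) : R :=
  (len a)^-1 * Ex (fun x => ind a x * u x).

Definition half_norm (a : 'I_m) (y : R) : R :=
  root_d (block_avg a (fun x => F (x, y) ^+ d)).

Definition block_norm (a b : 'I_m) : R :=
  root_d (block_avg a (fun x => block_avg b (fun y => F (x, y) ^+ d))).

(** A kernel together with its partial and full block norms, as one function
    on points and block labels: each variable can then be integrated out and
    replaced by a label separately. *)
Definition label_kernel (y z : R + 'I_m) : R :=
  match y, z with
  | inl x, inl y => F (x, y)
  | inr a, inl y => half_norm a y
  | inl x, inr b => half_norm b x
  | inr a, inr b => block_norm a b
  end.

Lemma block_avg01 a u : bmeas u -> (forall x, 0 <= u x <= 1) ->
  0 <= block_avg a u <= 1.
Proof.
move=> bu u01; rewrite /block_avg.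
have la := block_len_ge0 (R := R) gamP a; have bi := bmeas_block_ind (R := R) gam a.
have E0 : 0 <= Ex (fun x => ind a x * u x).
  apply: Ex_ge0 => x _; have /andP[? _] := block_ind01 (R := R) gam a x.
  by have /andP[? _] := u01 x; exact: mulr_ge0.
rewrite mulr_ge0 ?invr_ge0 //=.
have [l0|l0] := eqVneq (len a) 0; first by rewrite l0 invr0 mul0r ler01.
rewrite ler_pdivrMl ?mulr1 ?lt_def ?l0 //.
rewrite -[leRHS](Ex_block_ind gamP); apply: le_Ex => //; first exact: bmeasM.
move=> x _; have /andP[? _] := block_ind01 (R := R) gam a x.
by have /andP[_ ?] := u01 x; exact: ler_piMr.
Qed.

Lemma bmeas_block_avg {e} {T : measurableType e} a (u : T * R -> R) : bmeas u ->
  bmeas (fun t => block_avg a (fun x => u (t, x))).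
Proof.
move=> bu; apply: bmeasM; first exact: bmeas_cst.
apply: (@Ex_bmeas _ _ _ (fun z => ind a z.2 * u z)); apply: bmeasM => //.
by apply: (bmeas_comp (g := snd)) => //; exact: bmeas_block_ind.
Qed.

Let bFd : bmeas (fun z => F z ^+ d). Proof. exact: bmeasX. Qed.

Let Fd01 z : 0 <= F z ^+ d <= 1.
Proof. by have /andP[? ?] := F01 z; rewrite exprn_ge0 // exprn_ile1. Qed.

Let bFy y : bmeas (fun x => F (x, y) ^+ d).
Proof. exact: (Ex_bmeas1 y (bmeas_swap bFd)). Qed.

Lemma bmeas_half_norm a : bmeas (half_norm a).
Proof.
apply: bmeas_root_d; first exact: (bmeas_block_avg a (bmeas_swap bFd)).
by move=> y; apply: block_avg01.
Qed.

Lemma label_kernel_ge0 y z : 0 <= label_kernel y z.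
Proof.
by case: y z => [x|a] [y|b] /=; rewrite ?root_d_ge0 //; have /andP[] := F01 (x, y).
Qed.

Lemma label_kernelC y z : label_kernel y z = label_kernel z y.
Proof.
case: y z => [x|a] [y|b] /=; [exact: FC|by []|by []|].
rewrite /block_norm; apply: (congr1 root_d); rewrite /block_avg.
have ba (c : 'I_m) := bmeas_block_ind (R := R) gam c.
have bG c : bmeas (fun z : R * R => ind c z.2 * F z ^+ d).
  by apply: bmeasM => //; exact: bmeas_snd.
have bE c : bmeas (fun x => Ex (fun y => ind c y * F (x, y) ^+ d)).
  exact: (Ex_bmeas (bG c)).
have pull a' b' : Ex (fun x => ind a' x * ((len b')^-1 *
    Ex (fun y => ind b' y * F (x, y) ^+ d))) =
    (len b')^-1 * Ex (fun x => Ex (fun y => ind a' x * (ind b' y * F (x, y) ^+ d))).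
  rewrite -ExZ; last first.
    apply: (@Ex_bmeas _ _ _ (fun z => ind a' z.1 * (ind b' z.2 * F z ^+ d))).
    by apply: bmeasM => //; exact: bmeas_fst.
  congr Ex; apply/funext => x; rewrite ExZ; first by rewrite mulrCA.
  exact: (Ex_bmeas1 x (bG b')).
rewrite !pull mulrCA; do 2 apply: (congr1 (fun u => _ * u)).
rewrite (Ex_swap (F := fun z => ind a z.1 * (ind b z.2 * F z ^+ d))) /=; last first.
  by apply: bmeasM => //; exact: bmeas_fst.
congr Ex; apply/funext => y; congr Ex; apply/funext => x /=.
by rewrite mulrCA FC.
Qed.

Lemma block_norm_le1 a b : block_norm a b <= 1.
Proof.
apply: root_d_le1; apply: block_avg01; first exact: (bmeas_block_avg b bFd).
move=> x; apply: block_avg01 => //; exact: (Ex_bmeas1 x bFd).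
Qed.

Lemma bmeas_label_kernel1 z : bmeas (fun x => label_kernel (inl x) z).
Proof.
case: z => [y|b] /=; last exact: bmeas_half_norm.
exact: (Ex_bmeas1 y (bmeas_swap bF)).
Qed.

(** In the [d]-norm over a block, a variable can be traded for the label of the
    block; the other argument may be a point or a label. *)
Lemma label_kernel_norm a z :
  Ex (fun x => ind a x * label_kernel (inl x) z ^+ d) =
  len a * label_kernel (inr a) z ^+ d.
Proof.
have [l0|l0] := eqVneq (len a) 0.
  by rewrite l0 mul0r Ex_null_block //; exact/bmeasX/bmeas_label_kernel1.
case: z => [y|b] /=.
  rewrite root_dK; last by case/andP: (block_avg01 a (bFy y) (fun x => Fd01 (x, y))).
  by rewrite /block_avg mulVKf.
have avg01 x := block_avg01 b (Ex_bmeas1 x bFd) (fun y => Fd01 (x, y)).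
rewrite /block_norm [X in _ = _ * X]root_dK; last first.
  case/andP: (block_avg01 a (bmeas_block_avg b bFd) avg01) => + _.
  by [].
rewrite /block_avg mulVKf //; congr Ex; apply/funext => x; congr (_ * _).
rewrite /half_norm root_dK /block_avg.
  by congr (_ * Ex _); apply/funext => y; rewrite FC.
by case/andP: (block_avg01 b (bFy x) (fun y => Fd01 (y, x))).
Qed.

End BlockHoelder.

(** * Densities and block norms *)

Section Comparison.
Context {R : realType}.
Variables (m : nat) (gam : 'I_m -> rat).
Hypothesis gamP : rat_simplex gam.

Local Notation len := (@block_len R m gam).
Local Notation ind := (@block_ind R m gam).

Definition mixed_tuple n (t : n.-tuple (option 'I_m)) (s : n.-tuple R) :
    n.-tuple (R + 'I_m) :=
  [tuple if tnth t i is Some a then inr a else inl (tnth s i) | i < n].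

Lemma mixed_cons n o (t : n.-tuple (option 'I_m)) x (s : n.-tuple R) :
  mixed_tuple (cons_tuple o t) (cons_tuple x s) =
  cons_tuple (if o is Some a then inr a else inl x) (mixed_tuple t s).
Proof.
apply: eq_from_tnth => i; rewrite tnth_mktuple.
by case: (unliftP ord0 i) => [j ->|->]; rewrite ?tnth0 ?tnthS ?tnth_mktuple.
Qed.

Lemma mixed_None n (s : n.-tuple R) :
  mixed_tuple [tuple None | i < n] s = map_tuple inl s.
Proof. by apply: eq_from_tnth => i; rewrite !tnth_mktuple tnth_map. Qed.

Lemma mixed_Some n (t : n.-tuple 'I_m) (s : n.-tuple R) :
  mixed_tuple (map_tuple Some t) s = map_tuple inr t.
Proof. by apply: eq_from_tnth => i; rewrite tnth_mktuple !tnth_map. Qed.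

Lemma map_cons_tuple (T U : Type) (h : T -> U) n x (s : n.-tuple T) :
  map_tuple h (cons_tuple x s) = cons_tuple (h x) (map_tuple h s).
Proof. exact: val_inj. Qed.

(** If replacing any single variable by labels does not decrease the integral,
    all variables can be replaced, the innermost one first. *)
Lemma cube_le_block_sum n (G : n.-tuple (R + 'I_m) -> R) :
  (forall t, bmeas (fun s => G (mixed_tuple t s))) ->
  (forall s i, Ex (fun x => G (tuple_upd s i (inl x))) <=
               \sum_a len a * G (tuple_upd s i (inr a))) ->
  cube_integral (fun s => G (map_tuple inl s)) <=
  block_sum gam (fun s => G (map_tuple inr s)).
Proof.
elim: n G => [|n IHn] G mG locG /=.
  by rewrite (_ : map_tuple inl _ = map_tuple inr [tuple]) //; exact: val_inj.
pose Gx x s := G (cons_tuple (inl x) s).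
have cubeE x : cube_integral (fun s => G (map_tuple inl (cons_tuple x s))) =
    cube_integral (fun s => Gx x (map_tuple inl s)).
  by apply: eq_cube => s _; rewrite map_cons_tuple.
have bGx s : bmeas (fun x => Gx x (map_tuple inr s)).
  pose s0 : n.-tuple R := [tuple 0 | i < n].
  have := mG (cons_tuple None (map_tuple Some s)).
  move=> /(bmeas_comp (g := fun x => cons_tuple x s0)) h.
  rewrite (_ : (fun x => Gx x _) = (fun x => G (mixed_tuple
    (cons_tuple None (map_tuple Some s)) (cons_tuple x s0)))).
    by apply: h; exact: measurable_cons.
  by apply/funext => x; rewrite mixed_cons mixed_Some.
apply: (@le_trans _ _ (Ex (fun x => block_sum gam (fun s => Gx x (map_tuple inr s))))).
  apply: le_Ex.
  - have := mG [tuple None | i < n.+1]; under eq_fun do rewrite mixed_None.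
    exact: bmeas_cube_cons.
  - by apply: bmeas_block_sum => s; exact: bGx.
  - move=> x _; rewrite cubeE; apply: IHn => [t|s i].
      have := bmeas_cons_tuple x (mG (cons_tuple None t)).
      by under eq_fun do rewrite mixed_cons.
    have := locG (cons_tuple (inl x) s) (lift ord0 i).
    under eq_fun do rewrite tuple_updS.
    by under eq_bigr do rewrite tuple_updS.
rewrite Ex_block_sum //.
rewrite [leRHS](_ : _ = \sum_a len a *
    block_sum gam (fun s => G (cons_tuple (inr a) (map_tuple inr s)))); last first.
  apply: eq_bigr => a _; congr (_ * _); apply: eq_block_sum => s.
  by rewrite map_cons_tuple.
rewrite -block_sum_lincomb; apply: le_block_sum => // s.
have := locG (cons_tuple (inl 0) (map_tuple inr s)) ord0.
under eq_fun do rewrite tuple_upd0.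
by under eq_bigr do rewrite tuple_upd0.
Qed.

(** Each edge at [i] is counted once, as the pair of [i] and a neighbor, in
    whichever order [edges] lists its ends. *)
Lemma edges_split (Y : Type) (K : Y -> Y -> R) v (H : rel 'I_v)
    (y : v.-tuple Y) (i : 'I_v) : simple_graph H -> (forall a b, K a b = K b a) ->
  \prod_(e <- edges H) K (tnth y e.1) (tnth y e.2) =
  (\prod_(k in [set j | H i j]%SET) K (tnth y i) (tnth y k)) *
  \prod_(e <- edges H | ~~ ((e.1 == i) || (e.2 == i))) K (tnth y e.1) (tnth y e.2).
Proof.
move=> [Hsym Hirr] KC; rewrite (bigID (fun e => (e.1 == i) || (e.2 == i))) /=.
congr (_ * _); rewrite big_filter_cond.
pose h (j : 'I_v) := if (i < j)%N then (i, j) else (j, i).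
pose h' (e : 'I_v * 'I_v) := if e.1 == i then e.2 else e.1.
rewrite (reindex_onto h h') /=; last first.
  move=> [a b] /= /andP[/andP[ab Hab]]; rewrite /h /h' /=.
  case: (altP (a =P i)) => [ai _|ai /= /eqP bi]; first by rewrite -ai ab.
  by rewrite -bi ltnNge (ltnW ab).
apply: eq_big => [j|j _]; last by rewrite /h; case: ifP.
rewrite inE /h /h'; case: (ltngtP i j) => [ij|ji|/val_inj ij] /=.
- by rewrite ij !eqxx /= !andbT.
- have /negbTE ji' : j != i by rewrite neq_ltn ji.
  by rewrite ji ji' !eqxx !andbT Hsym.
- by rewrite ij ltnn /= Hirr.
Qed.

(** Finner's inequality in block form: every variable sits in exactly [d]
    factors, so Hoelder's inequality with exponent [d] applies to one variable
    at a time, and each edge ends up with its block [d]-norm. *)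
Lemma hom_density_le_block_norm v (H : rel 'I_v) d (f : R * R -> R) :
  (0 < d)%N -> simple_graph H -> regular_graph d H -> graphon f ->
  hom_density H f <= block_sum gam (fun s : v.-tuple 'I_m =>
    \prod_(e <- edges H) block_norm gam d (kernel_ext f) (tnth s e.1) (tnth s e.2)).
Proof.
move=> d0 sH rH gf.
have bF := bmeas_kernel_ext gf.
have F01 z : 0 <= kernel_ext f z <= 1 by rewrite kernel_ext_ge0 ?kernel_ext_le1.
have FC x y : kernel_ext f (x, y) = kernel_ext f (y, x) by exact: kernel_ext_sym.
pose K := label_kernel gam d (kernel_ext f).
have K0 y z : 0 <= K y z by exact: label_kernel_ge0.
have KC y z : K y z = K z y by exact: label_kernelC.
have bK z : bmeas (fun x => K (inl x) z) by exact: (bmeas_label_kernel1 gamP d0 bF).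
have normK a z : Ex (fun x => ind a x * K (inl x) z ^+ d) = len a * K (inr a) z ^+ d.
  exact: label_kernel_norm.
have bh a := bmeas_half_norm gamP d0 bF F01 a.
pose G (y : v.-tuple (R + 'I_m)) := \prod_(e <- edges H) K (tnth y e.1) (tnth y e.2).
rewrite [leLHS](_ : _ = cube_integral (fun s => G (map_tuple inl s))); last first.
  rewrite hom_densityE; apply: eq_cube => s _; apply: eq_bigr => e _.
  by rewrite !tnth_map.
rewrite [leRHS](_ : _ = block_sum gam (fun s => G (map_tuple inr s))); last first.
  by apply: eq_block_sum => s; apply: eq_bigr => e _; rewrite !tnth_map.
apply: cube_le_block_sum => [t|s i].
  apply: bmeas_prod => e _.
  under eq_fun do rewrite !tnth_mktuple.
  case: (tnth t e.1) => [a|]; case: (tnth t e.2) => [b|].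
  - exact: bmeas_cst.
  - apply: (bmeas_comp (g := fun s : v.-tuple R => tnth s e.2) (bh a)).
    exact: measurable_tnth.
  - apply: (bmeas_comp (g := fun s : v.-tuple R => tnth s e.1) (bh b)).
    exact: measurable_tnth.
  - exact: bmeas_edge.
pose rest := \prod_(e <- edges H | ~~ ((e.1 == i) || (e.2 == i)))
  K (tnth s e.1) (tnth s e.2).
have rest0 : 0 <= rest by apply: prodr_ge0.
have GE z : G (tuple_upd s i z) =
    rest * \prod_(k in [set j | H i j]%SET) K z (tnth s k).
  rewrite /G (edges_split _ i sH KC) mulrC; congr (_ * _).
    apply: eq_bigr => e; rewrite negb_or => /andP[/negbTE e1 /negbTE e2].
    by rewrite !tnth_upd e1 e2.
  apply: eq_bigr => k; rewrite inE !tnth_upd eqxx => Hik.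
  case: eqP => // ki; have [_ Hirr] := sH; by move: Hik; rewrite ki Hirr.
under eq_fun do rewrite GE.
under eq_bigr do rewrite GE mulrCA.
have bP : bmeas (fun x => \prod_(k in [set j | H i j]%SET) K (inl x) (tnth s k)).
  by apply: bmeas_prod.
rewrite ExZ // [leRHS](_ : _ = rest * \sum_a len a *
    \prod_(k in [set j | H i j]%SET) K (inr a) (tnth s k)); last first.
  by rewrite [RHS]big_distrr.
apply: ler_wpM2l => //.
rewrite (Ex_blocks gamP bP); apply: ler_sum => a _.
apply: (block_hoelder gamP d0 (u := fun k x => K (inl x) (tnth s k))
  (N := fun k => K (inr a) (tnth s k)) (rH i)) => //.
Qed.

End Comparison.

(** * The entropy and its supporting lines *)

Section Entropy.
Context {R : realType}.
Implicit Types p r u : R.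

Definition entropy p u : R := u * ln (u / p) + (1 - u) * ln ((1 - u) / (1 - p)).

Definition entropy_slope p r : R := ln (r / p) - ln ((1 - r) / (1 - p)).

Lemma ln_le_sub1 (x : R) : 0 < x -> ln x <= x - 1.
Proof.
move=> x0; rewrite -{1}(subrK 1 x) [X in ln X]addrC; apply: le_ln1Dx.
by rewrite ltrBrDl subrr.
Qed.

Lemma mul_ln_ratio p r u : 0 < p -> 0 < r -> 0 <= u ->
  u * ln (u / p) = u * ln (u / r) + u * ln (r / p).
Proof.
move=> p0 r0; rewrite le_eqVlt => /predU1P[<-|u0]; first by rewrite !mul0r addr0.
by rewrite !ln_div ?posrE // -mulrDr addrA subrK.
Qed.

(** The entropy is the Bregman divergence of itself. *)
Lemma entropy_bregman p r u : 0 < p < 1 -> 0 < r < 1 -> 0 <= u <= 1 ->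
  entropy p u = entropy p r + entropy_slope p r * (u - r) + entropy r u.
Proof.
move=> /andP[p0 p1] /andP[r0 r1] /andP[u0 u1].
rewrite /entropy (mul_ln_ratio p0 r0 u0) (@mul_ln_ratio (1 - p) (1 - r) (1 - u)) ?subr_gt0 ?subr_ge0 //.
by rewrite /entropy_slope; ring.
Qed.

(** With [u = a ^+ 2] and [r = b ^+ 2], the inequality [ln x <= x - 1] at
    [x = b / a] gives the excess [(a - b) ^+ 2], and [a + b <= 2] turns it into
    the square of [u - r]. *)
Lemma mul_ln_ge r u : 0 < r <= 1 -> 0 <= u <= 1 ->
  u - r + (u - r) ^+ 2 / 4 <= u * ln (u / r).
Proof.
move=> /andP[r0 r1] /andP[u0 u1].
have [a a0 aE] : exists2 a, 0 <= a & u = a ^+ 2.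
  by exists (Num.sqrt u); rewrite ?sqrtr_ge0 ?sqr_sqrtr.
have [b b0 bE] : exists2 b, 0 < b & r = b ^+ 2.
  by exists (Num.sqrt r); rewrite ?sqrtr_gt0 ?sqr_sqrtr // ltW.
have a1 : a <= 1 by rewrite -(ler_pXn2r (ltn0Sn 1)) ?nnegrE // -aE expr1n.
have b1 : b <= 1 by rewrite -(ler_pXn2r (ltn0Sn 1)) ?nnegrE ?(ltW b0) // -bE expr1n.
have key : u - r + (a - b) ^+ 2 <= u * ln (u / r).
  move: a0; rewrite le_eqVlt => /predU1P[a0|a0].
    by rewrite aE bE -a0 expr0n /= !mul0r; nra.
  have ba : 0 < b / a by rewrite divr_gt0.
  have -> : ln (u / r) = - (ln (b / a) *+ 2).
    rewrite -lnXn // expr_div_n -aE -bE -lnV ?posrE ?divr_gt0 ?invf_div //.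
    by rewrite aE exprn_gt0.
  have := ln_le_sub1 ba; move: (ln _) => l hl.
  have : a * a * l <= a * a * (b / a - 1) by rewrite ler_wpM2l // mulr_ge0 // ltW.
  have -> : a * a * (b / a - 1) = a * b - a * a by field; rewrite gt_eqF.
  rewrite aE bE mulr2n mulrN mulrDr expr2 => hl'.
  by move: (a * a * l) hl' => x hl'; nra.
apply: le_trans key; rewrite lerD2l aE bE.
rewrite (_ : (a ^+ 2 - b ^+ 2) ^+ 2 = (a - b) ^+ 2 * (a + b) ^+ 2); last by ring.
rewrite -mulrA ler_piMr ?sqr_ge0 //.
have : (a + b) ^+ 2 <= 4 by nra.
by lra.
Qed.

(** A weak form of Pinsker's inequality. *)
Lemma entropy_ge r u : 0 < r < 1 -> 0 <= u <= 1 -> (u - r) ^+ 2 / 2 <= entropy r u.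
Proof.
move=> /andP[r0 r1] /andP[u0 u1]; rewrite /entropy.
have h1 : u - r + (u - r) ^+ 2 / 4 <= u * ln (u / r).
  by apply: mul_ln_ge; rewrite ?r0 ?u0 ?u1 ?(ltW r1).
have h2 : (1 - u) - (1 - r) + ((1 - u) - (1 - r)) ^+ 2 / 4 <= (1 - u) * ln ((1 - u) / (1 - r)).
  by apply: mul_ln_ge; apply/andP; split; lra.
move: h1 h2; move: (u * _) ((1 - u) * _) => A B h1 h2; nra.
Qed.

Lemma entropy_ge0 r u : 0 < r < 1 -> 0 <= u <= 1 -> 0 <= entropy r u.
Proof. by move=> r01 u01; apply: le_trans (entropy_ge r01 u01); rewrite divr_ge0 ?sqr_ge0. Qed.

Lemma entropy_le p u : 0 < p < 1 -> 0 <= u <= 1 ->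
  entropy p u <= (u - p) ^+ 2 * (p^-1 + (1 - p)^-1).
Proof.
move=> /andP[p0 p1] /andP[u0 u1].
have le (q w : R) : 0 < q -> 0 <= w -> w * ln (w / q) <= w * ((w - q) / q).
  move=> q0; rewrite le_eqVlt => /predU1P[<-|w0]; first by rewrite !mul0r.
  apply: ler_wpM2l; first exact: ltW.
  by rewrite mulrBl divff ?gt_eqF // ln_le_sub1 // divr_gt0.
have q0 : 0 < 1 - p by rewrite subr_gt0.
have h1 := le p u p0 u0; have h2 := le (1 - p) (1 - u) q0.
rewrite subr_ge0 in h2; have {}h2 := h2 u1.
apply: le_trans (lerD h1 h2) _; rewrite le_eqVlt; apply/orP; left; apply/eqP.
by field; rewrite !gt_eqF.
Qed.

Lemma pow_taylor d u r : 0 <= u <= 1 -> 0 <= r <= 1 ->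
  `|u ^+ d - r ^+ d - d%:R * r ^+ d.-1 * (u - r)| <= d%:R ^+ 2 * (u - r) ^+ 2.
Proof.
move=> /andP[u0 u1] /andP[r0 r1]; elim: d => [|d IHd].
  by rewrite !expr0 subrr mul0r mul0r subrr normr0 mulr_ge0 ?sqr_ge0.
have -> : u ^+ d.+1 - r ^+ d.+1 - d.+1%:R * r ^+ d * (u - r) =
    u * (u ^+ d - r ^+ d - d%:R * r ^+ d.-1 * (u - r)) +
    d%:R * r ^+ d.-1 * (u - r) ^+ 2.
  case: d {IHd} => [|d]; first by rewrite /= !expr0 !expr1; ring.
  by rewrite /= !exprS -natr1; ring.
apply: le_trans (ler_normD _ _) _.
have h1 : `|u * (u ^+ d - r ^+ d - d%:R * r ^+ d.-1 * (u - r))| <=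
    d%:R ^+ 2 * (u - r) ^+ 2.
  by rewrite normrM ger0_norm // -[leRHS]mul1r ler_pM.
have h2 : `|d%:R * r ^+ d.-1 * (u - r) ^+ 2| <= d%:R * (u - r) ^+ 2.
  rewrite ger0_norm; last by rewrite mulr_ge0 ?sqr_ge0 ?mulr_ge0 ?exprn_ge0.
  by rewrite ler_wpM2r ?sqr_ge0 // ler_piMr ?ler0n ?exprn_ile1.
apply: le_trans (lerD h1 h2) _.
rewrite -mulrDl ler_wpM2r ?sqr_ge0 // -natr1.
have : 0 <= d%:R :> R by rewrite ler0n.
by move: (d%:R) => D; nra.
Qed.

Lemma pow_lipschitz d u r : 0 <= u <= 1 -> 0 <= r <= 1 ->
  `|u ^+ d - r ^+ d| <= d%:R * `|u - r|.
Proof.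
move=> /andP[u0 u1] /andP[r0 r1]; rewrite subrXX normrM mulrC ler_wpM2r //.
apply: le_trans (ler_norm_sum _ _ _) _.
rewrite -[in leRHS](card_ord d) -sumr_const; apply: ler_sum => i _.
by rewrite normrM !ger0_norm ?exprn_ge0 // mulr_ile1 ?exprn_ge0 ?exprn_ile1.
Qed.

Lemma pow_expand d u r : (0 < d)%N -> 0 <= u -> 0 <= r ->
  r ^+ d.-1 * `|u - r| <= `|u ^+ d - r ^+ d|.
Proof.
move=> d0 u0 r0; rewrite subrXX normrM mulrC ler_wpM2l //.
case: d d0 => [//|d] _; rewrite big_ord_recr /= subnn expr0 mul1r.
have S0 : 0 <= \sum_(i < d) u ^+ (d.+1.-1 - i) * r ^+ i.
  by apply: sumr_ge0 => i _; rewrite mulr_ge0 ?exprn_ge0.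
by rewrite ger0_norm ?addr_ge0 ?exprn_ge0 // lerDr.
Qed.

Lemma entropy_slope_le p r : 0 < p < 1 -> p / 2 <= r -> (1 - p) / 2 <= 1 - r ->
  `|entropy_slope p r| <= (2 / p + 2 / (1 - p)) * `|r - p|.
Proof.
move=> /andP[p0 p1] rp rp'.
have le (q w : R) : 0 < q -> q / 2 <= w -> `|ln (w / q)| <= 2 / q * `|w - q|.
  move=> q0 qw; have w0 : 0 < w by apply: lt_le_trans qw; rewrite divr_gt0.
  have iw : w^-1 <= 2 / q.
    by rewrite -[2 / q]invrK lef_pV2 ?posrE ?invr_gt0 ?divr_gt0 // invf_div.
  have iq : q^-1 <= 2 / q by rewrite ler_peMl ?invr_ge0 ?ltW // ltr1n.
  rewrite ler_norml; apply/andP; split.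
    rewrite lerNl -lnV ?posrE ?divr_gt0 // invf_div.
    apply: le_trans (ln_le_sub1 _) _; first by rewrite divr_gt0.
    rewrite -[X in _ - X](divff (lt0r_neq0 w0)) -mulrBl mulrC.
    apply: le_trans (ler_norm _) _; rewrite normrM distrC ger0_norm ?invr_ge0 ?(ltW w0) //.
    exact: ler_wpM2r.
  apply: le_trans (ln_le_sub1 _) _; first by rewrite divr_gt0.
  rewrite -[X in _ - X](divff (lt0r_neq0 q0)) -mulrBl mulrC.
  apply: le_trans (ler_norm _) _; rewrite normrM ger0_norm ?invr_ge0 ?(ltW q0) //.
  exact: ler_wpM2r.
have q0 : 0 < 1 - p by rewrite subr_gt0.
rewrite mulrDl; apply: le_trans (ler_normB _ _) _; apply: lerD; first exact: le.
apply: le_trans (le _ _ q0 rp') _.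
by rewrite (_ : 1 - r - (1 - p) = p - r) ?[`|p - r|]distrC //; ring.
Qed.

(** Near its minimum at [p], the entropy as a function of [u ^+ d] lies above
    its tangents: strong convexity in [u] dominates the curvature of [u ^+ d]
    because the slope is small there. *)
Lemma entropy_support p d : 0 < p < 1 -> (0 < d)%N ->
  exists2 rho, 0 < rho & forall r, `|r - p| <= rho -> 0 < r < 1 /\
    exists s, forall u, 0 <= u <= 1 ->
      entropy p r + s * (u ^+ d - r ^+ d) + (u - r) ^+ 2 / 4 <= entropy p u.
Proof.
move=> p01 d0; have /andP[p0 p1] := p01.
have q0 : 0 < 1 - p by rewrite subr_gt0.
pose C := 2 / p + 2 / (1 - p).
have C0 : 0 < C by rewrite addr_gt0 // divr_gt0.
have dR : 0 < d%:R :> R by rewrite ltr0n.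
pose w := (p / 2) ^+ d.-1 / (d%:R * 4).
have w0 : 0 < w by rewrite divr_gt0 ?exprn_gt0 ?divr_gt0 // mulr_gt0.
exists (Num.min (Num.min (p / 2) ((1 - p) / 2)) (w / C)).
  by rewrite !lt_min (divr_gt0 p0) // (divr_gt0 q0) // (divr_gt0 w0).
move=> r; rewrite !le_min -andbA ler_norml => /and3P[/andP[h1 h2] h3 h4].
move: h3; rewrite ler_norml => /andP[h3 h3'].
have rp : p / 2 <= r by lra.
have rp' : (1 - p) / 2 <= 1 - r by lra.
have r0 : 0 < r by apply: lt_le_trans rp; rewrite divr_gt0.
have r1 : r < 1 by rewrite -subr_gt0; apply: lt_le_trans rp'; rewrite divr_gt0.
have r01 : 0 < r < 1 by rewrite r0.
split => //; pose D := d%:R * r ^+ d.-1; have D0 : 0 < D by rewrite mulr_gt0 ?exprn_gt0.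
exists (entropy_slope p r / D) => u u01.
rewrite (entropy_bregman p01 r01 u01).
have tay : `|u ^+ d - r ^+ d - D * (u - r)| <= d%:R ^+ 2 * (u - r) ^+ 2.
  by apply: pow_taylor => //; rewrite (ltW r0) (ltW r1).
have slope : `|entropy_slope p r / D| * d%:R ^+ 2 <= 4^-1.
  rewrite normrM [`|D^-1|]ger0_norm ?invr_ge0 ?(ltW D0) // mulrAC ler_pdivrMr //.
  apply: (@le_trans _ _ (w * d%:R ^+ 2)).
    rewrite ler_wpM2r ?sqr_ge0 //; apply: le_trans (entropy_slope_le p01 rp rp') _.
    by rewrite -/C mulrC -ler_pdivlMr.
  rewrite (_ : w * d%:R ^+ 2 = 4^-1 * (d%:R * (p / 2) ^+ d.-1)).
    rewrite ler_wpM2l ?invr_ge0 // /D ler_wpM2l ?(ltW dR) //.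
    by rewrite lerXn2r ?nnegrE ?divr_ge0 ?(ltW p0) ?(ltW r0).
  by rewrite /w; field; rewrite gt_eqF.
have bre := entropy_ge r01 u01.
have slopeE : entropy_slope p r = entropy_slope p r / D * D by rewrite divfK ?gt_eqF.
rewrite {2}slopeE; move: slope tay bre.
move: (entropy_slope p r / D) (entropy p r) (entropy r u) => s e1 e2 slope tay bre.
have : s * (u ^+ d - r ^+ d - D * (u - r)) <= (u - r) ^+ 2 / 4.
  apply: le_trans (ler_norm _) _; rewrite normrM.
  apply: le_trans (ler_wpM2l (normr_ge0 _) tay) _.
  by rewrite mulrA [leRHS]mulrC ler_wpM2r ?sqr_ge0.
move: (u ^+ d) (r ^+ d) => ud rd {tay slope}; nra.
Qed.

Lemma rel_entropyE p u : 0 < p < 1 -> rel_entropy p u = (entropy p u)%:E.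
Proof. by move=> p01; rewrite /rel_entropy p01. Qed.

Lemma rel_entropy_ge0 p u : 0 <= u <= 1 -> (0 <= rel_entropy p u)%E.
Proof.
move=> u01; rewrite /rel_entropy; case: ifPn => [p01|_].
  by rewrite lee_fin; exact: entropy_ge0.
by case: ifP => _; rewrite ?leey.
Qed.

End Entropy.

(** * The rate functional *)

Section Rate.
Context {R : realType}.
Variables (m : nat) (gam : 'I_m -> rat).
Hypothesis gamP : rat_simplex gam.

Local Notation len := (@block_len R m gam).
Local Notation ind := (@block_ind R m gam).
Local Notation mu := (@lebesgue_measure R).
Local Notation mu2 := (mu \x mu)%E.

Definition rect_ind (i j : 'I_m) (z : R * R) : R := ind i z.1 * ind j z.2.

Lemma bmeas_rect_ind i j : bmeas (rect_ind i j).
Proof. by apply: bmeasM; [apply: bmeas_fst|apply: bmeas_snd]; exact: bmeas_block_ind. Qed.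
Local Hint Resolve bmeas_rect_ind : core.

Lemma rect_ind01 i j z : 0 <= rect_ind i j z <= 1.
Proof.
have /andP[h1 h2] := block_ind01 (R := R) gam i z.1.
have /andP[h3 h4] := block_ind01 (R := R) gam j z.2.
by rewrite mulr_ge0 ?mulr_ile1.
Qed.

Lemma rect_ind_in i j a b x y : block gam a x -> block gam b y ->
  rect_ind i j (x, y) = ((i == a) && (j == b))%:R.
Proof.
move=> ba bb; rewrite /rect_ind /= (block_ind_in gamP _ ba) (block_ind_in gamP _ bb).
by case: (i == a); case: (j == b); rewrite ?mulr0 ?mulr1 ?mul0r.
Qed.

Lemma step_kernel_rect (c : 'I_m -> 'I_m -> R) z :
  step_kernel gam c z = \sum_i \sum_j c i j * rect_ind i j z.
Proof.
apply: eq_bigr => i _; rewrite big_distrr; apply: eq_bigr => j _ /=.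
by rewrite /rect_ind mulrA mulrC.
Qed.

Lemma Ex2_step_mul (c : 'I_m -> 'I_m -> R) (F : R * R -> R) : bmeas F ->
  Ex2 (fun z => step_kernel gam c z * F z) =
  \sum_i \sum_j c i j * Ex2 (fun z => rect_ind i j z * F z).
Proof.
move=> bF.
have bc i j : bmeas (fun z => c i j * (rect_ind i j z * F z)).
  by apply: bmeasM; [exact: bmeas_cst|exact: bmeasM].
transitivity (Ex2 (fun z => \sum_i \sum_j c i j * (rect_ind i j z * F z))).
  congr Ex2; apply/funext => z; rewrite step_kernel_rect big_distrl.
  apply: eq_bigr => i _ /=; rewrite big_distrl; apply: eq_bigr => j _ /=.
  by rewrite mulrA.
rewrite Ex2_sum => [|i]; last by apply: bmeas_sum.
apply: eq_bigr => i _; rewrite Ex2_sum //; apply: eq_bigr => j _.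
by rewrite Ex2Z //; exact: bmeasM.
Qed.

Lemma Ex2_rect i j : Ex2 (rect_ind i j) = len i * len j.
Proof.
rewrite /Ex2 /rect_ind /=.
have bi k := bmeas_block_ind (R := R) gam k.
transitivity (Ex (fun x => len j * ind i x)).
  apply: (congr1 Ex); apply/funext => x; rewrite ExZ; last exact: bi.
  by rewrite (Ex_block_ind gamP); exact: mulrC.
by rewrite ExZ; [rewrite (Ex_block_ind gamP); exact: mulrC|exact: bi].
Qed.

Lemma Ex2_step (c : 'I_m -> 'I_m -> R) :
  Ex2 (step_kernel gam c) = \sum_i \sum_j c i j * (len i * len j).
Proof.
have := Ex2_step_mul c (bmeas_cst 1).
rewrite (_ : (fun z => step_kernel gam c z * 1) = step_kernel gam c); last first.
  by apply/funext => z; rewrite mulr1.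
move=> ->; apply: eq_bigr => i _; apply: eq_bigr => j _; rewrite -Ex2_rect.
by congr (_ * Ex2 _); apply/funext => z; rewrite mulr1.
Qed.

Section norms.
Variable d : nat.
Hypothesis d0 : (0 < d)%N.
Variable F : R * R -> R.
Hypothesis bF : bmeas F.
Hypothesis F01 : forall z, 0 <= F z <= 1.
Hypothesis FC : forall x y, F (x, y) = F (y, x).
Local Notation q := (block_norm gam d F).

Lemma Ex2_rect_pow i j :
  Ex2 (fun z => rect_ind i j z * F z ^+ d) = len i * len j * q i j ^+ d.
Proof.
have nrm := label_kernel_norm gamP d0 bF F01 FC.
have bFd : bmeas (fun z => F z ^+ d) by exact: bmeasX.
have inner x : Ex (fun y => ind j y * F (x, y) ^+ d) =
    len j * half_norm gam d F j x ^+ d.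
  rewrite -(nrm j (inl x)) /=; congr Ex; apply/funext => y.
  by rewrite FC.
rewrite -mulrA mulrCA -(nrm i (inr j)) /= -ExZ; last first.
  apply: bmeasM; first exact: bmeas_block_ind.
  by apply: bmeasX; exact: bmeas_half_norm.
congr Ex; apply/funext => x; rewrite mulrCA -inner -ExZ.
  by congr Ex; apply/funext => y; rewrite mulrA.
by apply: bmeasM; [exact: bmeas_block_ind|exact: (Ex_bmeas1 x bFd)].
Qed.

Lemma block_norm01 i j : 0 <= q i j <= 1.
Proof. by rewrite root_d_ge0 block_norm_le1. Qed.

Lemma block_norm_close i j p : 0 <= p <= 1 ->
  len i * len j * `|q i j ^+ d - p ^+ d| <=
  d%:R * Ex2 (fun z => rect_ind i j z * `|F z - p|).
Proof.
move=> p01; have ll0 : 0 <= len i * len j by rewrite mulr_ge0 ?block_len_ge0.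
have bFd : bmeas (fun z => F z ^+ d) by exact: bmeasX.
have bdiff : bmeas (fun z => rect_ind i j z * (F z ^+ d - p ^+ d)).
  by apply: bmeasM => //; apply: bmeasB => //; exact: bmeas_cst.
have bP : bmeas (fun z => rect_ind i j z * `|F z - p|).
  by apply: bmeasM => //; apply: bmeas_norm; apply: bmeasB => //; exact: bmeas_cst.
rewrite -{1}(ger0_norm ll0) -normrM.
rewrite (_ : _ * (_ - _) = Ex2 (fun z => rect_ind i j z * (F z ^+ d - p ^+ d))).
  apply: le_trans (ler_norm_Ex2 bdiff) _; rewrite -Ex2Z //; apply: le_Ex2.
  - exact: bmeas_norm.
  - by apply: bmeasM => //; exact: bmeas_cst.
  move=> z _; have /andP[r0 _] := rect_ind01 i j z.
  rewrite normrM ger0_norm // mulrCA; apply: ler_wpM2l => //.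
  exact: pow_lipschitz.
rewrite mulrBr -Ex2_rect_pow mulrC -Ex2_rect -[- _]mulN1r mulrA mulN1r -Ex2Z // -Ex2D.
- by congr Ex2; apply/funext => z; rewrite mulrBr mulNr [p ^+ d * _]mulrC.
- exact: bmeasM.
- by apply: bmeasM => //; exact: bmeas_cst.
Qed.

End norms.

Variable p : 'I_m -> 'I_m -> R.
Variable W0 : R * R -> R.
Hypothesis p01 : forall i j, 0 <= p i j <= 1.
Hypothesis W0p : forall i j x y, block gam i x -> block gam j y -> W0 (x, y) = p i j.

Lemma measurable_rel_entropy (q : R) (F : R * R -> R) : measurable_fun setT F ->
  measurable_fun setT (fun z => rel_entropy q (F z)).
Proof.
move=> mF; rewrite /rel_entropy; case: (0 < q < 1).
  apply/measurable_EFinP; apply: measurable_funD; apply: measurable_funM => //.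
  - by apply: measurableT_comp => //; exact: measurable_funM.
  - exact: measurable_funB.
  - apply: measurableT_comp => //; apply: measurable_funM => //.
    exact: measurable_funB.
apply: measurable_fun_ifT => //.
exact: (@measurable_fun_eqr _ _ _ setT F (cst q) mF).
Qed.

Lemma measurable_integrand h : graphon h ->
  measurable_fun unitI2 (fun z => rel_entropy (W0 z) (h z)).
Proof.
move=> gh; have [mF _] := bmeas_kernel_ext gh.
pose E z := (\sum_i \sum_j (rect_ind i j z)%:E * rel_entropy (p i j) (kernel_ext h z))%E.
have mE : measurable_fun setT E.
  apply: emeasurable_sum => i; apply: emeasurable_sum => j.
  apply: emeasurable_funM; last exact: measurable_rel_entropy.
  by apply/measurable_EFinP; have [] := bmeas_rect_ind i j.
apply: eq_measurable_fun (measurable_funTS mE) => -[x y] /set_mem[/= Ux Uy].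
have [a ba] := ex_block gamP Ux; have [b bb] := ex_block gamP Uy.
rewrite /E (bigD1 a) //= [X in (_ + X)%E]big1 => [|i ia]; last first.
  rewrite big1 // => j _.
  by rewrite (rect_ind_in _ _ ba bb) (negbTE ia) mul0e.
rewrite adde0 (bigD1 b) //= big1 => [|j jb]; last first.
  by rewrite (rect_ind_in _ _ ba bb) (negbTE jb) andbF mul0e.
rewrite (rect_ind_in _ _ ba bb) !eqxx mul1e adde0.
by rewrite (W0p ba bb) kernel_extE.
Qed.

Lemma integrable_unitI2 (L : R * R -> R) : bmeas L ->
  mu2.-integrable unitI2 (EFin \o L).
Proof.
move=> bL; apply: integrable_bmeas => //; first exact: measurable_unitI2.
by rewrite [X in (X < _)%E]mu2_unitI2 ltry.
Qed.

Lemma integral_EFin_Ex2 (L : R * R -> R) : bmeas L ->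
  (\int[mu2]_(z in unitI2) (L z)%:E)%E = (Ex2 L)%:E.
Proof.
move=> bL; rewrite /Ex2 -integral_unitI2E // /Rintegral fineK //.
apply: (integrable_fin_num _ (integrable_unitI2 bL)).
exact: measurable_unitI2.
Qed.

(** Every bounded function below the entropy integrand bounds the rate. As
    the integrand is [+oo] where [h] differs from a value 0 or 1 of [W0], such
    a function is free to take any value there. *)
Lemma rate_ge h (L : R * R -> R) : graphon h -> bmeas L ->
  (forall i j x y, block gam i x -> block gam j y ->
     ((L (x, y))%:E <= rel_entropy (p i j) (kernel_ext h (x, y)))%E) ->
  ((Ex2 L / 2)%:E <= rate W0 h)%E.
Proof.
move=> gh bL Lle; have mE := measurable_integrand gh; have [_ _ h01] := gh.
rewrite mulrC EFinM /rate; apply: lee_wpmul2l; first by rewrite lee_fin invr_ge0.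
rewrite -integral_EFin_Ex2 //.
have E0 z : unitI2 z -> (0 <= rel_entropy (W0 z) (h z))%E.
  by move=> Uz; apply: rel_entropy_ge0; exact: h01.
have := leey (\int[mu2]_(z in unitI2) rel_entropy (W0 z) (h z))%E.
rewrite le_eqVlt => /predU1P[->|Eoo]; first exact: leey.
apply: le_integral.
- exact: measurable_unitI2.
- exact: (integrable_unitI2 bL).
- apply/integrableP; split => //.
  rewrite (_ : integral _ _ _ =
    (\int[mu2]_(z in unitI2) rel_entropy (W0 z) (h z))%E) //.
  by apply: eq_integral => z /set_mem Uz; rewrite gee0_abs // E0.
- move=> [x y] /set_mem[/= Ux Uy].
  have [a ba] := ex_block gamP Ux; have [b bb] := ex_block gamP Uy.
  by rewrite (W0p ba bb) -(kernel_extE h Ux Uy); exact: Lle.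
Qed.

(** Agrees with [rel_entropy] wherever the latter is finite. *)
Definition cost (q u : R) : R := if 0 < q < 1 then entropy q u else 0.

Lemma cost_rel_entropy q u : 0 < q < 1 \/ u = q -> rel_entropy q u = (cost q u)%:E.
Proof.
rewrite /rel_entropy /cost; case: ifPn => // _ [//|->].
by rewrite eqxx.
Qed.

Lemma rate_step (h : R * R -> R) (r : 'I_m -> 'I_m -> R) :
  (forall i j x y, block gam i x -> block gam j y -> h (x, y) = r i j) ->
  (forall i j, 0 < p i j < 1 \/ r i j = p i j) ->
  rate W0 h = (Ex2 (step_kernel gam (fun i j => cost (p i j) (r i j))) / 2)%:E.
Proof.
move=> hr rp; rewrite /rate mulrC EFinM; congr (_ * _)%E.
rewrite -integral_EFin_Ex2; last exact: bmeas_step_kernel.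
apply: eq_integral => -[x y] /set_mem[/= Ux Uy].
have [a ba] := ex_block gamP Ux; have [b bb] := ex_block gamP Uy.
by rewrite (hr _ _ _ _ ba bb) (W0p ba bb) (step_kernelE _ _ ba bb) // cost_rel_entropy.
Qed.

(** On a block where [W0] is 0 or 1, any constant times the distance to [W0] is
    below the entropy, so the rate would exceed every bound. *)
Lemma rect_dist_null h i j : graphon h -> (rate W0 h < +oo)%E -> ~ (0 < p i j < 1) ->
  Ex2 (fun z => rect_ind i j z * `|kernel_ext h z - p i j|) = 0.
Proof.
move=> gh hoo pij.
have bP : bmeas (fun z => rect_ind i j z * `|kernel_ext h z - p i j|).
  apply: bmeasM => //; apply: bmeas_norm; apply: bmeasB; last exact: bmeas_cst.
  exact: bmeas_kernel_ext.
apply/eqP; rewrite eq_le; apply/andP; split; last first.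
  by apply: Ex2_ge0 => z _; rewrite mulr_ge0 //; case/andP: (rect_ind01 i j z).
rewrite leNgt; apply/negP => E0.
have key K : 0 <= K -> ((K * Ex2 (fun z => rect_ind i j z * `|kernel_ext h z - p i j|) / 2)%:E <=
    rate W0 h)%E.
  move=> K0; rewrite -Ex2Z //; apply: rate_ge => //.
    by apply: bmeasM => //; exact: bmeas_cst.
  move=> a b x y ba bb.
  have ge0 : (0 <= rel_entropy (p a b) (kernel_ext h (x, y)))%E.
    by apply: rel_entropy_ge0; rewrite kernel_ext_ge0 ?kernel_ext_le1.
  rewrite (rect_ind_in _ _ ba bb); case: andP => [[/eqP <- /eqP <-]|_]; last first.
    by rewrite mul0r mulr0.
  rewrite mul1r /rel_entropy ifN; last exact/negP.
  by case: eqP => [->|_]; [rewrite subrr normr0 mulr0|exact: leey].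
have fin : rate W0 h \is a fin_num.
  rewrite ge0_fin_numE //; apply: le_trans (key 0 (lexx _)).
  by rewrite mul0r mul0r.
move: key E0; rewrite -(fineK fin); move: (fine _) (Ex2 _) => r e key e0.
have e2 : 0 < e / 2 by rewrite divr_gt0.
have := key ((`|r| + 1) / (e / 2)) (divr_ge0 (addr_ge0 (normr_ge0 _) ler01) (ltW e2)).
rewrite lee_fin -mulrA divfK ?gt_eqF //; apply/negP; rewrite -ltNge.
by apply: le_lt_trans (ler_norm r) _; rewrite ltrDl.
Qed.

Lemma block_norm_pinned d h i j : (0 < d)%N -> graphon h -> 0 < len i * len j ->
  Ex2 (fun z => rect_ind i j z * `|kernel_ext h z - p i j|) = 0 ->
  block_norm gam d (kernel_ext h) i j = p i j.
Proof.
move=> d0 gh ll0 E0; have bF := bmeas_kernel_ext gh.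
have F01 z : 0 <= kernel_ext h z <= 1 by rewrite kernel_ext_ge0 ?kernel_ext_le1.
have FC x y : kernel_ext h (x, y) = kernel_ext h (y, x) by exact: kernel_ext_sym.
have := block_norm_close d0 bF F01 FC i j (p01 i j).
rewrite E0 mulr0 pmulr_rle0 // normr_le0 subr_eq0 => /eqP.
by apply: pexpIrn; rewrite ?nnegrE ?root_d_ge0 //; case/andP: (p01 i j).
Qed.

(** The convexity estimate behind the theorem: the tangents of the entropy at
    [r], as functions of [u ^+ d], integrate to block [d]-norms. *)
Lemma rate_tangent d (r s : 'I_m -> 'I_m -> R) h : (0 < d)%N -> graphon h ->
  (forall i j, 0 < p i j < 1 -> forall u, 0 <= u <= 1 ->
     entropy (p i j) (r i j) + s i j * (u ^+ d - r i j ^+ d) + (u - r i j) ^+ 2 / 4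
     <= entropy (p i j) u) ->
  (forall i j, ~ (0 < p i j < 1) -> r i j = p i j /\ s i j = 0) ->
  ((Ex2 (step_kernel gam (fun i j => cost (p i j) (r i j))) / 2 +
    (\sum_i \sum_j s i j * (len i * len j *
       (block_norm gam d (kernel_ext h) i j ^+ d - r i j ^+ d))) / 2 +
    Ex2 (fun z => (kernel_ext h z - step_kernel gam r z) ^+ 2) / 8)%:E <= rate W0 h)%E.
Proof.
move=> d0 gh tang pin; have bF := bmeas_kernel_ext gh.
have F01 z : 0 <= kernel_ext h z <= 1 by rewrite kernel_ext_ge0 ?kernel_ext_le1.
have FC x y : kernel_ext h (x, y) = kernel_ext h (y, x) by exact: kernel_ext_sym.
set F := kernel_ext h in bF F01 FC *.
pose A := step_kernel gam (fun i j => cost (p i j) (r i j)).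
pose B := step_kernel gam (fun i j => s i j * r i j ^+ d).
have bA : bmeas A by exact: bmeas_step_kernel.
have bB : bmeas B by exact: bmeas_step_kernel.
have bS : bmeas (step_kernel gam s) by exact: bmeas_step_kernel.
have bSF : bmeas (fun z => step_kernel gam s z * F z ^+ d).
  by apply: bmeasM => //; exact: bmeasX.
have bQ : bmeas (fun z => (F z - step_kernel gam r z) ^+ 2).
  by apply: bmeasX; apply: bmeasB => //; exact: bmeas_step_kernel.
pose L z := A z + step_kernel gam s z * F z ^+ d + (-1) * B z +
  4^-1 * (F z - step_kernel gam r z) ^+ 2.
have bB' : bmeas (fun z => (-1) * B z) by apply: bmeasM => //; exact: bmeas_cst.
have bQ' : bmeas (fun z => 4^-1 * (F z - step_kernel gam r z) ^+ 2).
  by apply: bmeasM => //; exact: bmeas_cst.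
have bL : bmeas L by apply: bmeasD => //; apply: bmeasD => //; exact: bmeasD.
have EL : Ex2 L = Ex2 A + (\sum_i \sum_j s i j * (len i * len j *
    (block_norm gam d F i j ^+ d - r i j ^+ d))) +
    4^-1 * Ex2 (fun z => (F z - step_kernel gam r z) ^+ 2).
  rewrite /L Ex2D ?Ex2D ?Ex2Z //; [|by apply: bmeasD|by apply: bmeasD => //; exact: bmeasD].
  congr (_ + _); rewrite -addrA; congr (_ + _).
  rewrite Ex2_step_mul ?Ex2_step; last exact: bmeasX.
  rewrite mulN1r -sumrB; apply: eq_bigr => i _; rewrite -sumrB; apply: eq_bigr => j _.
  by rewrite Ex2_rect_pow //; ring.
rewrite (_ : _ + _ + _ = Ex2 L / 2); last by rewrite EL; field.
apply: rate_ge => // i j x y bi bj.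
rewrite /L /A /B !(step_kernelE gamP _ bi bj).
have u01 := F01 (x, y); rewrite -/F; move: (F (x, y)) u01 => u u01.
have [pij|pij] := boolP (0 < p i j < 1).
  rewrite /rel_entropy /cost pij lee_fin; apply: le_trans (tang i j pij u u01).
  by rewrite le_eqVlt; apply/orP; left; apply/eqP; field.
have [-> ->] := pin i j (negP pij).
rewrite /rel_entropy /cost (negbTE pij); case: eqP => [->|_]; last exact: leey.
by rewrite lee_fin subrr expr0n /= !mul0r !mulr0 !addr0.
Qed.

(** By [entropy_ge] a small rate bounds the L2 distance to [W0] on every block,
    and this controls the block norms. *)
Lemma rate_small_near d (rho : 'I_m -> 'I_m -> R) : (0 < d)%N ->
  (forall i j, 0 < rho i j) ->
  exists2 kappa, 0 < kappa & forall h, graphon h -> (rate W0 h <= kappa%:E)%E ->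
    forall i j, 0 < p i j < 1 -> 0 < len i * len j ->
      `|block_norm gam d (kernel_ext h) i j - p i j| <= rho i j.
Proof.
move=> d0 rho0.
have dR : 0 < d%:R :> R by rewrite ltr0n.
pose a i j := if 0 < p i j < 1 then p i j ^+ d.-1 * rho i j / d%:R / 2 else 1.
have a0 i j : 0 < a i j.
  rewrite /a; case: ifP => // /andP[pij _].
  by rewrite !divr_gt0 // mulr_gt0 ?exprn_gt0.
pose k i j := if 0 < len i * len j then a i j ^+ 2 * (len i * len j) / 4 else 1.
have k0 i j : 0 < k i j.
  by rewrite /k; case: ifP => // ll0; rewrite divr_gt0 // mulr_gt0 ?exprn_gt0.
pose S := 1 + \sum_i \sum_j (k i j)^-1.
have S0 : 0 < S.
  by rewrite ltr_wpDr // sumr_ge0 // => i _; rewrite sumr_ge0 // => j _; rewrite invr_ge0 ltW.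
have Sk i j : S^-1 <= k i j.
  rewrite -[leRHS]invrK lef_pV2 ?posrE ?invr_gt0 // /S.
  rewrite (bigD1 i) //= (bigD1 j) //= addrCA -!addrA lerDl !addrA addr_ge0 //.
    rewrite addr_ge0 // sumr_ge0 // => l _; rewrite invr_ge0 ltW //.
  by rewrite sumr_ge0 // => l _; rewrite sumr_ge0 // => n _; rewrite invr_ge0 ltW.
exists S^-1; first by rewrite invr_gt0.
move=> h gh hS i j pij ll0; have bF := bmeas_kernel_ext gh.
have F01 z : 0 <= kernel_ext h z <= 1 by rewrite kernel_ext_ge0 ?kernel_ext_le1.
have FC x y : kernel_ext h (x, y) = kernel_ext h (y, x) by exact: kernel_ext_sym.
set F := kernel_ext h in bF F01 FC *.
have bc c : bmeas (fun _ : R * R => c : R) by exact: bmeas_cst.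
have bD : bmeas (fun z => F z - p i j) by exact: bmeasB.
have bQ : bmeas (fun z => rect_ind i j z * (F z - p i j) ^+ 2).
  by apply: bmeasM => //; exact: bmeasX.
have E2 : Ex2 (fun z => rect_ind i j z * (F z - p i j) ^+ 2) <= 4 * k i j.
  have : ((Ex2 (fun z => 2^-1 * (rect_ind i j z * (F z - p i j) ^+ 2)) / 2)%:E <= rate W0 h)%E.
    apply: rate_ge => //; first exact: bmeasM.
    move=> b c x y bb bc'.
    have ge0 : (0 <= rel_entropy (p b c) (kernel_ext h (x, y)))%E.
      by apply: rel_entropy_ge0; exact: F01.
    rewrite (rect_ind_in _ _ bb bc'); case: andP => [[/eqP eb /eqP ec]|_]; last first.
      by rewrite mul0r mulr0.
    rewrite -eb -ec rel_entropyE // lee_fin mul1r mulrC.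
    by apply: entropy_ge => //; exact: F01.
  move=> /le_trans/(_ hS); rewrite lee_fin Ex2Z // => h'.
  have := Sk i j; move: h'; move: (Ex2 _) S^-1 (k i j) => x y z; lra.
have E1 : Ex2 (fun z => rect_ind i j z * `|F z - p i j|) <=
    a i j * (len i * len j) + (a i j)^-1 * (4 * k i j).
  apply: (@le_trans _ _ (Ex2 (fun z => a i j * rect_ind i j z +
      (a i j)^-1 * (rect_ind i j z * (F z - p i j) ^+ 2)))).
    apply: le_Ex2.
    - by apply: bmeasM => //; exact: bmeas_norm.
    - by apply: bmeasD; exact: bmeasM.
    move=> z _; have /andP[i0 _] := rect_ind01 i j z.
    rewrite (_ : a i j * _ + _ = rect_ind i j z *
      (a i j + (a i j)^-1 * (F z - p i j) ^+ 2)); last by ring.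
    apply: ler_wpM2l => //.
    rewrite -(real_normK (num_real (F z - p i j))).
    move: `|_| (normr_ge0 (F z - p i j)) => w w0; have ai := a0 i j.
    rewrite -(ler_pM2l ai) mulrDr mulVKf ?gt_eqF //.
    by move: (a i j) ai => e e0; nra.
  rewrite Ex2D ?Ex2Z ?Ex2_rect //; [|exact: bmeasM..].
  by rewrite lerD2l; apply: ler_wpM2l => //; rewrite invr_ge0 ltW.
have cl := block_norm_close d0 bF F01 FC i j (p01 i j).
have kE : 4 * k i j = a i j ^+ 2 * (len i * len j) by rewrite /k ll0; field.
have E1' : Ex2 (fun z => rect_ind i j z * `|F z - p i j|) <= 2 * a i j * (len i * len j).
  apply: le_trans E1 _; rewrite kE le_eqVlt; apply/orP; left; apply/eqP.
  by field; rewrite gt_eqF.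
have {cl} cl : `|block_norm gam d F i j ^+ d - p i j ^+ d| <= d%:R * (2 * a i j).
  rewrite -(ler_pM2l ll0); apply: le_trans cl _.
  apply: le_trans (ler_wpM2l (ltW dR) E1') _.
  by rewrite le_eqVlt; apply/orP; left; apply/eqP; ring.
have /andP[pp _] := pij.
have := pow_expand d0 (root_d_ge0 _ _ : 0 <= block_norm gam d F i j) (ltW pp).
move=> /le_trans/(_ cl); rewrite /a pij.
rewrite (_ : d%:R * _ = p i j ^+ d.-1 * rho i j); last by field; rewrite gt_eqF.
by rewrite ler_pM2l // exprn_gt0.
Qed.

End Rate.

(** * Classes of graphons *)

Section Classes.
Context {R : realType}.
Implicit Types (f g h : R * R -> R).

Definition rep (c : set (R * R -> R)) : R * R -> R := xget (fun=> 0) c.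

Lemma rep_class f : graphon f -> graphon (rep (class_of f)) /\ cut_dist f (rep (class_of f)) = 0.
Proof.
move=> gf; suff : class_of f (rep (class_of f)) by case.
have cf : class_of f f by split => //; exact: cut_dist_refl.
exact: xgetI cf.
Qed.

Lemma qcut_distE c g : qcut_dist c g = cut_dist (rep c) g.
Proof. by []. Qed.

Lemma liftE {T : Type} (F : (R * R -> R) -> T) c : Defs.lift F c = F (rep c).
Proof. by []. Qed.

Lemma hom_density_dist0 v (H : rel 'I_v) f g : graphon f -> graphon g ->
  cut_dist f g = 0 -> hom_density H f = hom_density H g.
Proof.
move=> gf gg fg; have := hom_density_cut_dist H gf gg.
by rewrite fg mulr0 normr_le0 subr_eq0 => /eqP.
Qed.

Lemma hom_density_ge0 v (H : rel 'I_v) f : graphon f -> 0 <= hom_density H f.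
Proof.
move=> gf; rewrite hom_densityE -[leLHS](cube_cst v 0); apply: le_cube.
- exact: bmeas_cst.
- by apply: bmeas_edge_prod => _; exact: bmeas_kernel_ext.
- by move=> s _; apply: prodr_ge0 => e _; exact: kernel_ext_ge0.
Qed.

Lemma cut_dist0_trans f g h : graphon f -> graphon g -> graphon h ->
  cut_dist f g = 0 -> cut_dist g h = 0 -> cut_dist f h = 0.
Proof.
move=> gf gg gh fg ghE; apply/eqP; rewrite eq_le cut_dist_ge0 // andbT.
by apply: le_trans (cut_dist_triangle gf gg gh) _; rewrite fg ghE addr0.
Qed.

(** Compactness of the cube, with the cluster point spelled out. *)
Lemma finite_cluster (I : finType) (u : nat -> I -> R) :
  (forall n i, 0 <= u n i <= 1) ->
  exists r : I -> R, forall (e : R) (N : nat), 0 < e ->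
    exists2 n, (N <= n)%N & forall i, `|u n i - r i| < e.
Proof.
move=> u01.
pose w n : 'rV[R]_(#|I|) := \row_j u n (enum_val j).
have cpt : compact [set x : 'rV[R]_(#|I|) | forall j, `[0, 1]%classic (x ord0 j)].
  exact: (rV_compact (fun=> @segment_compact R 0 1)).
have [a [_ cla]] : exists a, ([set x : 'rV[R]_(#|I|) | forall j, `[0, 1]%classic (x ord0 j)]
    `&` cluster (w @ \oo)) a.
  apply: cpt; exists 0%N => // n _ j /=.
  by rewrite mxE in_itv /=; exact: u01.
exists (fun i => a ord0 (enum_rank i)) => e N e0.
have [x [/= [n Nn <-] bx]] : [set w n | n in [set n | (N <= n)%N]] `&` ball a e !=set0.
  apply: cla; last exact: nbhsx_ballx.
  by exists N => // n Nn; exists n.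
exists n => // i; have [_ /(_ ord0 (enum_rank i))] := bx.
by rewrite mxE enum_rankK -ball_normE /= distrC.
Qed.

End Classes.

(** * Admissible classes and raised block graphons *)

Section BlockClasses.
Context {R : realType}.
Variables (m : nat) (gam : 'I_m -> rat).
Hypothesis gamP : rat_simplex gam.
Local Notation len := (@block_len R m gam).

Lemma kernel_ext_step (f : R * R -> R) (a : 'I_m -> 'I_m -> R) z : unitI2 z ->
  (forall i j x y, block gam i x -> block gam j y -> f (x, y) = a i j) ->
  kernel_ext f z = step_kernel gam a z.
Proof.
case: z => x y [/= Ux Uy] fa.
have [i bi] := ex_block gamP Ux; have [j bj] := ex_block gamP Uy.
by rewrite kernel_extE // (fa _ _ _ _ bi bj) (step_kernelE gamP _ bi bj).
Qed.

Lemma sum_len2 : \sum_i \sum_j len i * len j = 1.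
Proof.
rewrite -[RHS](sum_block_len gamP); apply: eq_bigr => i _.
by rewrite -big_distrr /= (sum_block_len gamP); exact: mulr1.
Qed.

Lemma len2_ge0 i j : 0 <= len i * len j.
Proof. by rewrite mulr_ge0 ?block_len_ge0. Qed.

Lemma step_dist (f g : R * R -> R) (a b : 'I_m -> 'I_m -> R) :
  (forall i j x y, block gam i x -> block gam j y -> f (x, y) = a i j) ->
  (forall i j x y, block gam i x -> block gam j y -> g (x, y) = b i j) ->
  Ex2 (fun z => `|kernel_diff f g z|) = \sum_i \sum_j `|a i j - b i j| * (len i * len j).
Proof.
move=> fa gb; rewrite -(Ex2_step gamP); apply: eq_Ex2 => -[x y] Uz.
rewrite /kernel_diff (kernel_ext_step Uz fa) (kernel_ext_step Uz gb).
case: Uz => /= Ux Uy.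
have [i bi] := ex_block gamP Ux; have [j bj] := ex_block gamP Uy.
by rewrite !(step_kernelE gamP _ bi bj).
Qed.

Variables (p : 'I_m -> 'I_m -> R) (W0 : R * R -> R).
Hypothesis p01 : forall i j, 0 <= p i j <= 1.
Hypothesis pC : forall i j, p i j = p j i.
Hypothesis W0p : forall i j x y, block gam i x -> block gam j y -> W0 (x, y) = p i j.

Lemma step_Omega (r : 'I_m -> 'I_m -> R) : (forall i j, 0 <= r i j <= 1) ->
  (forall i j, r i j = r j i) -> (forall i j, ~ (0 < p i j < 1) -> r i j = p i j) ->
  graphon_Omega W0 (step_kernel gam r).
Proof.
move=> r01 rC rp; have [gr _] := graphon_step_kernel gamP rC r01; split => //.
apply: aeW => -[x y] [[/= Ux Uy] nO].
have [i bi] := ex_block gamP Ux; have [j bj] := ex_block gamP Uy.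
rewrite (step_kernelE gamP _ bi bj) (W0p bi bj); apply: rp => pij.
by apply: nO; split => //; rewrite (W0p bi bj).
Qed.

(** A block graphon of finite rate agrees with [W0] off [Omega] up to a null
    set, so its class is admissible, and it competes for its own class. *)
Lemma qgraphon_Omega_class g : block_graphon gam g -> (rate W0 g < +oo)%E ->
  qgraphon_Omega W0 (class_of g).
Proof.
move=> [gg [a [aC a01 ga]]] goo; have [gR dR] := rep_class gg.
split; first by exists g.
pose r i j := if 0 < p i j < 1 then a i j else p i j.
have r01 i j : 0 <= r i j <= 1 by rewrite /r; case: ifP.
have rC i j : r i j = r j i by rewrite /r pC aC.
have rO := @step_Omega r r01 rC.
have [gr _] := graphon_step_kernel gamP rC r01.
exists (step_kernel gam r).
  by apply: rO => i j /negP/negbTE pij; rewrite /r pij.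
suff gr0 : cut_dist g (step_kernel gam r) = 0.
  exact: (cut_dist0_trans gR gg gr (etrans (cut_distC gR gg) dR) gr0).
apply/eqP; rewrite eq_le cut_dist_ge0 // andbT.
apply: le_trans (cut_dist_le_metric gg gr) _; apply: le_trans (cut_metric_L1 gg gr) _.
rewrite (step_dist (a := a) (b := r) ga (fun i j x y bi bj => step_kernelE gamP r bi bj)).
rewrite big1 // => i _; rewrite big1 // => j _; rewrite /r.
have [pij|/negP pij] := boolP (0 < p i j < 1); first by rewrite subrr normr0 mul0r.
have := rect_dist_null gamP W0p (i := i) (j := j) gg goo pij.
rewrite (_ : Ex2 _ = Ex2 (fun z => `|a i j - p i j| * rect_ind gam i j z)).
  by rewrite Ex2Z ?Ex2_rect //; exact: bmeas_rect_ind.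
apply: eq_Ex2 => -[x y] Uz; rewrite (kernel_ext_step Uz ga); case: Uz => /= Ux Uy.
have [k bk] := ex_block gamP Ux; have [l bl] := ex_block gamP Uy.
rewrite (step_kernelE gamP _ bk bl) (rect_ind_in gamP _ _ bk bl).
by case: andP => [[/eqP -> /eqP ->]|_]; rewrite ?mul1r ?mulr1 ?mul0r ?mulr0.
Qed.

(** Balls around a class are centered at its representative [rep], and the
    symmetry of [cut_dist] puts [g] into all of them. *)
Lemma qrate_class_le g : block_graphon gam g -> (qrate W0 (class_of g) <= rate W0 g)%E.
Proof.
move=> bg; have := leey (rate W0 g); rewrite le_eqVlt => /predU1P[->|goo].
  exact: leey.
have [gg _] := bg; have [gR dR] := rep_class gg.
rewrite /qrate ifT; last by apply/asboolP; exact: qgraphon_Omega_class.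
apply: ge_ereal_sup => _ [eta eta0 <-]; apply: ereal_inf_lbound; exists g => //.
split; first exact: gg.
by rewrite qcut_distE (cut_distC gR gg) dR; exact: ltW.
Qed.

Lemma Omega_pinned g i j : graphon_Omega W0 g -> ~ (0 < p i j < 1) ->
  Ex2 (fun z => rect_ind gam i j z * `|kernel_ext g z - p i j|) = 0.
Proof.
move=> [gg gW0] pij.
have bP : bmeas (fun z => rect_ind gam i j z * `|kernel_ext g z - p i j|).
  apply: bmeasM; first exact: bmeas_rect_ind.
  apply: bmeas_norm; apply: bmeasB; last exact: bmeas_cst.
  exact: bmeas_kernel_ext.
apply: EFin_inj; rewrite -integral_EFin_Ex2 //.
rewrite (ae_eq_integral (cst 0%E)) ?integral0 //.
- exact: measurable_unitI2.
- by apply/measurable_EFinP/measurable_funTS; have [] := bP.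
case: gW0 => N [mN N0 sub]; exists N; split => // -[x y] nz; apply: sub.
apply: contra_not nz => gW0 Uxy; have [/= Ux Uy] := Uxy.
have [k bk] := ex_block gamP Ux; have [l bl] := ex_block gamP Uy.
rewrite (rect_ind_in gamP _ _ bk bl); case: andP => [[/eqP ik /eqP jl]|_]; last by rewrite mul0r.
rewrite kernel_extE // gW0; first by rewrite (W0p bk bl) ik jl subrr normr0 mulr0.
by split => // -[_]; rewrite (W0p bk bl) -ik -jl.
Qed.

Variables (v d : nat) (H : rel 'I_v).
Hypothesis d0 : (0 < d)%N.
Hypothesis sH : simple_graph H.
Hypothesis rH : regular_graph d H.
Local Notation t := (hom_density H).

(** Interpolates between [W0] at [s = 0] and the graphon that replaces [W0] by 1
    on [Omega], at [s = 1]. *)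
Definition raised (s : R) i j : R :=
  p i j + s * (if 0 < p i j < 1 then 1 - p i j else 0).

Lemma raised01 s i j : 0 <= s <= 1 -> 0 <= raised s i j <= 1.
Proof.
move=> /andP[s0 s1]; have /andP[p0 p1] := p01 i j; rewrite /raised.
by case: ifP => _; apply/andP; split; nra.
Qed.

Lemma raisedC s i j : raised s i j = raised s j i.
Proof. by rewrite /raised pC. Qed.

Lemma block_norm_null (g : R * R -> R) i j : len i * len j = 0 -> block_norm gam d g i j = 0.
Proof.
move=> /eqP; rewrite mulf_eq0 => l0; rewrite /block_norm /block_avg.
rewrite (_ : (len i)^-1 * _ = 0); first by rewrite /root_d powR0 // invr_neq0 // pnatr_eq0 -lt0n.
case/orP: l0 => /eqP ->; first by rewrite invr0 mul0r.
rewrite invr0; under eq_fun do rewrite mul0r mulr0.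
by rewrite Ex_cst mulr0.
Qed.

(** Only block norms count; they are at most 1 on [Omega] and pinned elsewhere. *)
Lemma hom_density_Omega_le g : graphon_Omega W0 g ->
  t g <= t (step_kernel gam (raised 1)).
Proof.
move=> gO; have [gg _] := gO; have bF := bmeas_kernel_ext gg.
have F01 z : 0 <= kernel_ext g z <= 1 by rewrite kernel_ext_ge0 ?kernel_ext_le1.
have FC x y : kernel_ext g (x, y) = kernel_ext g (y, x) by exact: kernel_ext_sym.
apply: le_trans (hom_density_le_block_norm gamP d0 sH rH gg) _.
rewrite (hom_density_step gamP H (fun i j x y bi bj => step_kernelE gamP (raised 1) bi bj)).
apply: le_block_sum => // s; apply: ler_prod => e _.
rewrite root_d_ge0 /=; move: (tnth s e.1) (tnth s e.2) => i j.
have [l0|l0] := eqVneq (len i * len j) 0.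
  have s11 : 0 <= (1 : R) <= 1 by rewrite ler01 lexx.
  by rewrite block_norm_null //; case/andP: (raised01 i j s11).
have l0' : 0 < len i * len j by rewrite lt_def l0 len2_ge0.
rewrite /raised; have [pij|/negP pij] := boolP (0 < p i j < 1).
  by rewrite mul1r addrC subrK block_norm_le1.
by rewrite mulr0 addr0 (block_norm_pinned gamP p01 d0 gg l0' (Omega_pinned gO pij)).
Qed.

Lemma block_sum_comb n (P Q : n.-tuple 'I_m -> R) x y :
  block_sum gam (fun s => x * P s + y * Q s) = x * block_sum gam P + y * block_sum gam Q.
Proof.
elim: n P Q => [//|n IHn] P Q /=.
rewrite !big_distrr -big_split; apply: eq_bigr => a _ /=.
by rewrite IHn; ring.
Qed.

(** A polynomial in [s] of degree at most [size l] with nonnegative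
    coefficients lies above this interpolation of its values at 0 and 1, as
    [s ^+ k >= s ^+ size l] for each exponent [k] that occurs. *)
Lemma prod_interp (I : Type) (l : seq I) (a b : I -> R) s :
  (forall i, 0 <= a i) -> (forall i, 0 <= b i) -> 0 <= s <= 1 ->
  (1 - s ^+ size l) * \prod_(i <- l) a i + s ^+ size l * \prod_(i <- l) (a i + b i)
  <= \prod_(i <- l) (a i + s * b i).
Proof.
move=> a0 b0 /andP[s0 s1]; elim: l => [|i l IHl].
  by rewrite !big_nil expr0 subrr mul0r add0r mul1r.
rewrite !big_cons /= exprS.
have A0 : 0 <= \prod_(j <- l) a j by apply: prodr_ge0.
have AB : \prod_(j <- l) a j <= \prod_(j <- l) (a j + b j).
  by apply: ler_prod => j _; rewrite a0 lerDl b0.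
have sn0 : 0 <= s ^+ size l by exact: exprn_ge0.
have sn1 : s ^+ size l <= 1 by exact: exprn_ile1.
have ab0 : 0 <= a i + s * b i by rewrite addr_ge0 // mulr_ge0.
apply: le_trans (ler_wpM2l ab0 IHl).
move: (a0 i) (b0 i) AB A0 sn0 sn1.
move: (a i) (b i) (\prod_(j <- l) a j) (\prod_(j <- l) (a j + b j)) (s ^+ size l).
move=> x y A B n x0 y0 AB A0 n0 n1.
have h1 : 0 <= x * n * (1 - s) * (B - A) by rewrite !mulr_ge0 ?subr_ge0.
have h2 : 0 <= s * y * (1 - n) * A by rewrite !mulr_ge0 ?subr_ge0.
rewrite -subr_ge0; apply: le_trans (addr_ge0 h1 h2) _.
by rewrite le_eqVlt; apply/orP; left; apply/eqP; ring.
Qed.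

Lemma hom_density_raised s : 0 <= s <= 1 ->
  t W0 + s ^+ size (edges H) * (t (step_kernel gam (raised 1)) - t W0) <=
  t (step_kernel gam (raised s)).
Proof.
move=> s01.
rewrite !(hom_density_step gamP H (fun i j x y bi bj => step_kernelE gamP (raised _) bi bj)).
rewrite (hom_density_step gamP H W0p).
set A := block_sum _ _; set B := block_sum _ _; set n := size _.
rewrite (_ : A + _ = (1 - s ^+ n) * A + s ^+ n * B); last by ring.
rewrite -block_sum_comb; apply: le_block_sum => // w.
pose b (e : 'I_v * 'I_v) := if 0 < p (tnth w e.1) (tnth w e.2) < 1
  then 1 - p (tnth w e.1) (tnth w e.2) else 0.
have b0 e : 0 <= b e.
  rewrite /b; case: ifP => // _; rewrite subr_ge0.
  by case/andP: (p01 (tnth w e.1) (tnth w e.2)).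
rewrite (eq_bigr (fun e => p (tnth w e.1) (tnth w e.2) + b e) (F1 := fun e => raised 1 _ _)).
  by apply: prod_interp => // e; case/andP: (p01 (tnth w e.1) (tnth w e.2)).
by move=> e _; rewrite /raised mul1r.
Qed.

End BlockClasses.

(** * Minimizers of small rate *)

Section Minimizers.
Context {R : realType}.
Variables (m : nat) (gam : 'I_m -> rat).
Hypothesis gamP : rat_simplex gam.
Local Notation len := (@block_len R m gam).
Variables (p : 'I_m -> 'I_m -> R) (W0 : R * R -> R).
Hypothesis p01 : forall i j, 0 <= p i j <= 1.
Hypothesis pC : forall i j, p i j = p j i.
Hypothesis W0p : forall i j x y, block gam i x -> block gam j y -> W0 (x, y) = p i j.
Variables (v d : nat) (H : rel 'I_v).
Hypothesis d0 : (0 < d)%N.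
Hypothesis sH : simple_graph H.
Hypothesis rH : regular_graph d H.
Local Notation t := (hom_density H).
Local Notation E := ((size (edges H))%:R : R).
Local Notation q h := (block_norm gam d (kernel_ext h)).

Lemma rate_ge0 (h : R * R -> R) : graphon h -> (0 <= rate W0 h)%E.
Proof.
move=> [_ _ h01]; apply: mule_ge0; first by rewrite lee_fin invr_ge0.
by apply: integral_ge0 => z Uz; apply: rel_entropy_ge0; exact: h01.
Qed.

Lemma block_norm_q01 (h : R * R -> R) i j : graphon h -> 0 <= q h i j <= 1.
Proof.
move=> gh; apply: block_norm01 => //; first exact: bmeas_kernel_ext.
by move=> z; rewrite kernel_ext_ge0 ?kernel_ext_le1.
Qed.

Lemma block_norm_qC (h : R * R -> R) i j : graphon h -> q h i j = q h j i.
Proof.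
move=> gh.
have F01 z : 0 <= kernel_ext h z <= 1 by rewrite kernel_ext_ge0 ?kernel_ext_le1.
have FC x y : kernel_ext h (x, y) = kernel_ext h (y, x) by exact: kernel_ext_sym.
exact: (label_kernelC gam d (bmeas_kernel_ext gh) FC (inr i) (inr j)).
Qed.

Lemma hom_density_step_close (a b : 'I_m -> 'I_m -> R) e :
  (forall i j, a i j = a j i) -> (forall i j, 0 <= a i j <= 1) ->
  (forall i j, b i j = b j i) -> (forall i j, 0 <= b i j <= 1) ->
  (forall i j, `|a i j - b i j| * (len i * len j) <= e * (len i * len j)) ->
  t (step_kernel gam a) <= t (step_kernel gam b) + E * e.
Proof.
move=> aC a01 bC b01 ab.
have [ga _] := graphon_step_kernel gamP aC a01.
have [gb _] := graphon_step_kernel gamP bC b01.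
rewrite -lerBlDl; apply: le_trans (ler_norm _) _.
apply: le_trans (counting_lemma H ga gb) _; apply: ler_wpM2l; first exact: ler0n.
apply: le_trans (cut_metric_L1 ga gb) _.
rewrite (step_dist gamP (step_kernelE gamP a)
  (step_kernelE gamP b)).
rewrite -[leRHS]mulr1 -(sum_len2 gamP) big_distrr; apply: ler_sum => i _ /=.
by rewrite big_distrr; apply: ler_sum => j _; exact: ab.
Qed.

(** The rate of a class is the supremum of the infima of the rate over the cut
    balls around it, so no such infimum exceeds it. *)
Lemma qrate_approx c J e : qrate W0 c = J%:E -> 0 < e ->
  exists h, [/\ graphon h, cut_dist (rep c) h <= e & (rate W0 h < (J + e)%:E)%E].
Proof.
rewrite /qrate; case: ifPn => // _ JE e0.
set S := [set rate W0 h | h in [set h | graphon h /\ qcut_dist c h <= e]].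
have : (ereal_inf S < (J + e)%:E)%E.
  apply: (@le_lt_trans _ _ J%:E); last by rewrite lte_fin ltrDl.
  by rewrite -JE; apply: ereal_sup_ubound; exists e.
by move=> /ereal_inf_lt[_ [h [gh ch] <-] lt]; exists h.
Qed.

(** Radii around the values of [W0] within which the tangents of
    [entropy_support] exist. *)
Definition supporting (rho : 'I_m -> 'I_m -> R) : Prop :=
  (forall i j, 0 < rho i j) /\
  forall i j r, 0 < p i j < 1 -> `|r - p i j| <= rho i j -> 0 < r < 1 /\
    exists s, forall u, 0 <= u <= 1 ->
      entropy (p i j) r + s * (u ^+ d - r ^+ d) + (u - r) ^+ 2 / 4 <= entropy (p i j) u.

Lemma ex_supporting : exists rho, supporting rho.
Proof.
have /choice[rho rhoP] (ij : 'I_m * 'I_m) : exists rho : R, 0 < rho /\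
    forall r, 0 < p ij.1 ij.2 < 1 -> `|r - p ij.1 ij.2| <= rho -> 0 < r < 1 /\
    exists s, forall u, 0 <= u <= 1 ->
      entropy (p ij.1 ij.2) r + s * (u ^+ d - r ^+ d) + (u - r) ^+ 2 / 4
      <= entropy (p ij.1 ij.2) u.
  have [pij|pij] := boolP (0 < p ij.1 ij.2 < 1); last by exists 1.
  by have [rho rho0 rhoP] := entropy_support pij d0; exists rho; split => // r _ /rhoP.
exists (fun i j => rho (i, j)); split=> i j; first by have [] := rhoP (i, j).
by have [_] := rhoP (i, j).
Qed.

Section cluster.
Variables (rho : 'I_m -> 'I_m -> R) (kappa : R).
Hypothesis rhoP : supporting rho.
Hypothesis near_p : forall h, graphon h -> (rate W0 h <= kappa%:E)%E ->
  forall i j, 0 < p i j < 1 -> 0 < len i * len j -> `|q h i j - p i j| <= rho i j.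

Variables (h : nat -> R * R -> R).
Hypothesis gh : forall n, graphon (h n).
Hypothesis rh : forall n, (rate W0 (h n) <= kappa%:E)%E.

(** The cluster point is overwritten by [p] where [W0] is 0 or 1, as the norms
    are pinned there, and on null blocks, where the norms carry no
    information. *)
Lemma cluster_values : exists r : 'I_m -> 'I_m -> R,
  [/\ forall i j, r i j = r j i,
      forall i j, `|r i j - p i j| <= rho i j,
      forall i j, ~ (0 < p i j < 1) -> r i j = p i j &
      forall e N, 0 < e -> exists2 n, (N <= n)%N & forall i j,
        `|q (h n) i j - r i j| * (len i * len j) <= e * (len i * len j)].
Proof.
have [rho0 _] := rhoP.
have [|r0 r0P] := @finite_cluster R ('I_m * 'I_m)%type (fun n ij => q (h n) ij.1 ij.2).
  by move=> n ij; exact: block_norm_q01.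
pose ok i j := (0 < p i j < 1) && (0 < len i * len j).
have r0C i j : r0 (i, j) = r0 (j, i).
  apply/eqP; rewrite -subr_eq0 -normr_le0; apply/ler_addgt0Pr => e e0.
  have e2 : 0 < e / 2 by rewrite divr_gt0.
  have [n _ nP] := r0P (e / 2) 0%N e2; have := nP (i, j); have := nP (j, i).
  rewrite /= (block_norm_qC i j (gh n)) add0r; move: (q _ _ _) => x.
  rewrite !ltr_norml ler_norml => /andP[h1 h2] /andP[h3 h4].
  by apply/andP; split; lra.
exists (fun i j => if ok i j then r0 (i, j) else p i j); split.
- by move=> i j; rewrite /ok pC mulrC r0C.
- move=> i j; case: ifPn => [/andP[pij ll]|_]; last by rewrite subrr normr0 ltW.
  apply/ler_addgt0Pr => e e0; have [n _ /(_ (i, j)) /= nP] := r0P e 0%N e0.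
  have := near_p (gh n) (rh n) pij ll.
  move: nP; move: (q _ _ _) (r0 _) (p i j) (rho i j) => x y z w.
  rewrite ltr_norml !ler_norml => /andP[h1 h2] /andP[h3 h4].
  by apply/andP; split; lra.
- by move=> i j /negP/negbTE pij; rewrite /ok pij.
move=> e N e0; have [n Nn nP] := r0P e N e0; exists n => // i j.
have [l0|l0] := eqVneq (len i * len j) 0; first by rewrite l0 !mulr0.
have l0' : 0 < len i * len j by rewrite lt_def l0 len2_ge0.
apply: ler_wpM2r; first exact: ltW.
rewrite /ok l0' andbT; have [pij|/negP pij] := boolP (0 < p i j < 1).
  by apply: ltW; exact: (nP (i, j)).
have hoo : (rate W0 (h n) < +oo)%E by apply: le_lt_trans (rh n) _; exact: ltry.
have E0 := rect_dist_null gamP W0p (gh n) hoo pij.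
by rewrite (block_norm_pinned gamP p01 d0 (gh n) l0' E0) subrr normr0 ltW.
Qed.

End cluster.

(** The weighted inequality of arithmetic and geometric means stands in for the
    Cauchy--Schwarz inequality. *)
Lemma ler_norm_Ex2_sqr (F : R * R -> R) eta : bmeas F -> 0 < eta ->
  Ex2 (fun z => `|F z|) <= eta + Ex2 (fun z => F z ^+ 2) / eta.
Proof.
move=> bF eta0; have bF2 : bmeas (fun z => F z ^+ 2) by exact: bmeasX.
rewrite mulrC -Ex2Z // -[X in X + _](Ex2_cst eta) -Ex2D; last 2 first.
- exact: bmeas_cst.
- by apply: bmeasM => //; exact: bmeas_cst.
apply: le_Ex2; first exact: bmeas_norm.
  by apply: bmeasD; [exact: bmeas_cst|apply: bmeasM => //; exact: bmeas_cst].
move=> z _; rewrite -(real_normK (num_real (F z))).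
move: `|_| (normr_ge0 (F z)) => w w0.
rewrite -(ler_pM2l eta0) mulrDr mulVKf ?gt_eqF //; nra.
Qed.

(** The symmetry statement for minimizers of small rate: the limit of the
    block norms is a competitor, and the strict part of the convexity estimate
    forces the near-minimizers to converge to it. *)
Lemma minimizer_block rho kappa x c : supporting rho -> 0 < kappa ->
  (forall h, graphon h -> (rate W0 h <= kappa%:E)%E ->
     forall i j, 0 < p i j < 1 -> 0 < len i * len j -> `|q h i j - p i j| <= rho i j) ->
  minimizer W0 t x c -> (qrate W0 c <= (kappa / 2)%:E)%E ->
  exists h, [/\ block_graphon gam h, c h, cut_dist (rep c) h = 0,
    qrate W0 c = rate W0 h & x <= t h].
Proof.
move=> rhoP kappa0 near_p [[f0 gf0 cE] xc cmin] ck.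
have [gg0 df0] := rep_class gf0; rewrite cE in gg0 df0.
rewrite liftE in xc; set g0 := rep c in xc gg0 df0 *.
have k2 : 0 < kappa / 2 by rewrite divr_gt0.
have Jfin : qrate W0 c \is a fin_num.
  rewrite ge0_fin_numE; first by apply: le_lt_trans ck _; exact: ltry.
  move: ck; rewrite /qrate; case: ifPn => // _ _.
  apply: le_trans (ereal_sup_ubound _); last by exists 1 => //=; exact: ltr01.
  by apply: le_ereal_inf_tmp => _ [h [gh _] <-]; exact: rate_ge0.
pose J := fine (qrate W0 c); have JE : qrate W0 c = J%:E by rewrite fineK.
have Jk : J <= kappa / 2 by rewrite -lee_fin -JE.
(* Besides tending to zero, the errors keep the rates below [kappa], where the
   block norms are close to [p]. *)
pose e n := Num.min (mesh n) (kappa / 2) : R.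
have e0 n : 0 < e n by rewrite lt_min mesh_gt0.
have /choice[h hP] n := qrate_approx JE (e0 n).
have gh n : graphon (h n) by have [] := hP n.
have rh n : (rate W0 (h n) <= kappa%:E)%E.
  have [_ _ /ltW /le_trans] := hP n; apply; rewrite lee_fin.
  have : e n <= kappa / 2 by rewrite ge_min lexx orbT.
  by move: (e n) => z; lra.
have [r [rC rrho rp rlim]] := cluster_values rhoP near_p gh rh.
have [_ support] := rhoP.
have r01 i j : 0 <= r i j <= 1.
  have [pij|/negP pij] := boolP (0 < p i j < 1); last by rewrite rp.
  by have [/andP[/ltW -> /ltW ->] _] := support i j (r i j) pij (rrho i j).
have bh := graphon_step_kernel gamP rC r01; set hs := step_kernel gam r in bh.
have [ghs _] := bh.
have pick eps : 0 < eps -> exists n, e n <= eps /\ forall i j,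
    `|q (h n) i j - r i j| * (len i * len j) <= eps * (len i * len j).
  move=> eps0; have [N NP] := lt_add_mesh eps0; rewrite add0r in NP.
  have [n Nn nP] := rlim eps N eps0; exists n; split => //.
  apply: (@le_trans _ _ (mesh n)); first by rewrite ge_min lexx.
  apply: le_trans (ltW NP); rewrite lef_pV2 ?posrE ?ltr0n // ler_nat.
  by rewrite ltnS.
have E0 : 0 <= E by exact: ler0n.
(* The constraint passes from the class to [h n], to its block norms, to [r]. *)
have xhs : x <= t hs.
  apply: le_trans xc _; apply/ler_addgt0Pr => eps eps0.
  have E1 : 0 < 2 * E + 1 by rewrite ltr_wpDl // mulr_ge0.
  have [n [en nP]] := pick (eps / (2 * E + 1)) (divr_gt0 eps0 E1).
  set eps' := eps / _ in en nP.
  have [_ dn _] := hP n.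
  have h1 : t g0 <= t (h n) + E * eps'.
    rewrite -lerBlDl; apply: le_trans (ler_norm _) _.
    apply: le_trans (hom_density_cut_dist H gg0 (gh n)) _.
    by apply: ler_wpM2l => //; exact: le_trans dn en.
  have h2 : t (h n) <= t (step_kernel gam (q (h n))).
    rewrite (hom_density_step gamP H (step_kernelE gamP (q (h n)))).
    exact: hom_density_le_block_norm.
  have h3 : t (step_kernel gam (q (h n))) <= t hs + E * eps'.
    exact: (hom_density_step_close (fun i j => block_norm_qC i j (gh n))
      (fun i j => block_norm_q01 i j (gh n)) rC r01 nP).
  apply: le_trans h1 _; apply: le_trans (lerD (le_trans h2 h3) (lexx _)) _.
  rewrite -addrA lerD2l (_ : E * eps' + E * eps' = eps * (2 * E / (2 * E + 1))); last first.
    by rewrite /eps'; field; rewrite gt_eqF.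
  apply: ler_piMr; first exact: ltW.
  by rewrite ler_pdivrMr // mul1r lerDl.
have hsp i j : 0 < p i j < 1 \/ r i j = p i j.
  by have [pij|/negP pij] := boolP (0 < p i j < 1); [left|right; exact: rp].
have rateE := rate_step gamP W0p (step_kernelE gamP r) hsp.
set I := _ / 2 in rateE; rewrite -/hs in rateE.
have JI : J <= I.
  rewrite -lee_fin -JE -rateE; apply: le_trans (qrate_class_le gamP p01 pC W0p bh).
  have [gr dr] := rep_class ghs.
  apply: cmin; first by exists hs.
  by rewrite liftE -(hom_density_dist0 H ghs gr dr).
have /choice[s sP] (ij : 'I_m * 'I_m) : exists s : R,
    (0 < p ij.1 ij.2 < 1 -> forall u, 0 <= u <= 1 ->
      entropy (p ij.1 ij.2) (r ij.1 ij.2) + s * (u ^+ d - r ij.1 ij.2 ^+ d) +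
      (u - r ij.1 ij.2) ^+ 2 / 4 <= entropy (p ij.1 ij.2) u) /\
    (~ (0 < p ij.1 ij.2 < 1) -> s = 0).
  have [pij|/negP pij] := boolP (0 < p ij.1 ij.2 < 1); last by exists 0.
  have [_ [s sP]] := support _ _ _ pij (rrho ij.1 ij.2).
  by exists s; split => [_|/(_ isT)]; first exact: sP.
pose C := d%:R * \sum_i \sum_j `|s (i, j)|.
have C0 : 0 <= C.
  by rewrite mulr_ge0 ?ler0n // sumr_ge0 // => i _; rewrite sumr_ge0.
pose Q n := Ex2 (fun z => (kernel_ext (h n) z - hs z) ^+ 2).
have Q0 n : 0 <= Q n by apply: Ex2_ge0 => z _; exact: sqr_ge0.
(* The tangent term vanishes as the block norms approach [r]. *)
have key n eps : e n <= eps -> (forall i j,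
    `|q (h n) i j - r i j| * (len i * len j) <= eps * (len i * len j)) ->
    I + Q n / 8 <= J + eps * (1 + C / 2).
  move=> en nP.
  have := rate_tangent gamP W0p (r := r) (s := fun i j => s (i, j)) d0 (gh n)
    (fun i j => (sP (i, j)).1) (fun i j pij => conj (rp i j pij) ((sP (i, j)).2 pij)).
  have [_ _ /ltW rn] := hP n; move=> /le_trans/(_ rn); rewrite lee_fin -/I -/hs -/(Q n).
  set S := \sum_i _.
  have SC : `|S| <= eps * C.
    rewrite /S /C mulrCA big_distrr; apply: le_trans (ler_norm_sum _ _ _) _.
    rewrite mulrC big_distrl; apply: ler_sum => i _ /=.
    rewrite big_distrr big_distrl; apply: le_trans (ler_norm_sum _ _ _) _.
    apply: ler_sum => j _ /=.
    have ll := len2_ge0 (R := R) gamP i j.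
    rewrite normrM [X in _ * X <= _]normrM (ger0_norm ll).
    have ll1 : len i * len j <= 1.
      rewrite -(sum_len2 gamP) (bigD1 i) //= (bigD1 j) //= -addrA lerDl addr_ge0 //.
        by rewrite sumr_ge0 // => k _; exact: len2_ge0.
      by rewrite sumr_ge0 // => k _; rewrite sumr_ge0 // => l _; exact: len2_ge0.
    have lip := pow_lipschitz d (block_norm_q01 i j (gh n)) (r01 i j).
    have := ler_wpM2l ll lip; have := nP i j.
    have dR : 0 <= d%:R :> R by exact: ler0n.
    have eps0 : 0 <= eps by apply: le_trans en; exact: ltW.
    rewrite [X in _ -> _ -> _ <= X](_ : _ = `|s (i, j)| * (eps * d%:R)); last by ring.
    move=> n1 n2; apply: ler_wpM2l => //; apply: le_trans n2 _.
    rewrite mulrCA [eps * _]mulrC; apply: ler_wpM2l => //.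
    rewrite mulrC; apply: le_trans n1 _; exact: ler_piMr.
  move: SC; rewrite ler_norml => /andP[SC _]; move: SC.
  by move: S (Q n) (e n) en => S' Q' e' en SC; nra.
have IJ : I = J.
  apply/eqP; rewrite eq_le JI andbT; apply/ler_addgt0Pr => eps eps0.
  have C1 : 0 < 1 + C / 2 by rewrite ltr_wpDr // divr_ge0.
  have [n [en nP]] := pick (eps / (1 + C / 2)) (divr_gt0 eps0 C1).
  have := key n _ en nP; rewrite divfK ?gt_eqF // => /(le_trans _); apply.
  by rewrite lerDl divr_ge0.
have dist0 : cut_dist g0 hs = 0.
  apply/eqP; rewrite eq_le cut_dist_ge0 // andbT; apply/ler_addgt0Pr => eps eps0.
  rewrite add0r; pose eta := eps / 3; have eta0 : 0 < eta by rewrite divr_gt0.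
  have C1 : 0 < 8 * (1 + C / 2) by rewrite mulr_gt0 // ltr_wpDr // divr_ge0.
  have [|n [en nP]] := pick (Num.min eta (eta ^+ 2 / (8 * (1 + C / 2)))).
    by rewrite lt_min eta0 divr_gt0 // exprn_gt0.
  have Qn : Q n <= eta ^+ 2.
    have := key n _ en nP; set mn := Num.min _ _.
    have : mn <= eta ^+ 2 / (8 * (1 + C / 2)) by rewrite ge_min lexx orbT.
    rewrite ler_pdivlMr // IJ; move: mn (Q n) => u w; lra.
  have [_ dn _] := hP n.
  apply: le_trans (cut_dist_L1 gg0 (gh n) ghs) _.
  have -> : eps = eta + (eta + eta) by rewrite /eta; field.
  apply: lerD.
    by apply: le_trans dn (le_trans en _); rewrite ge_min lexx.
  rewrite (_ : Ex2 _ = Ex2 (fun z => `|kernel_ext (h n) z - hs z|)); last first.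
    apply: eq_Ex2 => z Uz; rewrite /kernel_diff.
    by rewrite (kernel_ext_step gamP Uz (step_kernelE gamP r)).
  apply: le_trans (ler_norm_Ex2_sqr _ eta0) _.
    by apply: bmeasB; [exact: bmeas_kernel_ext|exact: bmeas_step_kernel].
  by rewrite lerD2l -/(Q n) ler_pdivrMr // -expr2.
exists hs; split => //; last by rewrite JE rateE IJ.
rewrite -cE; exact: (conj ghs (cut_dist0_trans gf0 gg0 ghs df0 dist0)).
Qed.

End Minimizers.

(** * Competitors of small rate *)

Section Competitors.
Context {R : realType}.
Variables (m : nat) (gam : 'I_m -> rat).
Hypothesis gamP : rat_simplex gam.
Local Notation len := (@block_len R m gam).
Variables (p : 'I_m -> 'I_m -> R) (W0 : R * R -> R).
Hypothesis p01 : forall i j, 0 <= p i j <= 1.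
Hypothesis pC : forall i j, p i j = p j i.
Hypothesis W0p : forall i j x y, block gam i x -> block gam j y -> W0 (x, y) = p i j.

(** The entropy is bounded by the square of the deviation from [p]. *)
Lemma rate_raised : exists2 C : R, 0 <= C & forall s, 0 <= s <= 1 ->
  (rate W0 (step_kernel gam (raised p s)) <= (C * s ^+ 2)%:E)%E.
Proof.
pose c i j := if 0 < p i j < 1 then (1 - p i j) ^+ 2 * ((p i j)^-1 + (1 - p i j)^-1) else 0.
have c0 i j : 0 <= c i j.
  rewrite /c; case: ifP => // /andP[p0 p1].
  by rewrite mulr_ge0 ?sqr_ge0 // addr_ge0 // invr_ge0 ?subr_ge0 ltW.
have S0 : 0 <= \sum_i \sum_j c i j * (len i * len j).
  by apply: sumr_ge0 => i _; apply: sumr_ge0 => j _; rewrite mulr_ge0 // len2_ge0.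
exists ((\sum_i \sum_j c i j * (len i * len j)) / 2); first by rewrite divr_ge0.
move=> s s01.
rewrite (rate_step gamP W0p (step_kernelE gamP (raised p s))); last first.
  move=> i j; rewrite /raised; case: ifP => _; first by left.
  by right; rewrite mulr0 addr0.
rewrite lee_fin mulrAC; apply: ler_wpM2r; first by rewrite invr_ge0.
rewrite (Ex2_step gamP) big_distrl; apply: ler_sum => i _ /=.
rewrite big_distrl; apply: ler_sum => j _ /=; rewrite [leRHS]mulrAC.
apply: ler_wpM2r; first exact: len2_ge0.
have u01 := raised01 p01 i j s01.
rewrite /cost /c; case: ifP => pij; last by rewrite mul0r.
apply: le_trans (entropy_le pij u01) _.
rewrite /raised pij le_eqVlt; apply/orP; left; apply/eqP; ring.
Qed.

(** With [s] as the raise and [e] as the number of edges, the density grows at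
    least by a constant times [s ^+ e]. *)
Lemma ex_cheap_block (v d : nat) (H : rel 'I_v) kappa : (0 < d)%N ->
  simple_graph H -> regular_graph d H -> 0 < kappa ->
  (exists2 g, graphon_Omega W0 g & hom_density H W0 < hom_density H g) ->
  exists h x, [/\ block_graphon gam h, (rate W0 h <= kappa%:E)%E,
    hom_density H W0 < x & x <= hom_density H h].
Proof.
move=> d0 sH rH k0 [g gO tg].
have lt1 := lt_le_trans tg (hom_density_Omega_le gamP p01 W0p d0 sH rH gO).
have [C C0 Cs] := rate_raised.
have C1 : 0 < C + 1 by rewrite ltr_wpDl.
pose s := Num.min 1 (kappa / (C + 1)).
have s0 : 0 < s by rewrite lt_min ltr01 divr_gt0.
have s1 : s <= 1 by rewrite ge_min lexx.
have s01 : 0 <= s <= 1 by rewrite ltW.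
have sk : s <= kappa / (C + 1) by rewrite ge_min lexx orbT.
exists (step_kernel gam (raised p s)).
exists (hom_density H W0 + s ^+ size (edges H) *
  (hom_density H (step_kernel gam (raised p 1)) - hom_density H W0)).
split.
- by apply: graphon_step_kernel => // i j; [exact: raisedC|exact: raised01].
- apply: le_trans (Cs s s01) _; rewrite lee_fin.
  move: sk; rewrite ler_pdivlMr // => sk; apply: le_trans sk.
  have : s ^+ 2 <= s by rewrite expr2 ger_pMr.
  by move: (s ^+ 2) => u us; nra.
- by rewrite ltrDl mulr_gt0 ?exprn_gt0 // subr_gt0.
- exact: hom_density_raised.
Qed.

End Competitors.

Lemma tmax_lt (R : realType) (W0 : R * R -> R) v (H : rel 'I_v) x : 0 <= x ->
  x < tmax W0 (hom_density H) ->
  exists2 g, graphon_Omega W0 g & x < hom_density H g.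
Proof.
move=> x0; rewrite /tmax; set A := [set _ | _ in _] => xA.
have A0 : A !=set0.
  by apply/set0P/eqP => A0; move: xA; rewrite A0 sup0 ltNge x0.
have [_ [c [cq [g gO cg]] <-] xc] := sup_gt A0 xA.
exists g => //; have [f gf cf] := cq; have [gr _] := rep_class gf.
rewrite cf in gr; have [gg _] := gO.
by move: xc; rewrite liftE (hom_density_dist0 H gr gg cg).
Qed.

Lemma hom_density_0regular (R : realType) (f g : R * R -> R) v (H : rel 'I_v) :
  regular_graph 0 H -> graphon f -> graphon g -> hom_density H f = hom_density H g.
Proof.
move=> rH gf gg; have := counting_lemma H gf gg.
have /size0nil -> : size (edges H) = 0%N.
  apply/eqP; rewrite size_eq0 /edges; apply/negPn/negP; rewrite -has_filter.
  case/hasP => -[i j] _ /andP[_ /= Hij]; have /eqP := rH i.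
  by rewrite cards_eq0 => /eqP/setP/(_ j); rewrite !inE Hij.
by rewrite mul0r normr_le0 subr_eq0 => /eqP.
Qed.

(** * The symmetric regime *)

Theorem theorem1p19 (R : realType) (m : nat) (gam : 'I_m -> rat)
    (W0 : R * R -> R) (v d : nat) (H : rel 'I_v) :
  (0 < m)%N -> rat_simplex gam -> block_graphon_star gam W0 ->
  simple_graph H -> regular_graph d H ->
  hom_density H W0 < tmax W0 (hom_density H) ->
  exists2 delta : R, 0 < delta &
    forall t : R,
      hom_density H W0 <= t < (1 + delta) * hom_density H W0 ->
      symmetric_regime gam W0 (hom_density H) t /\
      (forall c, minimizer W0 (hom_density H) t c ->
         exists h, [/\ block_graphon gam h, c h,
           qrate W0 c = rate W0 h &
           is_min [set rate W0 g | g in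
                     [set g | block_graphon gam g /\ t <= hom_density H g]]
                  (rate W0 h)]).
Proof.
move=> _ gamP [[gW0 [p [pC p01 W0p]]] _] sH rH tW0.
have t0 := hom_density_ge0 H gW0.
have [g gO tg] := tmax_lt t0 tW0.
case: d rH => [rH|d rH].
  by move: tg; have [gg _] := gO; rewrite (hom_density_0regular rH gg gW0) ltxx.
have [rho rhoP] := ex_supporting p (ltn0Sn d).
have [kappa k0 near_p] := rate_small_near gamP p01 W0p (ltn0Sn d) rhoP.1.
have k2 : 0 < kappa / 2 by rewrite divr_gt0.
have [G [y [bG rG W0y yG]]] := ex_cheap_block gamP p01 pC W0p (ltn0Sn d) sH rH k2
  (ex_intro2 _ _ g gO tg).
set z := Num.min y (tmax W0 (hom_density H)).
have W0z : hom_density H W0 < z by rewrite lt_min W0y.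
have [delta delta0 deltaP] : exists2 delta, 0 < delta &
    (1 + delta) * hom_density H W0 <= z.
  move: t0; rewrite le_eqVlt => /predU1P[E0|t0].
    (* The range of thresholds is empty for every [delta]. *)
    by exists 1; rewrite // -E0 mulr0 E0 ltW.
  exists ((z - hom_density H W0) / hom_density H W0); first by rewrite divr_gt0 // subr_gt0.
  by rewrite mulrDl mul1r divfK ?gt_eqF // addrC subrK.
exists delta => // x /andP[_ /lt_le_trans/(_ deltaP) xz].
have [xy xmax] : x <= y /\ x <= tmax W0 (hom_density H).
  by move: xz; rewrite lt_min => /andP[/ltW-> /ltW->].
have classP g' : block_graphon gam g' -> x <= hom_density H g' ->
    qgraphon (class_of g') /\ x <= Defs.lift (hom_density H) (class_of g').
  move=> [gg' _] xg'; have [gr dr] := rep_class gg'; split; first by exists g'.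
  by rewrite liftE -(hom_density_dist0 H gg' gr dr).
have main c : minimizer W0 (hom_density H) x c -> exists h,
    [/\ block_graphon gam h, c h, cut_dist (rep c) h = 0,
     qrate W0 c = rate W0 h & x <= hom_density H h].
  move=> cmin.
  apply: (minimizer_block gamP p01 pC W0p (ltn0Sn d) sH rH rhoP k0 near_p cmin).
  have [_ _ least] := cmin; have [Gq xG] := classP G bG (le_trans xy yG).
  apply: le_trans (least _ Gq xG) _.
  by apply: le_trans rG; exact: (qrate_class_le gamP p01 pC W0p).
split.
  split => // c cmin; have [h [bh _ ch _ _]] := main c cmin; have [cq _ _] := cmin.
  by split => //; exists h.
move=> c cmin; have [h [bh ch _ cr xh]] := main c cmin; exists h; split => //.
split; first by exists h.
move=> _ [g' [bg' xg'] <-]; rewrite -cr; have [_ _ least] := cmin.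
have [gq xg] := classP g' bg' xg'.
apply: le_trans (least _ gq xg) _; exact: (qrate_class_le gamP p01 pC W0p).
Qed.
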